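(* Let $(\mathcal{A},\mathcal{B})$ be an abstract boundary control system on $\mathcal{H}$ such that: (1) the disturbance-free operator $\mathcal{A}_0$ is a Riesz-spectral operator, with eigenvalues $\lambda_n$, eigenvectors $\phi_n$ and biorthogonal sequence $\psi_n$, $n\in\mathbb{N}^*$; (2) $N_0\in\mathbb{N}^*$ and $\alpha>0$ are such that $\operatorname{Re}\lambda_n\le-\alpha$ for all $n\ge N_0+1$, and $\xi=\sup_{n\ge N_0+1}\left|\frac{\lambda_n}{\operatorname{Re}\lambda_n}\right|<\infty$; (3) the pair $(A_{N_0},B_{N_0})$ is stabilizable. Let $\varphi\in\mathcal{C}^1(\mathbb{R};\mathbb{R})$ be a transition signal over $[0,t_0]$ for some $t_0>0$. Let $D_0>0$ and $K\in\mathbb{K}^{m\times N_0}$ be such that $A_{\mathrm{cl}}=A_{N_0}+e^{-D_0A_{N_0}}B_{N_0}K$ is Hurwitz. Let $\lambda>0$ and $M_\lambda\ge1$ be such that $\|e^{A_{\mathrm{cl}}t}\|\le M_\lambda e^{-\lambda t}$ for all $t\ge0$, and let $\delta\in(0,D_0)$ be such that $$M_\lambda\|B_{N_0}K\|\left[e^{\|A_{\mathrm{cl}}\|\delta}-e^{-\lambda\delta}\right]<\lambda .$$ Then there exist $\kappa\in(0,\alpha)$ and constants $\overline{C}_i>0$, $1\le i\le6$, such that, for any $D\in\mathcal{C}^1(\mathbb{R}_+;\mathbb{R})$ with $|D-D_0|\le\delta$, any $X_0\in\mathcal{H}$, and any $d_1,d_2\in\mathcal{C}^1(\mathbb{R}_+;\mathbb{K}^m)$,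 the mild solution $(X,u)\in\mathcal{C}^0(\mathbb{R}_+;\mathcal{H})\times\mathcal{C}^1([-D_0-\delta,+\infty);\mathbb{K}^m)$ of the closed-loop system associated with $(D,X_0,d_1,d_2)$ satisfies, for all $t\ge0$, $$\|X(t)\|_{\mathcal{H}}\le\overline{C}_1e^{-\kappa t}\|X_0\|_{\mathcal{H}}+\overline{C}_2\sup_{\tau\in[0,t]}e^{-\kappa(t-\tau)}\|d_1(\tau)\|+\overline{C}_3\sup_{\tau\in[0,\max(t-(D_0-\delta),0)]}e^{-\kappa(t-\tau)}\|d_2(\tau)\|$$ and $$\|u(t)\|\le\overline{C}_4e^{-\kappa t}\|X_0\|_{\mathcal{H}}+\overline{C}_5\sup_{\tau\in[0,t]}e^{-\kappa(t-\tau)}\|d_1(\tau)\|+\overline{C}_6\sup_{\tau\in[0,t]}e^{-\kappa(t-\tau)}\|d_2(\tau)\| .$$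
   Context: Notation: $\mathbb{N}^*$ is the set of positive integers, $\mathbb{R}_+=[0,\infty)$, $\mathbb{K}$ is either $\mathbb{R}$ or $\mathbb{C}$. Spaces $\mathbb{K}^p$ carry the Euclidean norm $\|\cdot\|$ and matrices the induced norm. $(\mathcal{H},\langle\cdot,\cdot\rangle_{\mathcal{H}})$ is a separable Hilbert space over $\mathbb{K}$ (inner product linear in the first argument). For $t_0>0$, $\varphi\in\mathcal{C}^0(\mathbb{R};\mathbb{R})$ is a transition signal over $[0,t_0]$ if $0\le\varphi\le1$, $\varphi=0$ on $(-\infty,0]$ and $\varphi=1$ on $[t_0,+\infty)$. Boundary control system: let $\mathcal{A}:D(\mathcal{A})\subset\mathcal{H}\to\mathcal{H}$ be a linear (unbounded) operator and $\mathcal{B}:D(\mathcal{B})\subset\mathcal{H}\to\mathbb{K}^m$ a linear operator with $D(\mathcal{A})\subset D(\mathcal{B})$. $(\mathcal{A},\mathcal{B})$ is an (abstract) boundary control system if (i) the disturbance-free operator $\mathcal{A}_0=\mathcal{A}|_{D(\mathcal{A}_0)}$, $D(\mathcal{A}_0)=D(\mathcal{A})\cap\ker(\mathcal{B})$, generates a $C_0$-semigroup $S$ on $\mathcal{H}$; (ii) there is a bounded operator $B\in\mathcal{L}(\mathbb{K}^m,\mathcal{H})$ (a lifting operator) with range contained in $D(\mathcal{A})$, $\mathcal{A}B\in\mathcal{L}(\mathbb{K}^m,\mathcal{H})$ and $\mathcal{B}B=I_{\mathbb{K}^m}$. Such a $B$ is fixed. Riesz-spectral operator: a linear closed operator $\mathcal{A}_0$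 with simple eigenvalues $\lambda_n$ and corresponding eigenvectors $\phi_n\in D(\mathcal{A}_0)$, $n\in\mathbb{N}^*$, such that (a) $\{\phi_n\}$ is a Riesz basis: its linear span is dense in $\mathcal{H}$ and there are $m_R,M_R>0$ with $m_R\sum_{n=1}^N|\alpha_n|^2\le\|\sum_{n=1}^N\alpha_n\phi_n\|_{\mathcal{H}}^2\le M_R\sum_{n=1}^N|\alpha_n|^2$ for all $N\ge1$, $\alpha_1,\dots,\alpha_N\in\mathbb{K}$; (b) the closure of $\{\lambda_n\}$ is totally disconnected, i.e. for any distinct $a,b$ in this closure, the segment $[a,b]$ is not contained in it. $\{\psi_n\}$ is the biorthogonal sequence: $\langle\phi_n,\psi_k\rangle_{\mathcal{H}}=\delta_{n,k}$. Truncated model: with $(e_1,\dots,e_m)$ the canonical basis of $\mathbb{K}^m$, set $b_{n,k}=-\lambda_n\langle Be_k,\psi_n\rangle_{\mathcal{H}}+\langle\mathcal{A}Be_k,\psi_n\rangle_{\mathcal{H}}$, $A_{N_0}=\mathrm{diag}(\lambda_1,\dots,\lambda_{N_0})\in\mathbb{K}^{N_0\times N_0}$, $B_{N_0}=(b_{n,k})_{1\le n\le N_0,1\le k\le m}\in\mathbb{K}^{N_0\times m}$. Closed-loop system: $\frac{\mathrm{d}X}{\mathrm{d}t}(t)=\mathcal{A}X(t)$, $\mathcal{B}X(t)=v(t)=u(t-D(t))+d_1(t)$, $X(0)=X_0$ for $t\ge0$, with $$u(t)=\varphi(t)\Big\{KY(t)+d_2(t)+K\int_{\max(t-D_0,0)}^te^{(t-s-D_0)A_{N_0}}B_{N_0}u(s)\,\mathrm{d}s\Big\},\qquad(\ast)$$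 where $Y(t)=[\langle X(t),\psi_1\rangle_{\mathcal{H}},\dots,\langle X(t),\psi_{N_0}\rangle_{\mathcal{H}}]^\top$. Mild solution: given $D\in\mathcal{C}^1(\mathbb{R}_+;\mathbb{R})$ with $|D-D_0|\le\delta$, $X_0\in\mathcal{H}$, $d_1,d_2\in\mathcal{C}^1(\mathbb{R}_+;\mathbb{K}^m)$, a pair $(X,u)\in\mathcal{C}^0(\mathbb{R}_+;\mathcal{H})\times\mathcal{C}^1([-D_0-\delta,+\infty);\mathbb{K}^m)$ is a mild solution associated with $(D,X_0,d_1,d_2)$ if, with $v(t)=u(t-D(t))+d_1(t)$, $$X(t)=S(t)\{X_0-Bv(0)\}+Bv(t)+\int_0^tS(t-s)\{\mathcal{A}Bv(s)-B\dot v(s)\}\,\mathrm{d}s\quad\text{for all }t\ge0,$$ $u=0$ on $[-D_0-\delta,0]$, and $(\ast)$ holds for all $t\ge0$. A unique mild solution exists for all such data. *)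

(* Defs.v *)
From Stdlib Require Import Reals Arith Factorial Lra Lia ssreflect.
From Coquelicot Require Import Coquelicot.
Open Scope R_scope.

Inductive scalar_kind := RealScalars | ComplexScalars.

Definition scalars (k : scalar_kind) : AbsRing :=
  match k with RealScalars => R_AbsRing | ComplexScalars => C_AbsRing end.

Definition ofR (k : scalar_kind) : R -> scalars k :=
  match k with RealScalars => fun r => r | ComplexScalars => RtoC end.

Definition toC (k : scalar_kind) : scalars k -> C :=
  match k with RealScalars => RtoC | ComplexScalars => fun z => z end.

Definition sconj (k : scalar_kind) : scalars k -> scalars k :=
  match k with RealScalars => fun r => r | ComplexScalars => Cconj end.

Definition sRe {k : scalar_kind} (z : scalars k) : R := Re (toC k z).

Lemma ofR_plus k r s : ofR k (r + s) = plus (ofR k r) (ofR k s).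
Proof. by case: k => //=; rewrite RtoC_plus. Qed.

Lemma ofR_mult k r s : ofR k (r * s) = mult (ofR k r) (ofR k s).
Proof. by case: k => //=; rewrite RtoC_mult. Qed.

Lemma ofR_one k : ofR k 1 = one.
Proof. by case: k. Qed.

Lemma abs_ofR k r : abs (ofR k r) = Rabs r.
Proof. by case: k => //=; apply: Cmod_R. Qed.

Definition scalars_lim (k : scalar_kind) :
    ((scalars k -> Prop) -> Prop) -> scalars k :=
  match k with
  | RealScalars => R_complete_lim
  | ComplexScalars => C_complete_lim
  end.

Lemma scalars_complete k (F : (scalars k -> Prop) -> Prop) :
  ProperFilter F ->
  (forall eps : posreal, exists x, F (fun y => abs (minus y x) < eps)) ->
  forall eps : posreal, F (fun y => abs (minus y (scalars_lim k F)) < eps).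
Proof.
case: k F => F FF HF eps.
- exact: (R_complete F FF HF eps).
- have Hs : 0 < sqrt 2 by apply: sqrt_lt_R0; lra.
  have He : 0 < eps / sqrt 2 by apply: Rdiv_lt_0_compat => //; apply: cond_pos.
  have H3 : F (ball (C_complete_lim F) (mkposreal _ He)).
    apply: (C_complete_ax1 F FF) => e.
    case: (HF e) => x Hx; exists x.
    apply: filter_imp Hx => y Hy.
    exact: (C_NormedModule_mixin_compat1 x y e Hy).
  apply: filter_imp H3 => y Hy.
  have := C_NormedModule_mixin_compat2 _ _ (mkposreal _ He) Hy.
  rewrite /=.
  by have -> : sqrt 2 * (eps / sqrt 2) = eps by field; lra.
Qed.

Lemma scalars_lim_ext k (F1 F2 : (scalars k -> Prop) -> Prop) :
  filter_le F1 F2 -> filter_le F2 F1 -> scalars_lim k F1 = scalars_lim k F2.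
Proof.
case: k F1 F2 => F1 F2 H12 H21 /=.
- exact: R_complete_ax2.
- rewrite /C_complete_lim; congr (_, _); apply: R_complete_ax2 => P HP;
    by [apply: H12 | apply: H21].
Qed.

Section MatrixSpace.
Variable k : scalar_kind.
Let K := scalars k.

Lemma coeff_Tn_default T n (x0 : T) (v : Tn n T) i :
  (n <= i)%nat -> coeff_Tn x0 v i = x0.
Proof.
elim: n v i => [|n IH] v [|i] //= Hi; first lia.
by apply: IH; lia.
Qed.

Lemma coeff_mk_Tn T n (x0 : T) (u : nat -> T) i :
  (i < n)%nat -> coeff_Tn x0 (mk_Tn n u) i = u i.
Proof.
elim: n u i => [|n IH] u [|i] //= Hi; try lia.
by rewrite IH //; lia.
Qed.

Lemma coeff_mat_out m n (A : @matrix K m n) i j :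
  (m <= i)%nat \/ (n <= j)%nat -> coeff_mat zero A i j = zero.
Proof.
rewrite /coeff_mat => -[Hi | Hj]; last exact: coeff_Tn_default.
rewrite (coeff_Tn_default _ _ _ A) //.
case: (Nat.lt_ge_cases j n) => Hj; first by rewrite coeff_mk_Tn.
exact: coeff_Tn_default.
Qed.

Lemma coeff_mat_mk m n (u : nat -> nat -> K) i j :
  (forall i j, (m <= i)%nat \/ (n <= j)%nat -> u i j = zero) ->
  coeff_mat zero (mk_matrix m n u) i j = u i j.
Proof.
move=> Hu.
case: (Nat.lt_ge_cases i m) => Hi; last by rewrite Hu ?coeff_mat_out; auto.
case: (Nat.lt_ge_cases j n) => Hj; last by rewrite Hu ?coeff_mat_out; auto.
exact: coeff_mat_bij.
Qed.

Lemma coeff_Mplus m n (A B : @matrix K m n) i j :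
  coeff_mat zero (Mplus A B) i j
  = plus (coeff_mat zero A i j) (coeff_mat zero B i j).
Proof.
rewrite /Mplus coeff_mat_mk // => a b Hab.
by rewrite !coeff_mat_out // plus_zero_r.
Qed.

Lemma coeff_Mopp m n (A : @matrix K m n) i j :
  coeff_mat zero (opp (A : @matrix_AbelianGroup K m n)) i j
  = opp (coeff_mat zero A i j).
Proof.
rewrite /opp /= coeff_mat_mk // => a b Hab.
by rewrite coeff_mat_out // opp_zero.
Qed.

Lemma coeff_Mminus m n (A B : @matrix_AbelianGroup K m n) i j :
  coeff_mat zero (minus A B : @matrix K m n) i j
  = minus (coeff_mat zero A i j) (coeff_mat zero B i j).
Proof. by rewrite /minus /plus /= coeff_Mplus coeff_Mopp. Qed.

Definition mat_scal {m n} (a : K) (A : @matrix K m n) : @matrix K m n :=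
  mk_matrix m n (fun i j => mult a (coeff_mat zero A i j)).

Lemma coeff_mat_scal m n a (A : @matrix K m n) i j :
  coeff_mat zero (mat_scal a A) i j = mult a (coeff_mat zero A i j).
Proof.
rewrite /mat_scal coeff_mat_mk // => b c Hbc.
by rewrite coeff_mat_out // mult_zero_r.
Qed.

(* The Frobenius norm, hence the Euclidean norm on column vectors; the norm
   induced on matrices is [op_norm] below.
   The upper bound [pred n] in [sum_n] is inclusive; for n = 0 the only term is
   the default coefficient [zero]. *)
Definition mat_norm {m n} (A : @matrix K m n) : R :=
  sqrt (sum_n (fun i => sum_n (fun j => abs (coeff_mat zero A i j) ^ 2)
                          (pred n)) (pred m)).

Definition l2 (n : nat) (a : nat -> R) := sqrt (sum_n (fun i => a i ^ 2) n).

Lemma sum_sqr_ge0 a n : 0 <= sum_n (fun i => a i ^ 2) n.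
Proof.
elim: n => [|n IH]; first by rewrite sum_O; apply: pow2_ge_0.
by rewrite sum_Sn; apply: Rplus_le_le_0_compat => //; apply: pow2_ge_0.
Qed.

Lemma l2_ge0 n a : 0 <= l2 n a.
Proof. exact: sqrt_pos. Qed.

Lemma l2_sqr n a : l2 n a ^ 2 = sum_n (fun i => a i ^ 2) n.
Proof. by rewrite /l2 pow2_sqrt //; apply: sum_sqr_ge0. Qed.

Lemma l2_S n a : l2 (S n) a = sqrt (l2 n a ^ 2 + a (S n) ^ 2).
Proof. by rewrite l2_sqr /l2 sum_Sn. Qed.

Lemma l2_0 a : 0 <= a 0%nat -> l2 0 a = a 0%nat.
Proof. by move=> H; rewrite /l2 sum_O sqrt_pow2. Qed.

Lemma mat_normE m n (A : @matrix K m n) :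
  mat_norm A
  = l2 (pred m) (fun i => l2 (pred n) (fun j => abs (coeff_mat zero A i j))).
Proof.
rewrite /mat_norm [RHS]/l2; f_equal; apply: sum_n_ext => i.
by rewrite l2_sqr.
Qed.

Lemma sqrt2_le a b c d : 0 <= a <= c -> 0 <= b <= d ->
  sqrt (a ^ 2 + b ^ 2) <= sqrt (c ^ 2 + d ^ 2).
Proof. move=> Ha Hb; apply: sqrt_le_1_alt; nra. Qed.

Lemma l2_le n a b : (forall i, 0 <= a i <= b i) -> l2 n a <= l2 n b.
Proof.
move=> H; elim: n => [|n IH].
  by rewrite !l2_0; have := H 0%nat; lra.
by rewrite !l2_S; apply: sqrt2_le => //; split=> //; apply: l2_ge0.
Qed.

Lemma l2_ext n a b : (forall i, a i = b i) -> l2 n a = l2 n b.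
Proof. by move=> H; rewrite /l2; f_equal; apply: sum_n_ext => i; rewrite H. Qed.

Lemma l2_triangle n a b : (forall i, 0 <= a i) -> (forall i, 0 <= b i) ->
  l2 n (fun i => a i + b i) <= l2 n a + l2 n b.
Proof.
move=> Ha Hb; elim: n => [|n IH].
  rewrite !l2_0 //; first lra.
  by have := Ha 0%nat; have := Hb 0%nat; lra.
rewrite !l2_S.
have := Cmod_triangle (l2 n a, a (S n)) (l2 n b, b (S n)).
rewrite /Cmod /=.
apply: Rle_trans; apply: sqrt_le_1_alt.
have := l2_ge0 n (fun i => a i + b i); have := l2_ge0 n a; have := l2_ge0 n b.
have := Ha (S n); have := Hb (S n).
move: (l2 n _) (l2 n a) (l2 n b) IH; move=> x y z; nra.
Qed.

Lemma l2_scal n c a : 0 <= c -> (forall i, 0 <= a i) ->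
  l2 n (fun i => c * a i) = c * l2 n a.
Proof.
move=> Hc Ha; elim: n => [|n IH].
  by rewrite !l2_0 //; apply: Rmult_le_pos.
rewrite !l2_S IH -[X in _ = X * _](sqrt_pow2 c) // -sqrt_mult_alt; last exact: pow2_ge_0.
by f_equal; ring.
Qed.

Lemma l2_coeff_le n a i : (forall i, 0 <= a i) -> (i <= n)%nat -> a i <= l2 n a.
Proof.
move=> Ha; elim: n => [|n IH] Hi.
  by have -> : i = 0%nat by [lia]; rewrite l2_0 //; lra.
have H := sqrt_plus_sqr (l2 n a) (a (S n)).
rewrite l2_S; apply: Rle_trans (proj1 H).
case: (Nat.eq_dec i (S n)) => [-> | Hne].
  by apply: Rle_trans (Rmax_r _ _); apply: Rle_abs.
apply: Rle_trans (Rmax_l _ _); apply: Rle_trans (Rle_abs _).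
by apply: IH; lia.
Qed.

Lemma l2_bound n a c : (forall i, (i <= n)%nat -> 0 <= a i <= c) ->
  l2 n a <= INR (S n) * c.
Proof.
elim: n => [|n IH] H.
  by rewrite l2_0; have := H 0%nat (le_n _); rewrite /=; lra.
have H1 : l2 n a <= INR (S n) * c by apply: IH => i Hi; apply: H; lia.
rewrite l2_S [INR (S (S n))]S_INR.
have Hn := l2_ge0 n a; have Hs := H (S n) (le_n _).
rewrite -[X in _ <= X]sqrt_pow2; last nra.
apply: sqrt_le_1_alt; nra.
Qed.

Lemma mat_norm_coeff_le m n (A : @matrix K m n) i j :
  (i < m)%nat -> (j < n)%nat -> abs (coeff_mat zero A i j) <= mat_norm A.
Proof.
move=> Hi Hj; rewrite mat_normE.
apply: Rle_trans
  (l2_coeff_le (pred m)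
     (fun i => l2 (pred n) (fun j => abs (coeff_mat zero A i j))) i _ _);
  last lia.
- apply: (l2_coeff_le (pred n) (fun j => abs (coeff_mat zero A i j)));
    last lia.
  by move=> ?; apply: abs_ge_0.
- by move=> ?; apply: l2_ge0.
Qed.

Lemma mat_norm_bound m n (A : @matrix K m n) c : 0 <= c ->
  (forall i j, (i < m)%nat -> (j < n)%nat ->
     abs (coeff_mat zero A i j) <= c) ->
  mat_norm A <= INR (S (pred m)) * (INR (S (pred n)) * c).
Proof.
move=> Hc H; rewrite mat_normE; apply: l2_bound => i Hi; split.
  exact: l2_ge0.
apply: l2_bound => j Hj; split; first exact: abs_ge_0.
case: (Nat.lt_ge_cases i m) => Hi'; last by rewrite coeff_mat_out ?abs_zero; auto.
case: (Nat.lt_ge_cases j n) => Hj'; last by rewrite coeff_mat_out ?abs_zero; auto.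
exact: H.
Qed.

Lemma mat_norm_triangle m n (A B : @matrix K m n) :
  mat_norm (Mplus A B) <= mat_norm A + mat_norm B.
Proof.
rewrite !mat_normE.
apply: Rle_trans (l2_triangle _ _ _ _ _); try by move=> ?; apply: l2_ge0.
apply: l2_le => i; split; first exact: l2_ge0.
apply: Rle_trans (l2_triangle _ _ _ _ _); try by move=> ?; apply: abs_ge_0.
apply: l2_le => j; split; first exact: abs_ge_0.
by rewrite coeff_Mplus; apply: abs_triangle.
Qed.

Lemma mat_norm_scal m n a (A : @matrix K m n) :
  mat_norm (mat_scal a A) <= abs a * mat_norm A.
Proof.
rewrite !mat_normE.
rewrite -l2_scal; [|exact: abs_ge_0|by move=> ?; apply: l2_ge0].
apply: l2_le => i; split; first exact: l2_ge0.
rewrite -l2_scal; [|exact: abs_ge_0|by move=> ?; apply: abs_ge_0].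
apply: l2_le => j; split; first exact: abs_ge_0.
by rewrite coeff_mat_scal; apply: abs_mult.
Qed.

Lemma mat_norm_eq0 m n (A : @matrix K m n) : mat_norm A = 0 -> A = Mzero.
Proof.
move=> H; apply/(coeff_mat_ext_aux zero zero) => i j Hi Hj.
rewrite /Mzero coeff_mat_bij //.
apply: abs_eq_zero; apply: Rle_antisym; last exact: abs_ge_0.
by rewrite -H; apply: mat_norm_coeff_le.
Qed.

Lemma mat_norm_minus_sym m n (A B : @matrix_AbelianGroup K m n) :
  mat_norm (minus A B) = mat_norm (minus B A).
Proof.
rewrite !mat_normE; apply: l2_ext => i; apply: l2_ext => j.
by rewrite !coeff_Mminus -abs_opp opp_minus.
Qed.

Section Structures.
Variables m n : nat.
Let G : AbelianGroup := @matrix_AbelianGroup K m n.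

Definition mat_ModuleSpace_mixin : ModuleSpace.mixin_of K G.
Proof.
apply: (ModuleSpace.Mixin K G (@mat_scal m n)).
- move=> x y u; apply/(coeff_mat_ext zero) => i j.
  by rewrite !coeff_mat_scal mult_assoc.
- move=> u; apply/(coeff_mat_ext zero) => i j.
  by rewrite !coeff_mat_scal mult_one_l.
- move=> x u v; apply/(coeff_mat_ext zero) => i j.
  by rewrite !(coeff_mat_scal, coeff_Mplus) mult_distr_l.
- move=> x y u; apply/(coeff_mat_ext zero) => i j.
  by rewrite !(coeff_mat_scal, coeff_Mplus) mult_distr_r.
Defined.

Definition mat_ball (A : G) (e : R) (B : G) := mat_norm (minus B A) < e.

Definition mat_UniformSpace_mixin : UniformSpace.mixin_of (@matrix K m n).
Proof.
apply: (UniformSpace.Mixin _ Mzero mat_ball).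
- move=> A e; rewrite /mat_ball minus_eq_zero.
  apply: Rle_lt_trans (cond_pos e).
  rewrite -[X in _ <= X](Rmult_0_r (INR (S (pred m)))).
  rewrite -[X in _ <= _ * X](Rmult_0_r (INR (S (pred n)))).
  apply: mat_norm_bound; first lra.
  move=> i j Hi Hj; rewrite coeff_mat_bij // abs_zero; lra.
- by move=> A B e; rewrite /mat_ball mat_norm_minus_sym.
- move=> A B C e1 e2; rewrite /mat_ball => H1 H2.
  rewrite (minus_trans B C A).
  rewrite (Rplus_comm e1).
  apply: Rle_lt_trans (mat_norm_triangle _ _ _ _) _.
  exact: (Rplus_lt_compat _ _ _ _ H2 H1).
Defined.

Definition mat_NormedModuleAux_class : NormedModuleAux.class_of K (@matrix K m n) :=
  NormedModuleAux.Class K _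
    (ModuleSpace.Class K _ (AbelianGroup.class G) mat_ModuleSpace_mixin)
    mat_UniformSpace_mixin.

Definition mat_NormedModule_mixin :
  NormedModule.mixin_of K
    (NormedModuleAux.Pack K _ mat_NormedModuleAux_class (@matrix K m n)).
Proof.
refine (NormedModule.Mixin K
  (NormedModuleAux.Pack K _ mat_NormedModuleAux_class (@matrix K m n))
  (@mat_norm m n) 1 _ _ _ _ _).
- exact: mat_norm_triangle.
- exact: mat_norm_scal.
- done.
- by move=> x y eps H; rewrite Rmult_1_l.
- exact: mat_norm_eq0.
Defined.

Definition mat_NormedModule_class : NormedModule.class_of K (@matrix K m n) :=
  NormedModule.Class K _ mat_NormedModuleAux_class mat_NormedModule_mixin.

Definition mat_lim (F : (@matrix K m n -> Prop) -> Prop) : @matrix K m n :=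
  mk_matrix m n (fun i j =>
    scalars_lim k (fun P => F (fun A => P (coeff_mat zero A i j)))).

Lemma filter_forall_lt T (F : (T -> Prop) -> Prop) (P : nat -> T -> Prop) p :
  Filter F -> (forall i, (i < p)%nat -> F (P i)) ->
  F (fun x => forall i, (i < p)%nat -> P i x).
Proof.
move=> FF; elim: p => [|p IH] H.
  by apply: filter_imp filter_true => x _ i Hi; lia.
have H1 : F (fun x => forall i, (i < p)%nat -> P i x).
  by apply: IH => i Hi; apply: H; lia.
apply: filter_imp (filter_and _ _ H1 (H p (le_n _))) => x [H2 H3] i Hi.
case: (Nat.eq_dec i p) => [-> // | Hne]; apply: H2; lia.
Qed.

Lemma mat_complete (F : (@matrix K m n -> Prop) -> Prop) :
  ProperFilter F ->
  (forall eps : posreal, exists A, F (mat_ball A eps)) ->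
  forall eps : posreal, F (mat_ball (mat_lim F) eps).
Proof.
move=> FF HF eps.
have Hm : 0 < INR (S (pred m)) by apply: lt_0_INR; lia.
have Hn : 0 < INR (S (pred n)) by apply: lt_0_INR; lia.
set d := INR (S (pred m)) * INR (S (pred n)).
have Hd : 0 < d by apply: Rmult_lt_0_compat.
have He : 0 < eps / (2 * d).
  by apply: Rdiv_lt_0_compat; [exact: cond_pos | lra].
have H : F (fun A => forall i, (i < m)%nat -> forall j, (j < n)%nat ->
   abs (minus (coeff_mat zero A i j) (coeff_mat zero (mat_lim F) i j))
     < eps / (2 * d)).
  apply: (filter_forall_lt _ F
    (fun i A => forall j, (j < n)%nat -> abs (minus (coeff_mat zero A i j)
       (coeff_mat zero (mat_lim F) i j)) < eps / (2 * d))) => i Hi.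
  apply: (filter_forall_lt _ F
    (fun j A => abs (minus (coeff_mat zero A i j)
       (coeff_mat zero (mat_lim F) i j)) < eps / (2 * d))) => j Hj.
  rewrite /mat_lim coeff_mat_bij //.
  apply: (scalars_complete k
    (fun P => F (fun A => P (coeff_mat zero A i j))) _ _ (mkposreal _ He)).
  move=> e; case: (HF e) => A HA; exists (coeff_mat zero A i j).
  apply: filter_imp HA => B HB.
  rewrite -coeff_Mminus.
  by apply: Rle_lt_trans HB; apply: mat_norm_coeff_le.
apply: filter_imp H => A HA.
rewrite /mat_ball.
have Hle := mat_norm_bound m n (minus (A : G) (mat_lim F)) (eps / (2 * d)).
apply: (Rle_lt_trans _ (INR (S (pred m)) * (INR (S (pred n)) * (eps / (2 * d))))).
  apply: Hle; first lra.
  by move=> i j Hi Hj; rewrite coeff_Mminus; left; apply: HA.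
have -> : INR (S (pred m)) * (INR (S (pred n)) * (eps / (2 * d))) = eps / 2.
  by rewrite /d; field; lra.
by have := cond_pos eps; lra.
Qed.

Definition mat_CompleteSpace_mixin :
  CompleteSpace.mixin_of
    (UniformSpace.Pack _ mat_UniformSpace_mixin (@matrix K m n)).
Proof.
refine (CompleteSpace.Mixin
  (UniformSpace.Pack _ mat_UniformSpace_mixin (@matrix K m n)) mat_lim _ _).
- exact: mat_complete.
- move=> F1 F2 H12 H21 eps.
  have -> : mat_lim F1 = mat_lim F2; last exact: ball_center.
  apply/mk_matrix_ext => i j Hi Hj; apply: scalars_lim_ext => P HP;
    by [apply: H12 | apply: H21].
Defined.

Definition Mat : CompleteNormedModule K :=
  CompleteNormedModule.Pack K (@matrix K m n)
    (CompleteNormedModule.Class K _ mat_NormedModule_class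
       mat_CompleteSpace_mixin) (@matrix K m n).

End Structures.
End MatrixSpace.

(* [real_space V] is [V] with the same norm, uniform structure and limits, and
   its scalars restricted to R; derivatives and integrals of functions of a real
   variable are taken in it. *)
Section RestrictScalars.
Variables (k : scalar_kind) (V : CompleteNormedModule (scalars k)).

Definition real_ModuleSpace_mixin :
  ModuleSpace.mixin_of R_Ring (CompleteNormedModule.AbelianGroup _ V).
Proof.
refine (ModuleSpace.Mixin R_Ring (CompleteNormedModule.AbelianGroup _ V)
  (fun (r : R) (x : V) => scal (ofR k r) x) _ _ _ _).
- by move=> x y u; rewrite scal_assoc -ofR_mult.
- by move=> u; rewrite ofR_one; apply: scal_one.
- by move=> x u v; apply: scal_distr_l.
- by move=> x y u; rewrite ofR_plus; apply: scal_distr_r.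
Defined.

Definition real_NormedModuleAux_class : NormedModuleAux.class_of R_AbsRing V :=
  NormedModuleAux.Class R_AbsRing _
    (ModuleSpace.Class R_AbsRing _
       (AbelianGroup.class (CompleteNormedModule.AbelianGroup _ V))
       real_ModuleSpace_mixin)
    (UniformSpace.class (CompleteNormedModule.UniformSpace _ V)).

Definition real_NormedModule_mixin :
  NormedModule.mixin_of R_AbsRing
    (NormedModuleAux.Pack R_AbsRing _ real_NormedModuleAux_class V).
Proof.
refine (NormedModule.Mixin R_AbsRing
  (NormedModuleAux.Pack R_AbsRing _ real_NormedModuleAux_class V)
  (fun x : V => norm x)
  (@norm_factor _ (CompleteNormedModule.NormedModule _ V)) _ _ _ _ _).
- by move=> x y; apply: norm_triangle.
- move=> l x; change (abs l) with (Rabs l); rewrite -(abs_ofR k).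
  exact: (@norm_scal _ (CompleteNormedModule.NormedModule _ V)).
- by move=> x y eps; apply: norm_compat1.
- by move=> x y eps; apply: norm_compat2.
- by move=> x; apply: norm_eq_zero.
Defined.

Definition real_space : CompleteNormedModule R_AbsRing :=
  CompleteNormedModule.Pack R_AbsRing V
    (CompleteNormedModule.Class R_AbsRing _
       (NormedModule.Class R_AbsRing _ real_NormedModuleAux_class
          real_NormedModule_mixin)
       (CompleteSpace.class (CompleteNormedModule.CompleteSpace _ V))) V.

End RestrictScalars.

(* [within I] makes the derivative one-sided at an endpoint of [I]. *)
Definition is_derive_on {V : NormedModule R_AbsRing} (I : R -> Prop)
    (f : R -> V) (t : R) (l : V) : Prop :=
  filterdiff f (within I (locally t)) (fun h => scal h l).

Definition C1_on {V : NormedModule R_AbsRing} (I : R -> Prop) (f : R -> V) :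
    Prop :=
  exists df : R -> V,
    (forall t, I t -> is_derive_on I f t (df t)) /\ continuous_on I df.

(* [real] sends an infinite supremum to 0; the suprema taken with [sup_on] and
   [op_norm] are finite. *)
Definition sup_on (a b : R) (f : R -> R) : R :=
  real (Lub_Rbar (fun r => exists s, a <= s <= b /\ r = f s)).

Definition transition_signal (t0 : R) (phi : R -> R) : Prop :=
  (forall t, continuous phi t) /\
  (forall t, 0 <= phi t <= 1) /\
  (forall t, t <= 0 -> phi t = 0) /\
  (forall t, t0 <= t -> phi t = 1).

Definition Kvec (k : scalar_kind) (n : nat) : CompleteNormedModule (scalars k) :=
  Mat k n 1.

Definition Mmul {k m n p} (A : Mat k m n) (B : Mat k n p) : Mat k m p :=
  @Mmult (scalars k) m n p A B.

Definition basis_vec (k : scalar_kind) (m j : nat) : Kvec k m :=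
  mk_matrix m 1 (fun i _ => if Nat.eqb i j then one else zero).

Definition op_norm {k m n} (A : Mat k m n) : R :=
  real (Lub_Rbar (fun r =>
    exists x : Kvec k n, norm x <= 1 /\ r = norm (Mmul A x : Kvec k m))).

(* [iota] selects the sum of the series. *)
Definition Mexp {k n} (A : Mat k n n) : Mat k n n :=
  iota (is_series (V := Mat k n n) (fun j =>
    scal (ofR k (/ INR (fact j)))
         (pow_n (A : @matrix_Ring (scalars k) n) j : Mat k n n))).

Definition complexify {k m n} (A : Mat k m n) : Mat ComplexScalars m n :=
  mk_matrix m n (fun i j => toC k (coeff_mat zero (A : matrix m n) i j)).

Definition eigenvalue {k n} (A : Mat k n n) (mu : scalars k) : Prop :=
  exists x : Kvec k n, x <> zero /\ (Mmul A x : Kvec k n) = scal mu x.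

(* The spectrum of a real matrix is taken over C. *)
Definition Hurwitz {k n} (A : Mat k n n) : Prop :=
  forall mu : C, eigenvalue (complexify A) mu -> Re mu < 0.

Definition stabilizable {k n m} (A : Mat k n n) (B : Mat k n m) : Prop :=
  exists F : Mat k m n, Hurwitz (plus A (Mmul B F)).

Record Hilbert (k : scalar_kind) := {
  hilbert_space :> CompleteNormedModule (scalars k);
  inner : hilbert_space -> hilbert_space -> scalars k;
  inner_plus_l : forall x y z,
    inner (plus x y) z = plus (inner x z) (inner y z);
  inner_scal_l : forall a x z, inner (scal a x) z = mult a (inner x z);
  inner_conj : forall x y, inner y x = sconj k (inner x y);
  inner_norm : forall x, toC k (inner x x) = RtoC (norm x ^ 2)
}.
Arguments inner {k h} _ _.

Definition separable {k} (H : Hilbert k) : Prop :=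
  exists s : nat -> H, forall (x : H) (eps : R), 0 < eps ->
    exists n, norm (minus x (s n)) < eps.

(* The values of [app] outside [dom] are irrelevant. *)
Record unbounded_operator {k} (U V : CompleteNormedModule (scalars k)) := {
  dom : U -> Prop;
  app :> U -> V;
  dom_zero : dom zero;
  dom_plus : forall x y, dom x -> dom y -> dom (plus x y);
  dom_scal : forall a x, dom x -> dom (scal a x);
  app_plus : forall x y, dom x -> dom y -> app (plus x y) = plus (app x) (app y);
  app_scal : forall a x, dom x -> app (scal a x) = scal a (app x)
}.
Arguments dom {k U V} _ _.
Arguments app {k U V} _ _.

Definition closed_operator {k} {U V : CompleteNormedModule (scalars k)}
    (T : unbounded_operator U V) : Prop :=
  closed (fun p : U * V => dom T (fst p) /\ T (fst p) = snd p).

Definition restrict_ker {k} {U V W : CompleteNormedModule (scalars k)}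
    (A : unbounded_operator U V) (Bb : unbounded_operator U W) :
    unbounded_operator U V.
Proof.
refine {| dom := fun x => dom A x /\ dom Bb x /\ Bb x = zero;
          app := app A |}.
- have Hd := dom_zero _ _ Bb.
  split; first exact: dom_zero.
  split=> //.
  by rewrite -(scal_zero_l (zero : U)) app_scal // scal_zero_l.
- move=> x y [Ax [Bx Zx]] [Ay [By Zy]].
  split; first exact: dom_plus.
  split; first exact: dom_plus.
  by rewrite app_plus // Zx Zy plus_zero_l.
- move=> a x [Ax [Bx Zx]].
  split; first exact: dom_scal.
  split; first exact: dom_scal.
  by rewrite app_scal // Zx scal_zero_r.
- by move=> x y [Ax _] [Ay _]; apply: app_plus.
- by move=> a x [Ax _]; apply: app_scal.
Defined.

(* Only the values [S t] with [0 <= t] matter. *)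
Definition C0_semigroup {k} {V : CompleteNormedModule (scalars k)}
    (S : R -> V -> V) : Prop :=
  (forall t, 0 <= t -> is_linear (S t)) /\
  (forall x, S 0 x = x) /\
  (forall s t x, 0 <= s -> 0 <= t -> S (s + t) x = S s (S t x)) /\
  (forall x, filterlim (fun t => S t x) (at_right 0) (locally x)).

Definition generates {k} {V : CompleteNormedModule (scalars k)}
    (T : unbounded_operator V V) (S : R -> V -> V) : Prop :=
  C0_semigroup S /\
  forall x y : V,
    (dom T x /\ T x = y) <->
    filterlim (fun h => scal (ofR k (/ h)) (minus (S h x) x))
      (at_right 0) (locally y).

Definition lifting_operator {k m} {H : Hilbert k} (A : unbounded_operator H H)
    (Bb : unbounded_operator H (Kvec k m)) (B : Kvec k m -> H) : Prop :=
  is_linear B /\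
  (forall v, dom A (B v)) /\
  is_linear (fun v => A (B v)) /\
  (forall v, Bb (B v) = v).

(* [S] is the semigroup generated by the disturbance-free operator and [B] is
   the chosen lifting operator. *)
Record boundary_control_system {k m} {H : Hilbert k}
    (A : unbounded_operator H H) (Bb : unbounded_operator H (Kvec k m))
    (S : R -> H -> H) (B : Kvec k m -> H) : Prop := {
  bcs_dom : forall x, dom A x -> dom Bb x;
  bcs_generates : generates (restrict_ker A Bb) S;
  bcs_lifting : lifting_operator A Bb B
}.

(* Sequences indexed by the positive integers are indexed here by [nat], from 0:
   [lam n], [phi n], [psi n] stand for the (n+1)-st terms. *)

Definition riesz_basis {k} {H : Hilbert k} (phi : nat -> H) : Prop :=
  (forall (x : H) (eps : R), 0 < eps ->
     exists (N : nat) (a : nat -> scalars k),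
       norm (minus x (sum_n (fun n => scal (a n) (phi n)) N)) < eps) /\
  exists mR MR : R, 0 < mR /\ 0 < MR /\
    forall (N : nat) (a : nat -> scalars k),
      mR * sum_n (fun n => abs (a n) ^ 2) N
        <= norm (sum_n (fun n => scal (a n) (phi n)) N) ^ 2
        <= MR * sum_n (fun n => abs (a n) ^ 2) N.

Definition closure_of_seq {k} (lam : nat -> scalars k) (z : scalars k) : Prop :=
  forall eps : R, 0 < eps -> exists n, abs (minus (lam n) z) < eps.

Definition segment {k} (a b z : scalars k) : Prop :=
  exists s : R, 0 <= s <= 1 /\
    z = plus (mult (ofR k (1 - s)) a) (mult (ofR k s) b).

Definition totally_disconnected {k} (E : scalars k -> Prop) : Prop :=
  forall a b, E a -> E b -> a <> b -> ~ (forall z, segment a b z -> E z).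

Record riesz_spectral {k} {H : Hilbert k} (T : unbounded_operator H H)
    (lam : nat -> scalars k) (phi : nat -> H) : Prop := {
  rs_closed : closed_operator T;
  rs_eigen : forall n, dom T (phi n) /\ phi n <> zero /\
               T (phi n) = scal (lam n) (phi n);
  rs_distinct : forall i j, lam i = lam j -> i = j;
  rs_simple : forall n x, dom T x -> T x = scal (lam n) x ->
                exists c : scalars k, x = scal c (phi n);
  rs_basis : riesz_basis phi;
  rs_disconnected : totally_disconnected (closure_of_seq lam)
}.

Definition biorthogonal {k} {H : Hilbert k} (phi psi : nat -> H) : Prop :=
  forall i j, inner (phi i) (psi j) = if Nat.eqb i j then one else zero.

Definition A_trunc {k} (lam : nat -> scalars k) (N0 : nat) : Mat k N0 N0 :=
  mk_matrix N0 N0 (fun i j => if Nat.eqb i j then lam i else zero).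

Definition B_trunc {k m} {H : Hilbert k} (A : unbounded_operator H H)
    (B : Kvec k m -> H) (lam : nat -> scalars k) (psi : nat -> H) (N0 : nat) :
    Mat k N0 m :=
  mk_matrix N0 m (fun n j =>
    plus (opp (mult (lam n) (inner (B (basis_vec k m j)) (psi n))))
         (inner (A (B (basis_vec k m j))) (psi n))).

Definition Y_trunc {k} {H : Hilbert k} (psi : nat -> H) (N0 : nat) (x : H) :
    Kvec k N0 :=
  mk_matrix N0 1 (fun i _ => inner x (psi i)).

Definition A_closed_loop {k m N0} (AN : Mat k N0 N0) (BN : Mat k N0 m)
    (K : Mat k m N0) (D0 : R) : Mat k N0 N0 :=
  plus AN (Mmul (Mexp (scal (ofR k (- D0)) AN)) (Mmul BN K)).

Section ClosedLoop.
Context {k : scalar_kind} {m : nat} {H : Hilbert k}.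
Variables (A : unbounded_operator H H) (S : R -> H -> H) (B : Kvec k m -> H)
  (lam : nat -> scalars k) (psi : nat -> H) (N0 : nat) (K : Mat k m N0)
  (varphi : R -> R) (D0 delta : R).

Let AN : Mat k N0 N0 := A_trunc lam N0.
Let BN : Mat k N0 m := B_trunc A B lam psi N0.

Definition feedback_law (X : R -> H) (u d2 : R -> Kvec k m) (t : R) : Kvec k m :=
  scal (ofR k (varphi t))
    (plus (plus (Mmul K (Y_trunc psi N0 (X t))) (d2 t))
       (Mmul K
         (RInt (V := real_space k (Kvec k N0))
            (fun s => Mmul (Mexp (scal (ofR k (t - s - D0)) AN)) (Mmul BN (u s)))
            (Rmax (t - D0) 0) t))).

(* [dv] is the derivative of the boundary input [v]. *)
Definition boundary_mild_formula (X0 : H) (X : R -> H) (v dv : R -> Kvec k m)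
    (t : R) : Prop :=
  X t = plus (plus (S t (minus X0 (B (v 0)))) (B (v t)))
          (RInt (V := real_space k H)
             (fun s => S (t - s) (minus (A (B (v s))) (B (dv s)))) 0 t).

Record mild_solution (D : R -> R) (X0 : H) (d1 d2 : R -> Kvec k m)
    (X : R -> H) (u : R -> Kvec k m) : Prop := {
  ms_state_continuous : continuous_on (fun t => 0 <= t) X;
  ms_input_C1 : C1_on (V := real_space k (Kvec k m))
                  (fun t => - D0 - delta <= t) u;
  ms_state :
    let v := fun t => plus (u (t - D t)) (d1 t) in
    exists dv : R -> Kvec k m,
      (forall t, 0 <= t ->
         is_derive_on (V := real_space k (Kvec k m)) (fun s => 0 <= s)
           v t (dv t)) /\
      (forall t, 0 <= t -> boundary_mild_formula X0 X v dv t);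
  ms_input_zero : forall t, - D0 - delta <= t <= 0 -> u t = zero;
  ms_input : forall t, 0 <= t -> u t = feedback_law X u d2 t
}.
End ClosedLoop.

(* Main.v *)
Require Import Defs.
From Stdlib Require Import Reals List Factorial Lra Lia ssreflect.
From Coquelicot Require Import Coquelicot.
Open Scope R_scope.

(** Why the estimate holds.

    Spectral coordinates.  The semigroup acts diagonally on the coefficients
    <x, psi_n>: if [Pi] is a bounded map into a Banach space and [L] a bounded
    operator with [L (Pi phi_j) = lam_j Pi phi_j] for all [j], then
    [Pi S(t) = exp (t L) Pi] ([projection_semigroup]; both sides agree on the
    dense span of the [phi_j]).  Applying [Pi] to the mild formula and integrating
    the derivative of the boundary input by parts gives the ordinary differential
    equation (Pi X)' = L Pi X + (Pi A B - L Pi B) v ([mild_projection]).  It is used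
    with [Pi] the first [N0] coefficients and with [Pi] one single coefficient.

    Finite part.  For Y' = A Y + B v with the delayed input v = u(t - D(t)) + d1,
    add the prediction integral ([predictor]): Z = Y + int_{t-D0}^t
    exp((t-s-D0)A) B u(s) ds satisfies Z' = Acl Z + w, where w consists of the
    disturbances and of B (u(t - D(t)) - u(t - D0)).  Once the transition signal is
    1, u = K Z + d2, so w is controlled by the increments of Z over times at most
    delta.  With a = |Acl|, g = |B K| and |exp(t Acl)| <= M exp(-l t), variation of
    constants gives
      |Z| <= M |Z(0)| + (M / l) |w|,
      |increment of Z| <= (exp(a delta) - 1) |Z| + (M / l) (1 - exp(-l delta)) |w|
    in the supremum norm, hence a loop gain M g (exp(a delta) - exp(-l delta)) / l,
    which the last hypothesis makes smaller than 1.  As the inequality is strict it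
    survives multiplication of all signals by exp(kappa t) for a small kappa
    ([gain_exists]), and the contraction argument gives [small_gain].

    Infinite part.  For n >= N0 the n-th coefficient is driven by
    exp(lam_n t), |exp(lam_n t)| = exp(Re lam_n t), with Re lam_n <= - alpha.  Its
    response to an input bounded by W exp(-kappa t) is at most W exp(-kappa t) times
    (|lam_n| |<B e, psi_n>| + |<A B e, psi_n>|) / (- Re lam_n - kappa).  The finite
    xi bounds |lam_n| / (- Re lam_n - kappa) uniformly in n, so the bounds are square
    summable by the Bessel inequality of the Riesz basis, and they sum up to a bound
    on the norm of X(t) ([riesz_frame], [mode_bound], [state_from_modes]).

    Causality.  X(t) depends on u only through u(s - D(s)), s <= t, hence on d2 only
    up to t1 = max (t - (D0 - delta), 0).  The small-gain estimate is therefore used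
    on [0, t1] only, and the finite part is continued in open loop from t1 to t, an
    interval of length at most D0 ([truncated_stability]). *)

(** * Linear identities in real normed spaces *)

Inductive mexpr :=
  | MAtom (i : nat) | MZero | MPlus (a b : mexpr) | MMinus (a b : mexpr)
  | MOpp (a : mexpr) | MScal (r : R) (a : mexpr).

Fixpoint meval {V : NormedModule R_AbsRing} (env : list V) (e : mexpr) : V :=
  match e with
  | MAtom i => nth i env zero
  | MZero => zero
  | MPlus a b => plus (meval env a) (meval env b)
  | MMinus a b => minus (meval env a) (meval env b)
  | MOpp a => opp (meval env a)
  | MScal r a => scal r (meval env a)
  end.

Fixpoint mcoef (e : mexpr) (i : nat) : R :=
  match e with
  | MAtom j => if Nat.eqb j i then 1 else 0
  | MZero => 0
  | MPlus a b => mcoef a i + mcoef b i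
  | MMinus a b => mcoef a i - mcoef b i
  | MOpp a => - mcoef a i
  | MScal r a => r * mcoef a i
  end.

Fixpoint mlin {V : NormedModule R_AbsRing} (env : list V) (c : nat -> R) : V :=
  match env with
  | nil => zero
  | x :: env => plus (scal (c 0%nat) x) (mlin env (fun i => c (S i)))
  end.

Lemma mlin_ext {V : NormedModule R_AbsRing} (env : list V) c d :
  (forall i, (i < length env)%nat -> c i = d i) -> mlin env c = mlin env d.
Proof.
elim: env c d => [|x env IH] c d H //=.
rewrite H /=; last lia.
by congr (plus _ _); apply: IH => i Hi; apply: H => /=; lia.
Qed.

Lemma mlin_plus {V : NormedModule R_AbsRing} (env : list V) c d :
  mlin env (fun i => c i + d i) = plus (mlin env c) (mlin env d).
Proof.
elim: env c d => [|x env IH] c d /=; first by rewrite plus_zero_l.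
rewrite IH (scal_distr_r (c 0%nat : R_AbsRing)) -!plus_assoc; congr (plus _ _).
by rewrite !plus_assoc; congr (plus _ _); apply: plus_comm.
Qed.

Lemma mlin_scal {V : NormedModule R_AbsRing} (env : list V) r c :
  mlin env (fun i => r * c i) = scal (r : R_AbsRing) (mlin env c).
Proof.
elim: env c => [|x env IH] c /=; first by rewrite scal_zero_r.
by rewrite IH scal_distr_l scal_assoc.
Qed.

Lemma mlin_0 {V : NormedModule R_AbsRing} (env : list V) c :
  (forall i, c i = 0) -> mlin env c = zero.
Proof.
elim: env c => [|x env IH] c Hc //=.
rewrite Hc (scal_zero_l x) IH ?plus_zero_l //.
Qed.

Lemma mlin_atom {V : NormedModule R_AbsRing} (env : list V) j :
  mlin env (fun i => if Nat.eqb j i then 1 else 0) = nth j env zero.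
Proof.
elim: env j => [|x env IH] [|j] //=.
- rewrite mlin_0 // plus_zero_r; exact: (scal_one x).
- by rewrite IH (scal_zero_l x) plus_zero_l.
Qed.

Lemma meval_mlin {V : NormedModule R_AbsRing} (env : list V) e :
  meval env e = mlin env (mcoef e).
Proof.
elim: e => [i||a Ha b Hb|a Ha b Hb|a Ha|r a Ha] /=.
- by rewrite mlin_atom.
- by rewrite mlin_0.
- by rewrite mlin_plus Ha Hb.
- rewrite (mlin_ext env _ (fun i => mcoef a i + (-1) * mcoef b i)); last by move=> i _; ring.
  rewrite mlin_plus mlin_scal -Ha -Hb /minus; congr (plus _ _).
  by rewrite -(scal_opp_one (meval env b)).
- rewrite (mlin_ext env _ (fun i => (-1) * mcoef a i)); last by move=> i _; ring.
  by rewrite mlin_scal -Ha -(scal_opp_one (meval env a)).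
- by rewrite mlin_scal Ha.
Qed.

(** Soundness of the reflection: the vectors need not be independent, equality of
    the formal coefficients suffices. *)
Lemma meval_eq {V : NormedModule R_AbsRing} (env : list V) e1 e2 :
  (forall i, (i < length env)%nat -> mcoef e1 i = mcoef e2 i) ->
  meval env e1 = meval env e2.
Proof. by move=> H; rewrite !meval_mlin; apply: mlin_ext. Qed.

Ltac m_find x l :=
  match l with
  | nil => constr:(0%nat)
  | x :: _ => constr:(0%nat)
  | _ :: ?l' => let n := m_find x l' in constr:(S n)
  end.
Ltac m_add x l :=
  match l with
  | nil => constr:(x :: l)
  | x :: _ => constr:(l)
  | ?y :: ?l' => let l2 := m_add x l' in constr:(y :: l2)
  end.
(* The cast [r : R] fails when [r] is a scalar of [scalars k] with [k] unknown;
   such a multiple is then treated as an atom. *)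
Ltac m_atoms e l :=
  match e with
  | plus ?a ?b => let l1 := m_atoms a l in m_atoms b l1
  | minus ?a ?b => let l1 := m_atoms a l in m_atoms b l1
  | opp ?a => m_atoms a l
  | scal ?r ?a => let _ := constr:(r : R) in m_atoms a l
  | zero => l
  | _ => m_add e l
  end.
Ltac m_reify e l :=
  match e with
  | plus ?a ?b => let x := m_reify a l in let y := m_reify b l in constr:(MPlus x y)
  | minus ?a ?b => let x := m_reify a l in let y := m_reify b l in constr:(MMinus x y)
  | opp ?a => let x := m_reify a l in constr:(MOpp x)
  | scal ?r ?a =>
      let _ := constr:(r : R) in let x := m_reify a l in constr:(MScal r x)
  | zero => constr:(MZero)
  | _ => let n := m_find e l in constr:(MAtom n)
  end.

(** Proves an identity between real linear combinations of vectors of [V] by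
    comparing the coefficients of each atom with [ring].  Because the operations
    of [real_space k V] compute to those of [V], it also serves for identities
    stated in a space over [scalars k]. *)
Ltac module_eq V :=
  lazymatch goal with |- ?a = ?b =>
    let l0 := constr:(@nil (NormedModule.sort R_AbsRing V)) in
    let l1 := m_atoms a l0 in let l := m_atoms b l1 in
    let x := m_reify a l in let y := m_reify b l in
    change (@meval V l x = @meval V l y); apply: meval_eq;
    let i := fresh "i" in let Hi := fresh "Hi" in
    intros i Hi; cbn [length] in Hi;
    repeat (destruct i as [|i]; [clear Hi; cbn [mcoef Nat.eqb] | try lia]);
    try (change (@one R_AbsRing) with 1); try ring
  end.
Tactic Notation "module_eq" constr(V) := module_eq V.

(** * Calculus in normed spaces *)

Lemma norm_minus_sym {K : AbsRing} {V : NormedModule K} (x y : V) :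
  norm (minus x y) = norm (minus y x).
Proof. by rewrite -(norm_opp (minus x y)) opp_minus. Qed.

Lemma norm_minus_le {V : NormedModule R_AbsRing} (x y : V) :
  norm (minus x y) <= norm x + norm y.
Proof. rewrite /minus -(norm_opp y); exact: norm_triangle. Qed.

Lemma norm_scal_R {V : NormedModule R_AbsRing} (r : R) (x : V) :
  norm (scal r x) <= Rabs r * norm x.
Proof. exact: (norm_scal r x). Qed.

(** The filter-based definition quantifies over all limits of the filter; as [t]
    itself lies in [I], it is the only one. *)
Lemma is_derive_on_eps {V : NormedModule R_AbsRing} (I : R -> Prop) (f : R -> V)
    t l : I t ->
  is_derive_on I f t l <->
  (forall eps, 0 < eps -> exists d, 0 < d /\ forall s, I s -> Rabs (s - t) < d ->
     norm (minus (minus (f s) (f t)) (scal (s - t) l)) <= eps * Rabs (s - t)).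
Proof.
move=> It; split.
- move=> [_ Hd] eps Heps.
  have Hl : is_filter_lim (within I (locally t)) t.
    by move=> P HP; apply: filter_imp HP => s Hs _.
  case: (Hd t Hl (mkposreal eps Heps)) => d Hd'.
  exists d; split; first exact: cond_pos.
  by move=> s Is Hs; apply: (Hd' s Hs Is).
- move=> Heps; split; first exact: is_linear_scal_l.
  move=> x Hx.
  have -> : x = t.
    case: (Req_dec x t) => // Hne.
    have He : 0 < Rabs (x - t) by apply: Rabs_pos_lt; lra.
    case: (Hx _ (locally_ball x (mkposreal _ He))) => d Hd.
    have /= := Hd t (ball_center t d) It.
    rewrite /ball /= /AbsRing_ball /abs /= /minus /plus /opp /= => Hlt.
    have H2 : t + - x = - (x - t) by ring.
    by rewrite H2 Rabs_Ropp in Hlt; lra.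
  move=> eps; case: (Heps eps (cond_pos eps)) => d [Hd H].
  exists (mkposreal d Hd) => s Hs Is; exact: (H s Is Hs).
Qed.

Lemma is_derive_eps {V : NormedModule R_AbsRing} (f : R -> V) t l :
  is_derive f t l <->
  (forall eps, 0 < eps -> exists d, 0 < d /\ forall s, Rabs (s - t) < d ->
     norm (minus (minus (f s) (f t)) (scal (s - t) l)) <= eps * Rabs (s - t)).
Proof.
split.
- move=> [_ Hd] eps Heps.
  have Hl : is_filter_lim (locally t) t by [].
  case: (Hd t Hl (mkposreal eps Heps)) => d Hd'.
  exists d; split; first exact: cond_pos.
  by move=> s Hs; apply: (Hd' s Hs).
- move=> Heps; split; first exact: is_linear_scal_l.
  move=> x Hx.
  have <- := is_filter_lim_locally_unique _ _ Hx.
  move=> eps; case: (Heps eps (cond_pos eps)) => d [Hd H].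
  exists (mkposreal d Hd) => s Hs; exact: (H s Hs).
Qed.

Lemma continuous_eps {V W : NormedModule R_AbsRing} (f : V -> W) t :
  continuous f t <->
  (forall eps, 0 < eps -> exists d, 0 < d /\ forall s, norm (minus s t) < d ->
     norm (minus (f s) (f t)) < eps).
Proof.
split.
- move=> Hf eps Heps.
  have H1 : locally (f t) (fun y => norm (minus y (f t)) < eps).
    apply: (locally_le_locally_norm (f t)).
    by exists (mkposreal eps Heps) => y Hy; exact: Hy.
  case: (locally_norm_le_locally t _ (Hf _ H1)) => d Hd.
  by exists d; split; [exact: cond_pos|move=> s Hs; apply: Hd].
- move=> H P HP.
  case: (locally_norm_le_locally (f t) P HP) => e He.
  case: (H e (cond_pos e)) => d [Hd Hs].
  apply: (locally_le_locally_norm t).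
  by exists (mkposreal d Hd) => s Hds; apply: He; apply: Hs.
Qed.

(** The majorant need not be the series of norms: its exact sum [l] is what turns
    scalar exponential series into sharp operator bounds. *)
Lemma series_norm_le {K : AbsRing} {V : NormedModule K} (u : nat -> V) s (b : nat -> R) l :
  is_series u s -> (forall n, norm (u n) <= b n) -> is_series b l -> norm s <= l.
Proof.
move=> Hu Hb Hl.
have H1 : filterlim (fun n => norm (sum_n u n)) eventually (locally (norm s)).
  by apply: filterlim_comp Hu _; apply: filterlim_norm.
apply: (filterlim_le (F := eventually) (fun n => norm (sum_n u n)) (sum_n b)
  (norm s) l) => //.
exists 0%nat => n _.
apply: (Rle_trans _ _ _ (norm_sum_n_m u 0 n)).
exact: sum_n_m_le.
Qed.

Lemma is_series_unique_V {K : AbsRing} {V : NormedModule K} (u : nat -> V) s1 s2 :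
  is_series u s1 -> is_series u s2 -> s1 = s2.
Proof. by move=> H1 H2; apply: (filterlim_locally_unique (F :=
  eventually) (sum_n u) s1 s2 H1 H2). Qed.

Lemma is_series_linear {K : AbsRing} {U V : NormedModule K} (L : U -> V) (u : nat -> U) s :
  is_linear L -> is_series u s -> is_series (fun n => L (u n)) (L s).
Proof.
move=> HL Hu.
apply: (filterlim_ext (fun n => L (sum_n u n))).
  elim=> [|n IH]; first by rewrite !sum_O.
  by rewrite !sum_Sn linear_plus // IH.
apply: filterlim_comp Hu _.
exact: linear_cont.
Qed.

Lemma linear_minus {K : AbsRing} {U V : NormedModule K} (L : U -> V) x y :
  is_linear L -> L (minus x y) = minus (L x) (L y).
Proof.
move=> HL; rewrite /minus linear_plus //; congr (plus _ _).
by rewrite -(scal_opp_one y) linear_scal // scal_opp_one.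
Qed.

Lemma linear_zero {K : AbsRing} {U V : NormedModule K} (L : U -> V) :
  is_linear L -> L zero = zero.
Proof.
by move=> HL; rewrite -(scal_zero_l (zero : U)) linear_scal // scal_zero_l.
Qed.

Lemma continuous_linear_comp {X Y : NormedModule R_AbsRing} (F : X -> Y) (h : R -> X) s :
  is_linear F -> continuous h s -> continuous (fun r => F (h r)) s.
Proof. by move=> HF Hh; apply: (filterlim_comp _ _ _ _ _ _ _ _ Hh); apply: linear_cont. Qed.

Lemma is_derive_linear_comp {X Y : NormedModule R_AbsRing} (F : X -> Y) (h : R -> X) s l :
  is_linear F -> is_derive h s l -> is_derive (fun r => F (h r)) s (F l).
Proof.
move=> HF Hh.
have := filterdiff_comp' h F s _ _ Hh (filterdiff_linear F HF).
move=> H1; apply: filterdiff_ext_lin H1 _ => y /=; exact: linear_scal.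
Qed.

Lemma is_series_exp t : is_series (fun j => t ^ j / INR (fact j)) (exp t).
Proof.
have := is_exp_Reals t; rewrite /is_pseries.
apply: is_series_ext => n.
by rewrite pow_n_pow /scal /= /mult /= /Rdiv.
Qed.

(** * The exponential of a bounded operator *)

(** The exponential series applied to a vector, [exp (t A) x].  Working with vectors
    instead of operators avoids a space of operators and covers at once matrices,
    scalars and operators that are only given as functions. *)
Definition expop {V : CompleteNormedModule R_AbsRing} (A : V -> V) (t : R) (x : V) : V :=
  iota (is_series (fun j => scal (t ^ j / INR (fact j)) (Nat.iter j A x))).

Section Expop.
Variables (V : CompleteNormedModule R_AbsRing) (A : V -> V) (a : R).
Hypothesis (HA : is_linear A) (Ha0 : 0 <= a)
  (Ha : forall x, norm (A x) <= a * norm x).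

Lemma norm_iter_le j x : norm (Nat.iter j A x) <= a ^ j * norm x.
Proof.
elim: j => [|j IH] /=; first lra.
apply: Rle_trans (Ha _) _; rewrite Rmult_assoc.
exact: Rmult_le_compat_l.
Qed.

Lemma norm_iter_scal c d j x : Rabs c <= d -> norm (scal c (Nat.iter j A x)) <= d * a ^ j * norm x.
Proof.
move=> Hc; apply: Rle_trans (norm_scal_R _ _) _.
rewrite Rmult_assoc; apply: Rmult_le_compat; try exact: norm_ge_0; try exact: Rabs_pos.
- done.
- exact: norm_iter_le.
Qed.

Lemma Rabs_exp_coef t j : Rabs (t ^ j / INR (fact j)) = Rabs t ^ j / INR (fact j).
Proof.
rewrite /Rdiv Rabs_mult -RPow_abs Rabs_inv; congr (_ * / _).
apply: Rabs_pos_eq; apply: pos_INR.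
Qed.

Lemma expop_series t x :
  is_series (fun j => scal (t ^ j / INR (fact j)) (Nat.iter j A x)) (expop A t x).
Proof.
have Hex : ex_series (fun j => scal (t ^ j / INR (fact j)) (Nat.iter j A x)).
  apply: (ex_series_le _ (fun j => (Rabs t ^ j / INR (fact j)) * a ^ j * norm x)).
    by move=> j; apply: norm_iter_scal; rewrite Rabs_exp_coef; lra.
  exists (exp (Rabs t * a) * norm x).
  have := is_series_scal_r (norm x) _ _ (is_series_exp (Rabs t * a)).
  apply: is_series_ext => j; rewrite Rpow_mult_distr /Rdiv.
  change ((Rabs t ^ j * a ^ j * / INR (fact j)) * norm x =
    Rabs t ^ j * / INR (fact j) * a ^ j * norm x); ring.
rewrite /expop; apply: iota_correct.
case: Hex => s Hs; exists s; split=> // s' Hs'.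
exact: is_series_unique_V Hs Hs'.
Qed.

Lemma expop_unique t x s :
  is_series (fun j => scal (t ^ j / INR (fact j)) (Nat.iter j A x)) s -> expop A t x = s.
Proof. by move=> Hs; apply: is_series_unique_V (expop_series t x) Hs. Qed.

Lemma exp_majorant r (x : V) : is_series (fun j => r ^ j / INR (fact j) * a ^ j * norm x) (exp
  (r * a) * norm x).
Proof.
have := is_series_scal_r (norm x) _ _ (is_series_exp (r * a)).
apply: is_series_ext => j; rewrite Rpow_mult_distr /Rdiv.
change ((r ^ j * a ^ j * / INR (fact j)) * norm x = r ^ j * / INR (fact j) * a ^ j * norm x); ring.
Qed.

Lemma norm_expop_le t x : norm (expop A t x) <= exp (Rabs t * a) * norm x.
Proof.
apply: (series_norm_le _ _ _ _ (expop_series t x) _ (exp_majorant (Rabs t) x)).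
by move=> j; apply: norm_iter_scal; rewrite Rabs_exp_coef; lra.
Qed.

Lemma iter_plus j x y : Nat.iter j A (plus x y) = plus (Nat.iter j A x) (Nat.iter j A y).
Proof. by elim: j => [|j IH] //=; rewrite IH linear_plus. Qed.

Lemma iter_scal j r x : Nat.iter j A (scal r x) = scal r (Nat.iter j A x).
Proof. by elim: j => [|j IH] //=; rewrite IH linear_scal. Qed.

Lemma is_linear_expop t : is_linear (expop A t).
Proof.
split.
- move=> x y; apply: expop_unique.
  apply: is_series_ext (is_series_plus _ _ _ _ (expop_series t x) (expop_series t y)).
  by move=> j; rewrite iter_plus scal_distr_l.
- move=> r x; apply: expop_unique.
  apply: is_series_ext (is_series_scal r _ _ (expop_series t x)).
  move=> j; rewrite iter_scal !scal_assoc; congr (scal _ _).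
  exact: Rmult_comm.
- exists (exp (Rabs t * a)); split; first exact: exp_pos.
  exact: norm_expop_le.
Qed.

Lemma expop_0 x : expop A 0 x = x.
Proof.
apply: expop_unique.
have H0 : forall n, sum_n (fun j => scal (0 ^ j / INR (fact j)) (Nat.iter j A x)) n = x.
  elim=> [|n IH]; first by rewrite sum_O /= Rdiv_1_r; apply: (scal_one x).
  rewrite sum_Sn IH pow_ne_zero; last lia.
  rewrite /Rdiv Rmult_0_l; set y := Nat.iter _ _ _.
  by rewrite (scal_zero_l y) plus_zero_r.
by apply: (filterlim_ext (fun _ => x)); [move=> n; rewrite H0|apply: filterlim_const].
Qed.

Lemma expop_comm t x : expop A t (A x) = A (expop A t x).
Proof.
apply: expop_unique.
apply: is_series_ext (is_series_linear A _ _ HA (expop_series t x)) => j.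
rewrite linear_scal //; congr (scal _ _).
by elim: j => [|j IH] //=; rewrite IH.
Qed.

(** Subtracting the value at [t = 0] removes exactly the constant term of the
    majorant. *)
Lemma norm_expop_minus_le t x : norm (minus (expop A t x) x) <= (exp (Rabs t * a) - 1) * norm x.
Proof.
have Hs : is_series (fun j => scal ((t ^ j - 0 ^ j) / INR (fact j)) (Nat.iter j A x)) (minus
  (expop A t x) x).
  have H0 := is_series_scal (-1 : R_AbsRing) _ _ (expop_series 0 x).
  rewrite expop_0 in H0.
  have := is_series_plus _ _ _ _ (expop_series t x) H0.
  have -> : plus (expop A t x) (scal (-1 : R_AbsRing) x) = minus (expop A t x) x by module_eq V.
  apply: is_series_ext => j; module_eq V; rewrite /Rdiv; ring.
apply: (series_norm_le _ _ (fun j => (Rabs t ^ j - 0 ^ j) / INR (fact j) * a ^ j * norm x) _ Hs).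
  move=> j; apply: norm_iter_scal.
  have Hf : 0 < / INR (fact j) by apply: Rinv_0_lt_compat; apply: INR_fact_lt_0.
  rewrite /Rdiv Rabs_mult (Rabs_pos_eq (/ _)); last lra.
  apply: Rmult_le_compat_r; first lra.
  case: j {Hf} => [|j] /=; first by rewrite Rminus_diag Rabs_R0; lra.
  by rewrite Rmult_0_l !Rminus_0_r Rabs_mult RPow_abs; lra.
have H0 := is_series_scal_r (-1) _ _ (exp_majorant 0 x).
have := is_series_plus _ _ _ _ (exp_majorant (Rabs t) x) H0.
rewrite Rmult_0_l exp_0.
have -> : plus (exp (Rabs t * a) * norm x) (1 * norm x * -1) = (exp (Rabs t * a) - 1) * norm x :> R.
  by rewrite /plus /=; ring.
apply: is_series_ext => j; rewrite /plus /= /Rdiv; ring.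
Qed.

(** The second-order remainder of the [j]-th power.  By the binomial theorem it is a
    polynomial in [t] and [h] with nonnegative coefficients, hence dominated by its
    value at the absolute values ([Rabs_taylor2_le]). *)
Definition taylor2 (t h : R) (j : nat) := (t + h) ^ j - t ^ j - INR j * h * t ^ pred j.

Lemma taylor2_S t h j :
  taylor2 t h (S j) = (t + h) * taylor2 t h j + INR j * h ^ 2 * t ^ pred j.
Proof.
rewrite /taylor2; case: j => [|j]; first by rewrite /=; ring.
by rewrite !S_INR /=; ring.
Qed.

Lemma Rabs_taylor2_le t h j : Rabs (taylor2 t h j) <= taylor2 (Rabs t) (Rabs h) j.
Proof.
have H0 x y : taylor2 x y 0 = 0 by rewrite /taylor2 /=; ring.
elim: j => [|j IH]; first by rewrite !H0 Rabs_R0; lra.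
rewrite !taylor2_S; apply: Rle_trans (Rabs_triang _ _) _.
apply: Rplus_le_compat.
- rewrite Rabs_mult; apply: Rmult_le_compat; try exact: Rabs_pos; last done.
  exact: Rabs_triang.
- rewrite !Rabs_mult (Rabs_pos_eq (INR j)); last exact: pos_INR.
  by rewrite Rabs_R1 -RPow_abs /=; right; ring.
Qed.

(** The term [j = 0] vanishes and the others are those of [h A exp (t A) x], shifted
    by one. *)
Lemma expop_deriv_series t h x :
  is_series (fun j => scal (INR j * h * t ^ pred j / INR (fact j)) (Nat.iter j A x)) (scal h
    (A (expop A t x))).
Proof.
apply: is_series_decr_1.
have -> : plus (scal h (A (expop A t x))) (opp (scal (INR 0 * h * t ^ pred 0 / INR (fact 0))
  (Nat.iter 0 A x)))
  = scal h (A (expop A t x)).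
  by module_eq V; rewrite /= /Rdiv; ring.
apply: is_series_ext (is_series_scal h _ _ (is_series_linear A _ _ HA (expop_series t x))) => j.
rewrite linear_scal // scal_assoc; congr (scal _ _).
rewrite fact_simpl mult_INR /= -/(INR (S j)) S_INR /mult /=; field; split.
- by apply: INR_fact_neq_0.
- have := pos_INR j; lra.
Qed.

(** Majorizing each term by [Rabs_taylor2_le] sums up to the second-order remainder of
    the scalar exponential.  One estimate gives differentiability, continuity and,
    at [t = 0], the size of [exp (h A) - 1 - h A]. *)
Lemma expop_remainder t h x :
  norm (minus (minus (expop A (t + h) x) (expop A t x)) (scal h (A (expop A t x))))
  <= exp (Rabs t * a) * (exp (Rabs h * a) - 1 - Rabs h * a) * norm x.
Proof.
have Hs : is_series (fun j => scal (taylor2 t h j / INR (fact j)) (Nat.iter j A x))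
  (minus (minus (expop A (t + h) x) (expop A t x)) (scal h (A (expop A t x)))).
  have := is_series_plus _ _ _ _ (expop_series (t + h) x)
    (is_series_scal (-1 : R_AbsRing) _ _
      (is_series_plus _ _ _ _ (expop_series t x) (expop_deriv_series t h x))).
  have -> : plus (expop A (t + h) x) (scal (-1 : R_AbsRing) (plus (expop A t x) (scal h (A
    (expop A t x)))))
    = minus (minus (expop A (t + h) x) (expop A t x)) (scal h (A (expop A t x))) by module_eq V.
  apply: is_series_ext => j; rewrite /taylor2; module_eq V; rewrite /Rdiv; ring.
apply: (series_norm_le _ _ (fun j => taylor2 (Rabs t) (Rabs h) j / INR
  (fact j) * a ^ j * norm x) _ Hs).
  move=> j; apply: norm_iter_scal.
  have Hf : 0 < / INR (fact j) by apply: Rinv_0_lt_compat; apply: INR_fact_lt_0.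
  rewrite /Rdiv Rabs_mult (Rabs_pos_eq (/ _)); last lra.
  apply: Rmult_le_compat_r; first lra.
  exact: Rabs_taylor2_le.
have H1 := exp_majorant (Rabs t + Rabs h) x.
have H2 := exp_majorant (Rabs t) x.
have H3 : is_series (fun j => INR j * Rabs h * Rabs t ^ pred j / INR (fact j) * a ^ j * norm x)
   (Rabs h * a * exp (Rabs t * a) * norm x).
  apply: is_series_decr_1.
  have -> : plus (Rabs h * a * exp (Rabs t * a) * norm x) (opp
    (INR 0 * Rabs h * Rabs t ^ pred 0 / INR (fact 0) * a ^ 0 * norm x))
    = (exp (Rabs t * a) * norm x) * (Rabs h * a) :> R by rewrite /plus /opp /= /Rdiv; ring.
  apply: is_series_ext (is_series_scal_r (Rabs h * a) _ _ H2) => j.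
  rewrite fact_simpl mult_INR /= -/(INR (S j)) S_INR; field; split.
  - by apply: INR_fact_neq_0.
  - have := pos_INR j; lra.
have := is_series_plus _ _ _ _ H1 (is_series_scal_r (-1) _ _ (is_series_plus _ _ _ _ H2 H3)).
rewrite Rmult_plus_distr_r exp_plus.
have -> : plus (exp (Rabs t * a) * exp (Rabs h * a) * norm x)
     (plus (exp (Rabs t * a) * norm x) (Rabs h * a * exp (Rabs t * a) * norm x) * -1)
  = exp (Rabs t * a) * (exp (Rabs h * a) - 1 - Rabs h * a) * norm x :> R by rewrite /plus /=; ring.
by apply: is_series_ext => j; rewrite /taylor2 /plus /= /Rdiv; ring.
Qed.

End Expop.

(** * Variation of constants *)

(** From [1 - x <= exp (- x)], multiplied by [exp x]. *)
Lemma exp_minus1_le x : 0 <= x -> exp x - 1 <= x * exp x.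
Proof.
move=> Hx; have H := exp_ineq1_le (- x); rewrite exp_Ropp in H.
have He := exp_pos x.
have : exp x * (1 + - x) <= exp x * / exp x by apply: Rmult_le_compat_l; lra.
rewrite Rinv_r; lra.
Qed.

Lemma exp_le x y : x <= y -> exp x <= exp y.
Proof. by case=> [H| ->]; [left; apply: exp_increasing|right]. Qed.

Lemma exp_ge1 x : 0 <= x -> 1 <= exp x.
Proof. by move=> H; rewrite -exp_0; apply: exp_le. Qed.

Lemma is_RInt_linear {U V : NormedModule R_AbsRing} (L : U -> V) (f : R -> U) a b I :
  is_linear L -> is_RInt f a b I -> is_RInt (fun t => L (f t)) a b (L I).
Proof.
move=> HL; rewrite /is_RInt => H.
apply: (filterlim_ext (fun ptd => L (scal (sign (b - a)) (Riemann_sum f ptd)))).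
  move=> ptd; rewrite linear_scal //; congr (scal _ _).
  rewrite /Riemann_sum; move: (SF_h ptd, zero) (SF_t ptd) => p s.
  elim: s p => [|q s IH] p /=; first exact (linear_zero L HL).
  by rewrite -IH; etransitivity; [apply (linear_plus L HL)|rewrite linear_scal].
apply: filterlim_comp H _; exact: linear_cont.
Qed.

Lemma RInt_linear {U V : CompleteNormedModule R_AbsRing} (L : U -> V) (f : R -> U) a b :
  is_linear L -> ex_RInt f a b -> RInt (fun t => L (f t)) a b = L (RInt f a b).
Proof.
by move=> HL Hf; apply: is_RInt_unique; apply: is_RInt_linear => //; apply: RInt_correct.
Qed.

(** Comparison with the explicit primitive of [exp (- l (r - x)) exp (- k x)].  Neither
    sign of [l - k] is excluded: the weight may grow ([k] negative) or decay. *)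
Lemma convolution_bound {V : NormedModule R_AbsRing} (g : R -> V) s r M W l k I :
  s <= r -> l <> k ->
  (forall x, s <= x <= r -> norm (g x) <= M * exp (- l * (r - x)) * (W * exp (- k * x))) ->
  is_RInt g s r I ->
  norm I <= M * W * exp (- k * r) * ((1 - exp (- (l - k) * (r - s))) / (l - k)).
Proof.
move=> Hsr Hlk Hg HI.
pose G := fun x => M * W * exp (- l * r) * (exp ((l - k) * x) / (l - k)).
apply: (norm_RInt_le g (fun x => M * exp (- l * (r - x)) * (W * exp (- k * x))) s r I _ Hsr Hg HI).
have -> : M * W * exp (- k * r) * ((1 - exp (- (l - k) * (r - s))) / (l - k)) = minus (G r) (G s).
  rewrite /G /minus /plus /opp /=.
  have E1 : exp (- k * r) = exp (- l * r) * exp ((l - k) * r) by rewrite -exp_plus; f_equal; ring.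
  have E2 : exp (- k * r) * exp (- (l - k) * (r - s)) = exp (- l * r) * exp ((l - k) * s).
    by rewrite -!exp_plus; f_equal; ring.
  transitivity (M * W * ((exp (- k * r) - exp (- k * r) * exp (- (l - k) * (r - s))) / (l - k))).
    field; lra.
  rewrite E2 E1; field; lra.
apply: is_RInt_derive => x _.
- rewrite /G; auto_derive => //.
  have E1 : exp (- l * (r - x)) * exp (- k * x) = exp (- l * r) * exp ((l - k) * x).
    by rewrite -!exp_plus; f_equal; ring.
  transitivity (M * W * (exp (- l * r) * exp ((l - k) * x))); first by field; lra.
  rewrite -E1; ring.
- apply: ex_derive_continuous; auto_derive => //.
Qed.

Section ExpopCalculus.
Variables (V : CompleteNormedModule R_AbsRing) (A : V -> V) (a : R).
Hypothesis (HA : is_linear A) (Ha0 : 0 <= a)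
  (Ha : forall x, norm (A x) <= a * norm x).
Notation E := (expop A).

Lemma expop_increment t h x :
  norm (minus (E (t + h) x) (E t x)) <= exp (Rabs t * a) * (exp (Rabs h * a) - 1) * norm x.
Proof.
have -> : minus (E (t + h) x) (E t x) = plus (minus (minus (E (t +
  h) x) (E t x)) (scal h (A (E t x)))) (scal h (A (E t x))) by module_eq V.
apply: Rle_trans (norm_triangle _ _) _.
have H1 := expop_remainder V A a HA Ha0 Ha t h x.
have H2 : norm (scal h (A (E t x))) <= exp (Rabs t * a) * (Rabs h * a) * norm x.
  apply: Rle_trans (norm_scal_R _ _) _.
  have H := Ha (E t x); have H' := norm_expop_le V A a Ha0 Ha t x.
  have : a * norm (E t x) <= a * (exp (Rabs t * a) * norm x) by apply: Rmult_le_compat_l.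
  move=> H''; have := Rabs_pos h => Hh.
  have : Rabs h * norm (A (E t x)) <= Rabs h * (a * (exp (Rabs t * a) * norm x)).
    by apply: Rmult_le_compat_l => //; apply: Rle_trans H _.
  lra.
lra.
Qed.

(** Joint differentiability in time and vector, from which every chain rule below
    follows.  The error splits into the time remainder at [z] and the increment in
    time of the exponential at the small vector [k]. *)
Lemma filterdiff_expop t z :
  filterdiff (fun p : R_NormedModule * V => E (fst p) (snd p)) (locally (t, z))
    (fun p => plus (scal (fst p) (A (E t z))) (E t (snd p))).
Proof.
split.
  split.
  - move=> [h1 k1] [h2 k2] /=.
    rewrite (linear_plus _ (is_linear_expop V A a HA Ha0 Ha t)) (scal_distr_r (h1 : R_AbsRing)).
    by module_eq V.
  - move=> r [h1 k1] /=.
    rewrite (linear_scal _ (is_linear_expop V A a HA Ha0 Ha t)).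
    change (scal (r : R_AbsRing) h1) with (r * h1).
    by module_eq V.
  - exists (norm (A (E t z)) + exp (Rabs t * a)); split.
      have := norm_ge_0 (A (E t z)); have := exp_pos (Rabs t * a); lra.
    move=> [h k] /=.
    have Hn := norm_prod (h : R_NormedModule) k.
    have Hh : Rabs h <= norm (h, k) by apply: Rle_trans (proj1 Hn);
      apply: (Rmax_l (norm (h : R_NormedModule))).
    have Hk : norm k <= norm (h, k) by apply: Rle_trans (proj1 Hn); apply: Rmax_r.
    apply: Rle_trans (norm_triangle _ _) _.
    rewrite Rmult_plus_distr_r; apply: Rplus_le_compat.
    + apply: Rle_trans (norm_scal_R _ _) _; rewrite Rmult_comm; apply: Rmult_le_compat_l => //;
      exact: norm_ge_0.
    + apply: Rle_trans (norm_expop_le V A a Ha0 Ha t k) _; apply: Rmult_le_compat_l => //;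
      left; exact: exp_pos.
move=> x Hx.
have <- := is_filter_lim_locally_unique _ _ Hx => {x Hx}.
move=> eps.
pose c := exp (Rabs t * a).
have Hc : 0 < c by apply: exp_pos.
pose n := a * norm z + 1.
have Hn : 0 < n by rewrite /n; have := Rmult_le_pos _ _ Ha0 (norm_ge_0 z); lra.
pose eta := eps / (c * n).
have Heta : 0 < eta by apply: Rdiv_lt_0_compat; [apply: cond_pos|apply: Rmult_lt_0_compat].
(* For |h| < d one has exp (|h| a) - 1 <= eta. *)
pose d := ln (1 + eta) / (a + 1).
have Hln : 0 < ln (1 + eta) by rewrite -ln_1; apply: ln_increasing; lra.
have Hd : 0 < d by apply: Rdiv_lt_0_compat; lra.
exists (mkposreal d Hd) => -[s y] [/= Hs Hy].
set h := s - t; set k := minus y z.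
have Hh : Rabs h < d by exact: Hs.
change (norm (minus (minus (E s y) (E t z)) (plus (scal h (A (E t z))) (E t k))) <=
  eps * norm (minus ((s, y) : prod_NormedModule _ R_NormedModule V) (t, z))).
have Hnp := norm_prod (h : R_NormedModule) k.
have -> : minus ((s, y) : prod_NormedModule _ R_NormedModule V) (t, z) = (h, k) by [].
have Hh' : Rabs h <= norm (h, k) by apply: Rle_trans (proj1 Hnp);
  apply: (Rmax_l (norm (h : R_NormedModule))).
have Hk' : norm k <= norm (h, k) by apply: Rle_trans (proj1 Hnp); apply: Rmax_r.
have He1 : exp (Rabs h * a) - 1 <= eta.
  have : Rabs h * a <= ln (1 + eta).
    have -> : ln (1 + eta) = d * (a + 1) by rewrite /d; field; lra.
    have := Rabs_pos h; nra.
  move/exp_le; rewrite exp_ln; lra.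
have Hha : 0 <= Rabs h * a by apply: Rmult_le_pos => //; apply: Rabs_pos.
have He0 : 0 <= exp (Rabs h * a) - 1 by have := exp_ge1 _ Hha; lra.
have He2 : exp (Rabs h * a) - 1 - Rabs h * a <= Rabs h * a * eta.
  have := exp_minus1_le _ Hha; nra.
have -> : minus (minus (E s y) (E t z)) (plus (scal h (A (E t z))) (E t k))
  = plus (minus (minus (E (t + h) z) (E t z)) (scal h (A (E t z)))) (minus (E (t + h) k) (E t k)).
  have -> : t + h = s by rewrite /h; ring.
  have -> : E s k = minus (E s y) (E s z) by apply: linear_minus; apply: is_linear_expop Ha _.
  by module_eq V.
apply: Rle_trans (norm_triangle _ _) _.
apply: Rle_trans (Rplus_le_compat _ _ _ _ (expop_remainder V A a HA Ha0 Ha t h z)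
  (expop_increment t h k)) _.
rewrite -/c.
have Hz := norm_ge_0 z; have Hk0 := norm_ge_0 k.
have N0 : 0 <= norm (h, k) by apply: norm_ge_0.
have B1 : (exp (Rabs h * a) - 1 - Rabs h * a) * norm z <= norm (h, k) * eta * (a * norm z).
  have : (exp (Rabs h * a) - 1 - Rabs h * a) * norm z <= (Rabs h * a * eta) * norm z by
    apply: Rmult_le_compat_r.
  have : Rabs h * (a * eta * norm z) <= norm (h, k) * (a * eta * norm z).
    apply: Rmult_le_compat_r => //; apply: Rmult_le_pos => //; apply: Rmult_le_pos => //; lra.
  lra.
have B2 : (exp (Rabs h * a) - 1) * norm k <= norm (h, k) * eta.
  rewrite (Rmult_comm (norm (h, k))); apply: Rmult_le_compat => //.
have -> : eps * norm (h, k) = c * (norm (h, k) * eta * (a * norm z) + norm (h, k) * eta).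
  by rewrite /eta /n; field; split; [rewrite -/n|]; lra.
apply: (Rle_trans _ (c * ((exp (Rabs h * a) - 1 - Rabs h * a) * norm z +
  (exp (Rabs h * a) - 1) * norm k))).
  by right; ring.
by apply: Rmult_le_compat_l; [left|apply: Rplus_le_compat].
Qed.

Lemma is_derive_expop_apply (f : R -> R) t lf (Z : R -> V) lZ :
  is_derive f t lf -> is_derive Z t lZ ->
  is_derive (fun x => E (f x) (Z x)) t (plus (scal lf (A (E (f t) (Z t)))) (E (f t) lZ)).
Proof.
move=> Hf HZ.
have := filterdiff_comp'_2 f Z (fun s y => E s y) t _ _
  (fun h k => plus (scal h (A (E (f t) (Z t)))) (E (f t) k)) Hf HZ (filterdiff_expop (f t) (Z t)).
move=> H; apply: filterdiff_ext_lin H _ => y /=.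
rewrite (linear_scal _ (is_linear_expop V A a HA Ha0 Ha _)).
change (scal y lf) with (y * lf).
by module_eq V.
Qed.

Lemma continuous_expop_apply (f : R -> R) t (Z : R -> V) :
  continuous f t -> continuous Z t -> continuous (fun x => E (f x) (Z x)) t.
Proof.
move=> Hf HZ.
apply: (continuous_comp_2 f Z (fun s y => E s y) t Hf HZ).
apply: (filterdiff_continuous (U := prod_NormedModule _ R_NormedModule V)).
eexists; exact: filterdiff_expop.
Qed.

(** The integrand is the derivative of [exp ((r - t) A) Z(t)], because [A] commutes with
    its exponential. *)
Lemma variation_of_constants (Z w : R -> V) s r :
  (forall t, Rmin s r <= t <= Rmax s r -> is_derive Z t (plus (A (Z t)) (w t))) ->
  (forall t, Rmin s r <= t <= Rmax s r -> continuous w t) ->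
  is_RInt (fun t => E (r - t) (w t)) s r (minus (Z r) (E (r - s) (Z s))).
Proof.
move=> HZ Hw.
have H : is_RInt (fun t => E (r - t) (w t)) s r (minus (E (r - r) (Z r)) (E (r - s) (Z s))).
  apply: (is_RInt_derive (fun t => E (r - t) (Z t))) => t Ht.
  - have Hd : is_derive (fun t => r - t) t (-1) by auto_derive => //; ring.
    have := is_derive_expop_apply _ _ _ _ _ Hd (HZ t Ht).
    have -> // : plus (scal (-1) (A (E (r - t) (Z t)))) (E (r - t) (plus (A (Z t)) (w t))) =
      E (r - t) (w t).
    rewrite (linear_plus _ (is_linear_expop V A a HA Ha0 Ha _)) (expop_comm V A a HA Ha0 Ha).
    by module_eq V.
  - apply: continuous_expop_apply; last exact: Hw.
    by apply: ex_derive_continuous; auto_derive.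
by move: H; rewrite Rminus_diag (expop_0 V A a Ha0 Ha).
Qed.

Lemma is_derive_expop t x : is_derive (fun s => E s x) t (A (E t x)).
Proof.
have := is_derive_expop_apply (fun s => s) t 1 (fun _ => x) zero (is_derive_id _)
  (is_derive_const _ _).
rewrite (linear_zero _ (is_linear_expop V A a HA Ha0 Ha t)).
have -> // : plus (scal 1 (A (E t x))) zero = A (E t x) by module_eq V.
Qed.

(** Variation of constants for the homogeneous equation solved by [exp (t A) x]. *)
Lemma expop_plus s t x : E (s + t) x = E s (E t x).
Proof.
have H := variation_of_constants (fun r => E r x) (fun _ => zero) t (s + t) _ _.
have {}H : is_RInt (fun r => E (s + t - r) zero) t (s + t) (minus (E (s + t) x) (E (s +
  t - t) (E t x))).
  apply: H => r _; last exact: continuous_const.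
  have -> : plus (A (E r x)) zero = A (E r x) by rewrite plus_zero_r.
  exact: is_derive_expop.
have H0 : is_RInt (fun r => E (s + t - r) zero) t (s + t) zero.
  apply: (is_RInt_ext (fun _ => zero)).
    by move=> r _; rewrite (linear_zero _ (is_linear_expop V A a HA Ha0 Ha _)).
  have := is_RInt_const t (s + t) (zero : V); by rewrite scal_zero_r.
have Hz : minus (E (s + t) x) (E (s + t - t) (E t x)) = zero.
  by rewrite -(is_RInt_unique _ _ _ _ H) (is_RInt_unique _ _ _ _ H0).
have -> : E s (E t x) = E (s + t - t) (E t x) by congr (expop A _ _); ring.
have -> : E (s + t) x = plus (minus (E (s + t) x) (E (s + t - t) (E t x))) (E (s +
  t - t) (E t x)) by module_eq V.
by rewrite Hz plus_zero_l.
Qed.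

(** The logarithmic norm bounds the growth: writing [t = n h], the norm of
    [exp (t A) = exp (h A)^n] is at most [exp (n (omega h + O(h^2)))], and [n] tends to
    infinity.  For a scalar [lam] this gives the rate [Re lam] without a complex
    exponential function. *)
Lemma expop_growth omega c :
  0 <= c ->
  (forall h x, 0 <= h -> norm (plus x (scal h (A x))) <= (1 + omega * h + c * h ^ 2) * norm x) ->
  forall t x, 0 <= t -> norm (E t x) <= exp (omega * t) * norm x.
Proof.
move=> Hc Hom t x Ht.
pose c' := c + a ^ 2 * exp a.
have Hc' : 0 <= c' by have := pow2_ge_0 a; have := exp_pos a; rewrite /c'; nra.
have step h y : 0 <= h <= 1 -> norm (E h y) <= exp (omega * h + c' * h ^ 2) * norm y.
  move=> Hh.
  have Hr := expop_remainder V A a HA Ha0 Ha 0 h y.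
  rewrite Rplus_0_l (expop_0 V A a Ha0 Ha) Rabs_R0 Rmult_0_l exp_0 Rmult_1_l
    (Rabs_pos_eq h) in Hr; last lra.
  have Hha : 0 <= h * a by nra.
  have Hq : exp (h * a) - 1 - h * a <= a ^ 2 * exp a * h ^ 2.
    have H1 := exp_minus1_le _ Hha.
    have H2 : h * a * exp (h * a) - h * a <= h * a * (h * a * exp (h * a)) by nra.
    have H3 : exp (h * a) <= exp a by apply: exp_le; nra.
    have : h * a * (h * a * exp (h * a)) <= h * a * (h * a * exp a) by
      apply: (Rmult_le_compat_l _ _ _ Hha); apply: (Rmult_le_compat_l _ _ _ Hha).
    lra.
  have -> : E h y = plus (plus y (scal h (A y))) (minus (minus (E h y) y) (scal h (A y))) by
    module_eq V.
  apply: Rle_trans (norm_triangle _ _) _.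
  have H1 := Hom h y (proj1 Hh).
  have Hy := norm_ge_0 y.
  have H2 := Rmult_le_compat_r _ _ _ Hy Hq.
  have H3 := Rmult_le_compat_r _ _ _ Hy (exp_ineq1_le (omega * h + c' * h ^ 2)).
  rewrite /c' in H3 *; lra.
have iter_ h n : 0 <= h <= 1 -> norm (E (INR n * h) x) <= exp (INR n * (omega * h +
  c' * h ^ 2)) * norm x.
  move=> Hh; elim: n => [|n IH].
    by rewrite /= !Rmult_0_l (expop_0 V A a Ha0 Ha) exp_0; lra.
  rewrite S_INR.
  have -> : (INR n + 1) * h = h + INR n * h by ring.
  rewrite expop_plus.
  apply: Rle_trans (step _ _ Hh) _.
  have -> : (INR n + 1) * (omega * h + c' * h ^ 2) = (omega * h + c' * h ^ 2) +
    INR n * (omega * h + c' * h ^ 2) by ring.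
  rewrite (exp_plus (omega * h + c' * h ^ 2)) Rmult_assoc.
  by apply: Rmult_le_compat_l => //; left; exact: exp_pos.
have all_eta eta : 0 < eta -> norm (E t x) <= exp (omega * t) * exp eta * norm x.
  move=> Heta.
  have [n Hn] := INR_unbounded (Rmax 1 (Rmax t (c' * t ^ 2 / eta))).
  have M1 := Rmax_l 1 (Rmax t (c' * t ^ 2 / eta)); have M2 := Rmax_r 1 (Rmax t (c' * t ^ 2 / eta)).
  have M3 := Rmax_l t (c' * t ^ 2 / eta); have M4 := Rmax_r t (c' * t ^ 2 / eta).
  have Hn0 : 0 < INR n by lra.
  have Hh : 0 <= t / INR n <= 1.
    split; first by apply: Rdiv_le_0_compat.
    by apply/Rle_div_l => //; lra.
  have := iter_ _ n Hh.
  have -> : INR n * (t / INR n) = t by field; lra.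
  have -> : INR n * (omega * (t / INR n) + c' * (t / INR n) ^ 2) = omega * t +
    c' * t ^ 2 / INR n by field; lra.
  move=> H; apply: Rle_trans H _.
  apply: Rmult_le_compat_r; first exact: norm_ge_0.
  rewrite -exp_plus; apply: exp_le; apply: Rplus_le_compat_l.
  apply/Rle_div_l => //.
  have : c' * t ^ 2 / eta <= INR n by lra.
  by move=> H'; have := proj1 (Rle_div_l _ _ _ Heta) H'; lra.
apply: le_epsilon => eps Heps.
set N := norm (E t x) in all_eta *.
have HN : 0 <= N by apply: norm_ge_0.
pose eta := Rmin (1 / 2) (eps / (N + 1)).
have Heta : 0 < eta by apply: Rmin_pos; [lra|apply: Rdiv_lt_0_compat; lra].
have Heta1 : eta <= 1 / 2 by apply: Rmin_l.
have Heta2 : eta * (N + 1) <= eps by apply/Rle_div_r; [lra|apply: Rmin_r].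
have H := all_eta eta Heta.
have H1 := exp_ineq1_le (- eta).
have H2 : (1 - eta) * N <= exp (- eta) * (exp (omega * t) * exp eta * norm x).
  apply: Rmult_le_compat => //; lra.
have H3 : exp (- eta) * (exp (omega * t) * exp eta * norm x) = exp (omega * t) * norm x.
  transitivity (exp (- eta + eta) * exp (omega * t) * norm x); first by rewrite exp_plus; ring.
  rewrite Rplus_opp_l exp_0; ring.
nra.
Qed.

End ExpopCalculus.

(** * Small-gain estimate for the delayed feedback loop *)

Lemma continuous_max (f : R -> R) T : 0 <= T ->
  (forall t, 0 <= t <= T -> continuous f t) ->
  exists s, 0 <= s <= T /\ forall t, 0 <= t <= T -> f t <= f s.
Proof.
move=> HT Hf.
have [|s [H1 H2]] := continuity_ab_maj f 0 T HT; last by exists s.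
by move=> c Hc; apply/continuity_pt_filterlim; apply: Hf.
Qed.

Lemma continuous_norm_weighted {V : NormedModule R_AbsRing} (f : R -> V) k t :
  continuous f t -> continuous (fun s => exp (k * s) * norm (f s)) t.
Proof.
move=> Hf.
apply: (continuous_mult (fun s => exp (k * s)) (fun s => norm (f s))).
- by apply: ex_derive_continuous; auto_derive.
- by apply: filterlim_comp Hf _; apply: filterlim_norm.
Qed.

Lemma exp_neg_mult x : exp x * exp (- x) = 1.
Proof. by rewrite -exp_plus Rplus_opp_r exp_0. Qed.

(** Exponentially weighted signals: [k] is a decay rate, and a negative [k] allows
    growth. *)
Lemma weight_le k t x W : exp (k * t) * x <= W <-> x <= W * exp (- k * t).
Proof.
have H := exp_neg_mult (k * t); have H1 := exp_pos (k * t).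
rewrite (_ : - k * t = - (k * t)); last by ring.
have H2 := exp_pos (- (k * t)).
split=> Hx.
- have := Rmult_le_compat_r _ _ _ (Rlt_le _ _ H2) Hx.
  have -> : exp (k * t) * x * exp (- (k * t)) = exp (k * t) * exp (- (k * t)) * x by ring.
  rewrite H; lra.
- have := Rmult_le_compat_l _ _ _ (Rlt_le _ _ H1) Hx.
  have -> : exp (k * t) * (W * exp (- (k * t))) = exp (k * t) * exp (- (k * t)) * W by ring.
  rewrite H; lra.
Qed.

Section Perturbed.
Variables (V : CompleteNormedModule R_AbsRing) (A : V -> V) (a M l : R).
Hypothesis (HA : is_linear A) (Ha0 : 0 <= a)
  (Ha : forall x, norm (A x) <= a * norm x) (HM : 0 <= M)
  (Hdec : forall t x, 0 <= t -> norm (expop A t x) <= M * exp (- l * t) * norm x).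
Variables (Z w : R -> V) (T k W : R).
Hypothesis (HZ : forall t, 0 <= t <= T -> is_derive Z t (plus (A (Z t)) (w t)))
  (Hw : forall t, 0 <= t <= T -> continuous w t)
  (Hkl : k < l) (HW : forall t, 0 <= t <= T -> norm (w t) <= W * exp (- k * t)).

Lemma perturbed_step s r : 0 <= s <= r -> r <= T ->
  norm (minus (Z r) (expop A (r - s) (Z s)))
  <= M * W * exp (- k * r) * ((1 - exp (- (l - k) * (r - s))) / (l - k)).
Proof.
move=> Hs Hr.
apply: (convolution_bound (fun t => expop A (r - t) (w t)) s r); first lra; first lra.
- move=> x Hx; apply: Rle_trans (Hdec _ _ _) _; first lra.
  apply: Rmult_le_compat_l; last by apply: HW; lra.
  by apply: Rmult_le_pos => //; left; apply: exp_pos.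
- apply: (variation_of_constants V A a HA Ha0 Ha) => t.
  all: rewrite Rmin_left ?Rmax_right; try lra.
  + move=> Ht; apply: HZ; lra.
  + move=> Ht; apply: Hw; lra.
Qed.

Lemma W_ge0 : 0 <= T -> 0 <= W.
Proof.
move=> HT; have H := HW 0 (conj (Rle_refl _) HT).
rewrite Rmult_0_r exp_0 Rmult_1_r in H; have := norm_ge_0 (w 0); lra.
Qed.

(** First estimate of the loop: the trajectory in terms of its initial value and of
    the weighted supremum [W] of the perturbation. *)
Lemma perturbed_bound t : 0 <= t <= T ->
  norm (Z t) <= (M * norm (Z 0) + M * W / (l - k)) * exp (- k * t).
Proof.
move=> Ht.
have HW0 : 0 <= W by apply: W_ge0; lra.
have Hst := perturbed_step 0 t (conj (Rle_refl _) (proj1 Ht)) (proj2 Ht).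
rewrite Rminus_0_r in Hst.
have -> : Z t = plus (minus (Z t) (expop A t (Z 0))) (expop A t (Z 0)) by module_eq V.
apply: Rle_trans (norm_triangle _ _) _.
rewrite Rplus_comm Rmult_plus_distr_r; apply: Rplus_le_compat.
- apply: Rle_trans (Hdec _ _ (proj1 Ht)) _.
  have : exp (- l * t) <= exp (- k * t) by apply: exp_le; nra.
  move=> He; have := Rmult_le_compat_l _ _ _ (Rmult_le_pos _ _ HM (norm_ge_0 (Z 0))) He; lra.
- apply: Rle_trans Hst _.
  have -> : M * W / (l - k) * exp (- k * t) = M * W * exp (- k * t) * (1 / (l - k)) by field; lra.
  apply: Rmult_le_compat_l.
    by apply: Rmult_le_pos; [apply: Rmult_le_pos|left; apply: exp_pos].
  apply: Rmult_le_compat_r; first by left; apply: Rinv_0_lt_compat; lra.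
  by have := exp_pos (- (l - k) * t); lra.
Qed.

(** Second estimate of the loop: an increment over a time at most [d] is small with
    [d], both through [exp (a d) - 1] acting on the trajectory and through the short
    interval on which the perturbation acts. *)
Lemma perturbed_increment z d s r : 0 <= s <= r -> r <= T -> r - s <= d -> 0 <= k ->
  (forall t, 0 <= t <= T -> norm (Z t) <= z * exp (- k * t)) ->
  norm (minus (Z r) (Z s))
  <= exp (- k * s) * ((exp (a * d) - 1) * z + M * W * ((1 - exp (- (l - k) * d)) / (l - k))).
Proof.
move=> Hs Hr Hd Hk0 Hz.
have HW0 : 0 <= W by apply: W_ge0; lra.
have -> : minus (Z r) (Z s) = plus (minus (expop A (r - s) (Z s)) (Z s)) (minus (Z r) (expop A
  (r - s) (Z s))) by module_eq V.
apply: Rle_trans (norm_triangle _ _) _.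
rewrite Rmult_plus_distr_l; apply: Rplus_le_compat.
- apply: Rle_trans (norm_expop_minus_le V A a Ha0 Ha _ _) _.
  rewrite Rabs_pos_eq; last lra.
  have -> : exp (- k * s) * ((exp (a * d) - 1) * z) =
    (exp (a * d) - 1) * (z * exp (- k * s)) by ring.
  apply: Rmult_le_compat; last by apply: Hz; lra.
  + have : 1 <= exp ((r - s) * a) by apply: exp_ge1; nra.
    lra.
  + exact: norm_ge_0.
  + have : exp ((r - s) * a) <= exp (a * d) by apply: exp_le; nra.
    lra.
- apply: Rle_trans (perturbed_step s r Hs Hr) _.
  have Hlk : 0 < / (l - k) by apply: Rinv_0_lt_compat; lra.
  have H1 : exp (- k * r) <= exp (- k * s) by apply: exp_le; nra.
  have H2 : exp (- (l - k) * d) <= exp (- (l - k) * (r - s)) by apply: exp_le; nra.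
  have H3 : exp (- (l - k) * (r - s)) <= 1 by rewrite -exp_0; apply: exp_le; nra.
  have -> : exp (- k * s) * (M * W * ((1 - exp (- (l - k) * d)) / (l - k)))
   = M * W * exp (- k * s) * ((1 - exp (- (l - k) * d)) / (l - k)) by ring.
  have HMW := Rmult_le_pos _ _ HM HW0.
  apply: Rmult_le_compat.
  + by apply: Rmult_le_pos => //; left; apply: exp_pos.
  + apply: Rmult_le_pos; lra.
  + exact: Rmult_le_compat_l.
  + apply: Rmult_le_compat_r; lra.
Qed.
End Perturbed.

Section SmallGain.
Variables (V U : CompleteNormedModule R_AbsRing) (A : V -> V) (B F : U -> V) (K : V -> U).
Hypothesis (HA : is_linear A) (HB : is_linear B) (HF : is_linear F) (HK : is_linear K).
Let Acl x := plus (A x) (F (K x)).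
Variables (a M l g alpha t0 D0 delta : R) (phi : R -> R).
Hypothesis (Ha0 : 0 <= a) (Ha : forall x, norm (Acl x) <= a * norm x)
  (HM : 0 <= M) (Hl : 0 < l)
  (Hdec : forall t x, 0 <= t -> norm (expop Acl t x) <= M * exp (- l * t) * norm x)
  (Hg0 : 0 <= g) (Hg : forall x, norm (B (K x)) <= g * norm x)
  (Halpha : 0 < alpha) (Ht0 : 0 < t0) (Hdelta : 0 < delta < D0)
  (Hphi : forall t, 0 <= phi t <= 1) (Hphi1 : forall t, t0 <= t -> phi t = 1)
  (Hgain : M * g * (exp (a * delta) - exp (- l * delta)) < l).

Lemma is_linear_plus2 {X Y : NormedModule R_AbsRing} (f h : X -> Y) :
  is_linear f -> is_linear h -> is_linear (fun x => plus (f x) (h x)).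
Proof.
move=> Hf Hh; split.
- move=> x y; rewrite (linear_plus f Hf) (linear_plus h Hh); module_eq Y.
- move=> r x; rewrite (linear_scal f Hf) (linear_scal h Hh).
  by rewrite scal_distr_l.
- have [m1 [H1 H2]] := linear_norm f Hf; have [m2 [H3 H4]] := linear_norm h Hh.
  exists (m1 + m2); split; first lra.
  move=> x; apply: Rle_trans (norm_triangle _ _) _.
  have := H2 x; have := H4 x; lra.
Qed.

Lemma is_linear_Acl : is_linear Acl.
Proof. apply: is_linear_plus2 => //; exact: is_linear_comp. Qed.

(** The loop is a contraction in the norm weighted by [exp (k t)] when this number is
    negative; [exp (k (D0 + delta))] is the price for shifting the weight by a delay. *)
Definition gain (k : R) := M * g * exp (k * (D0 +
  delta)) * (exp (a * delta) - exp (- (l - k) * delta)) - (l - k).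

(** At [k = 0] negativity is the small-gain hypothesis; the rest is continuity. *)
Lemma gain_exists : exists k, 0 < k /\ k < l /\ k < alpha /\ gain k < 0.
Proof.
have Hc : continuous gain 0.
  by apply: ex_derive_continuous; rewrite /gain; auto_derive.
have Hg0' : gain 0 < 0.
  rewrite /gain !Rminus_0_r Rmult_0_l exp_0; lra.
have [d Hd] := Hc _ (open_lt 0 _ Hg0').
pose k := Rmin (d / 2) (Rmin (l / 2) (alpha / 2)).
have k1 : k <= d / 2 by apply: Rmin_l.
have k2 : k <= l / 2 by apply: Rle_trans (Rmin_r _ _) (Rmin_l _ _).
have k3 : k <= alpha / 2 by apply: Rle_trans (Rmin_r _ _) (Rmin_r _ _).
have Hd0 := cond_pos d.
have k0 : 0 < k by apply: Rmin_pos; [lra|apply: Rmin_pos; lra].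
exists k; split=> //; split; first lra; split; first lra.
apply: Hd; rewrite /ball /= /AbsRing_ball /abs /= /minus /plus /opp /= Ropp_0 Rplus_0_r
  Rabs_pos_eq; lra.
Qed.

(** The loop after adding the prediction.  The time horizon [T] is part of the data
    because the estimate must see the disturbances only up to [T].  Continuity is
    asked on the whole line since the signals come from extensions. *)
Record loop_data (Z : R -> V) (u d1 d2 : R -> U) (D : R -> R) (T k E : R) : Prop := {
  ld_Z : forall t, 0 <= t <= T -> is_derive Z t
    (plus (A (Z t)) (plus (F (u t)) (plus (B (minus (u (t - D t)) (u (t - D0)))) (B (d1 t)))));
  ld_u : forall t, 0 <= t <= T -> u t = scal (phi t) (plus (K (Z t)) (d2 t));
  ld_u0 : forall t, - D0 - delta <= t <= 0 -> u t = zero;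
  ld_D : forall t, 0 <= t <= T -> Rabs (D t - D0) <= delta;
  ld_cu : forall t, continuous u t;
  ld_cD : forall t, continuous D t;
  ld_cd : forall t, continuous d1 t;
  ld_d1 : forall t, 0 <= t <= T -> norm (d1 t) <= E * exp (- k * t);
  ld_d2 : forall t, 0 <= t <= T -> norm (d2 t) <= E * exp (- k * t)
}.

Arguments ld_Z {Z u d1 d2 D T k E} _.
Arguments ld_u {Z u d1 d2 D T k E} _.
Arguments ld_u0 {Z u d1 d2 D T k E} _.
Arguments ld_D {Z u d1 d2 D T k E} _.
Arguments ld_cu {Z u d1 d2 D T k E} _.
Arguments ld_cD {Z u d1 d2 D T k E} _.
Arguments ld_cd {Z u d1 d2 D T k E} _.
Arguments ld_d1 {Z u d1 d2 D T k E} _.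
Arguments ld_d2 {Z u d1 d2 D T k E} _.

(** The perturbation [w] of [Z' = Acl Z + w] is maximal, in the weighted norm, at some
    [s1].  If [s1] lies beyond [T1 = t0 + D0 + delta], both delayed arguments exceed [t0],
    the feedback is the nominal one there, and the two estimates above give
    [W <= q W + C (|Z(0)| + E)] with [q < 1].  If [s1 <= T1], the transition signal may
    be anything between 0 and 1, but only a bounded time has elapsed. *)
Lemma small_gain : exists k C, 0 < k /\ k < alpha /\ 0 <= C /\
  forall Z u d1 d2 D T E, loop_data Z u d1 d2 D T k E ->
  forall t, 0 <= t <= T -> norm (Z t) <= C * (norm (Z 0) + E) * exp (- k * t).
Proof.
have [k [k0 [kl [ka kg]]]] := gain_exists.
have [f [f0 Hf]] := linear_norm F HF.
have [b [b0 Hb]] := linear_norm B HB.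
have [kk [kk0 Hkk]] := linear_norm K HK.
pose T1 := t0 + D0 + delta.
pose c0 := 2 * kk * (f + b).
have Hc0 : 0 < c0 by rewrite /c0; nra.
pose c1 := f + 3 * b.
pose gam := 2 * M * c0.
have Hgam : 0 <= gam by rewrite /gam; nra.
pose p := exp (k * (D0 + delta)).
have Hp : 1 <= p by apply: exp_ge1; nra.
pose q := M * g * p * (exp (a * delta) - exp (- (l - k) * delta)) / (l - k).
have Hq : q < 1.
  apply/Rlt_div_l; first lra.
  by move: kg; rewrite /gain -/p; lra.
pose Cr := exp (k * T1) * exp (gam * T1) * (c0 * (2 * M + 2 * M * c1 / l) + c1).
pose ea := exp (a * delta) - 1.
have Hea : 0 <= ea by rewrite /ea; have : 1 <= exp (a * delta); [apply: exp_ge1; nra|lra].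
pose Cm := f + g * p * ea * M + 2 * b * p + b.
pose CW := (Cm + Cr) / (1 - q).
have HCr : 0 <= Cr.
  rewrite /Cr /c1; apply: Rmult_le_pos.
    by apply: Rmult_le_pos; left; apply: exp_pos.
  have : 0 <= 2 * M * (f + 3 * b) / l by apply: Rdiv_le_0_compat; nra.
  move=> H; have : 0 <= c0 * (2 * M + 2 * M * (f + 3 * b) / l) by apply: Rmult_le_pos; lra.
  lra.
have HCm : 0 <= Cm.
  rewrite /Cm.
  have : 0 <= g * p * ea * M by repeat apply: Rmult_le_pos => //; lra.
  have : 0 <= b * p by apply: Rmult_le_pos; lra.
  lra.
have HCW : 0 <= CW by apply: Rdiv_le_0_compat; lra.
have HCWq : CW * (1 - q) = Cm + Cr by rewrite /CW; field; lra.
exists k, (M + M * CW / (l - k)); split=> //; split=> //; split.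
  have : 0 <= M * CW / (l - k) by apply: Rdiv_le_0_compat; nra.
  lra.
move=> Z u d1 d2 D T E HD t Ht.
have HT : 0 <= T by lra.
have HE : 0 <= E.
  have := ld_d1 HD 0 (conj (Rle_refl _) HT).
  rewrite Rmult_0_r exp_0 Rmult_1_r; have := norm_ge_0 (d1 0); lra.
have HE1 s : 0 <= s -> E * exp (- k * s) <= E.
  move=> Hs; have : exp (- k * s) <= 1 by rewrite -exp_0; apply: exp_le; nra.
  move=> H; have := Rmult_le_compat_l _ _ _ HE H; lra.
have HDt s : 0 <= s <= T -> s - D0 - delta <= s - D s <= s - D0 + delta.
  move=> Hs; have := ld_D HD s Hs; move/Rabs_le_between; lra.
pose w s := plus (F (minus (u s) (K (Z s)))) (plus (B (minus (u (s - D s)) (u (s - D0)))) (B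
  (d1 s))).
have HZw s : 0 <= s <= T -> is_derive Z s (plus (Acl (Z s)) (w s)).
  move=> Hs; have := ld_Z HD s Hs.
  have -> // : plus (A (Z s)) (plus (F (u s)) (plus (B (minus (u (s - D s)) (u (s - D0)))) (B
    (d1 s))))
    = plus (Acl (Z s)) (w s).
  rewrite /Acl /w (linear_minus F) //; module_eq V.
have HcZ s : 0 <= s <= T -> continuous Z s.
  by move=> Hs; apply: ex_derive_continuous; eexists; apply: HZw.
have Hcw s : 0 <= s <= T -> continuous w s.
  move=> Hs; have Hcu := ld_cu HD.
  apply: (continuous_plus (V := V)).
    apply: (continuous_linear_comp F) => //; apply: continuous_minus => //.
    by apply: (continuous_linear_comp K) => //; apply: HcZ.
  apply: continuous_plus; apply: (continuous_linear_comp B) => //; last exact: (ld_cd HD).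
  apply: continuous_minus.
  - refine (continuous_comp (fun r => r - D r) u s _ _) => //.
    apply: (continuous_minus (V := R_NormedModule)); first exact: continuous_id.
    exact: (ld_cD HD).
  - refine (continuous_comp (fun r => r - D0) u s _ _) => //.
    by apply: ex_derive_continuous; auto_derive.
have Hu s : 0 <= s <= T -> norm (u s) <= kk * norm (Z s) + norm (d2 s).
  move=> Hs; rewrite (ld_u HD s Hs).
  apply: Rle_trans (norm_scal_R _ _) _.
  have [P1 P2] := Hphi s; rewrite Rabs_pos_eq //.
  have H1 := norm_triangle (K (Z s)) (d2 s); have H2 := Hkk (Z s).
  have H3 := norm_ge_0 (plus (K (Z s)) (d2 s)).
  have H4 := Rmult_le_compat_r _ _ _ H3 P2.
  apply: Rle_trans H4 _; rewrite Rmult_1_l; apply: Rle_trans H1 _; lra.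
(* Up to T1 the norm is weighted with the growth rate gam, chosen so large that the
   whole feedback becomes a contraction with constant 1/2. *)
have rough : forall T', 0 <= T' <= T -> T' <= T1 -> forall s, 0 <= s <= T' ->
  exp (k * s) * norm (w s) <= Cr * (norm (Z 0) + E).
  move=> T' HT' HT1.
  have [s0 [Hs0 Hmax]] : exists s, 0 <= s <= T' /\ forall t, 0 <= t <= T' ->
    exp (- gam * t) * norm (Z t) <= exp (- gam * s) * norm (Z s).
    apply: (continuous_max (fun s => exp (- gam * s) * norm (Z s)) T' (proj1 HT')).
    by move=> s Hs; apply: continuous_norm_weighted; apply: HcZ; lra.
  set N := exp (- gam * s0) * norm (Z s0) in Hmax.
  have HN : 0 <= N by apply: Rmult_le_pos; [left; apply: exp_pos|apply: norm_ge_0].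
  have HZN s : 0 <= s <= T' -> norm (Z s) <= N * exp (gam * s).
    by move=> Hs; have /weight_le := Hmax s Hs; rewrite Ropp_involutive.
  have HuN r s : - D0 - delta <= r <= s -> 0 <= s <= T' -> norm (u r) <= kk * N * exp (gam * s) + E.
    move=> Hr Hs.
    have HkN : 0 <= kk * N * exp (gam * s).
      by repeat apply: Rmult_le_pos => //; [left|left; apply: exp_pos].
    case: (Rle_dec r 0) => Hr0.
      rewrite (ld_u0 HD); last lra.
      rewrite norm_zero; lra.
    have Hr' : 0 <= r <= T by lra.
    apply: Rle_trans (Hu r Hr') _.
    apply: Rplus_le_compat.
    - rewrite Rmult_assoc; apply: Rmult_le_compat_l; first lra.
      apply: Rle_trans (HZN r _) _; first lra.
      apply: Rmult_le_compat_l => //; apply: exp_le; nra.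
    - apply: Rle_trans (ld_d2 HD r Hr') _; apply: HE1; lra.
  have HwN s : 0 <= s <= T' -> norm (w s) <= (c0 * N + c1 * E) * exp (- - gam * s).
    move=> Hs; rewrite Ropp_involutive.
    have Hs' : 0 <= s <= T by lra.
    have He1 : 1 <= exp (gam * s) by apply: exp_ge1; nra.
    have HD' := HDt s Hs'.
    have U1 := HuN s s ltac:(lra) Hs.
    have U2 := HuN (s - D s) s ltac:(lra) Hs.
    have U3 := HuN (s - D0) s ltac:(lra) Hs.
    have N1 : norm (F (minus (u s) (K (Z s)))) <= f * (2 * kk * N * exp (gam * s) + E).
      apply: Rle_trans (Hf _) _; apply: Rmult_le_compat_l; first lra.
      apply: Rle_trans (norm_minus_le _ _) _.
      have := Hkk (Z s); have := HZN s Hs; nra.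
    have N2 : norm (B (minus (u (s - D s)) (u (s - D0)))) <= b * (2 * (kk * N * exp (gam * s) + E)).
      apply: Rle_trans (Hb _) _; apply: Rmult_le_compat_l; first lra.
      apply: Rle_trans (norm_minus_le _ _) _; lra.
    have N3 : norm (B (d1 s)) <= b * E.
      apply: Rle_trans (Hb _) _; apply: Rmult_le_compat_l; first lra.
      apply: Rle_trans (ld_d1 HD s Hs') _; apply: HE1; lra.
    have T1' : norm (w s) <= norm (F (minus (u s) (K (Z s)))) +
      norm (plus (B (minus (u (s - D s)) (u (s - D0)))) (B (d1 s))).
      exact: norm_triangle.
    have T2' := norm_triangle (B (minus (u (s - D s)) (u (s - D0)))) (B (d1 s)).
    have HcE : c1 * E <= c1 * E * exp (gam * s).
      have : 0 <= c1 * E by apply: Rmult_le_pos => //; rewrite /c1; lra.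
      nra.
    apply: (Rle_trans _ _ _ T1').
    apply: (Rle_trans _ _ _ (Rplus_le_compat _ _ _ _ N1 (Rle_trans _ _ _ T2'
      (Rplus_le_compat _ _ _ _ N2 N3)))).
    rewrite /c0 /c1 in HcE *; lra.
  have Hcl : - gam < l by lra.
  have Hs0T : 0 <= s0 <= T' by [].
  have := perturbed_bound V Acl a M l is_linear_Acl Ha0 Ha HM Hdec Z w T' (- gam) (c0 * N + c1 * E)
    (fun s Hs => HZw s ltac:(lra)) (fun s Hs => Hcw s ltac:(lra)) Hcl HwN s0 Hs0T.
  rewrite -(weight_le (- gam) s0) -/N => HN2.
  have HNb : N <= 2 * M * norm (Z 0) + 2 * M * c1 / l * E.
    have Hz0 := norm_ge_0 (Z 0).
    have H1 : M * (c0 * N + c1 * E) / (l - - gam) <= N / 2 + M * c1 * E / l.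
      have -> : M * (c0 * N + c1 * E) / (l - - gam) = gam / (2 * (l + gam)) * N +
        M * c1 * E / (l + gam).
        rewrite /gam; field; rewrite -/gam; lra.
      have : gam / (2 * (l + gam)) <= 1 / 2.
        apply/Rle_div_l; lra.
      move=> H; have := Rmult_le_compat_r _ _ _ HN H => H'.
      have : M * c1 * E / (l + gam) <= M * c1 * E / l.
        apply: Rmult_le_compat_l; first by repeat apply: Rmult_le_pos => //; rewrite /c1; lra.
        apply: Rinv_le_contravar; lra.
      lra.
    have -> : 2 * M * c1 / l * E = 2 * (M * c1 * E / l) by field; lra.
    lra.
  move=> s Hs.
  have He1 : exp (k * s) <= exp (k * T1) by apply: exp_le; nra.
  have He2 : exp (gam * s) <= exp (gam * T1) by apply: exp_le; nra.
  have HwNs := HwN s Hs; rewrite Ropp_involutive in HwNs.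
  have Hz0 := norm_ge_0 (Z 0).
  have Hc1 : 0 <= c1 by rewrite /c1; lra.
  have HX : 0 <= c0 * N + c1 * E by nra.
  have HXb : c0 * N + c1 * E <= (c0 * (2 * M + 2 * M * c1 / l) + c1) * (norm (Z 0) + E).
    have Q1 : 0 <= 2 * M * c1 / l by apply: Rdiv_le_0_compat; nra.
    have Q2 : N <= (2 * M + 2 * M * c1 / l) * (norm (Z 0) + E) by nra.
    have := Rmult_le_compat_l _ _ _ (Rlt_le _ _ Hc0) Q2.
    have := Rmult_le_pos _ _ Hc1 Hz0.
    lra.
  have HY : norm (w s) <= exp (gam * T1) * ((c0 * (2 * M + 2 * M * c1 / l) +
    c1) * (norm (Z 0) + E)).
    apply: (Rle_trans _ _ _ HwNs); rewrite Rmult_comm.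
    by apply: Rmult_le_compat => //; left; exact: exp_pos.
  have HY' : exp (k * s) * norm (w s) <= exp (k * T1) * (exp (gam * T1) * ((c0 * (2 * M +
    2 * M * c1 / l) + c1) * (norm (Z 0) + E))).
    apply: Rmult_le_compat => //; [left; exact: exp_pos|exact: norm_ge_0].
  apply: (Rle_trans _ _ _ HY'); right; rewrite /Cr; ring.
(* From here on the norm is weighted with the decay rate k. *)
have [s1 [Hs1 Hmax]] : exists s, 0 <= s <= T /\ forall t, 0 <= t <= T ->
  exp (k * t) * norm (w t) <= exp (k * s) * norm (w s).
  apply: (continuous_max (fun s => exp (k * s) * norm (w s)) T HT).
  by move=> s Hs; apply: continuous_norm_weighted; apply: Hcw.
set W := exp (k * s1) * norm (w s1) in Hmax.
have HW0 : 0 <= W by apply: Rmult_le_pos; [left; apply: exp_pos|apply: norm_ge_0].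
have HWw s : 0 <= s <= T -> norm (w s) <= W * exp (- k * s).
  by move=> Hs; apply/weight_le; apply: Hmax.
have HZb := perturbed_bound V Acl a M l is_linear_Acl Ha0 Ha HM Hdec Z w T k W HZw Hcw kl HWw.
set z := M * norm (Z 0) + M * W / (l - k) in HZb.
have Hz0 := norm_ge_0 (Z 0).
have HWb : W <= CW * (norm (Z 0) + E).
  case: (Rle_dec s1 T1) => Hs1T.
    have H1 := rough s1 Hs1 Hs1T s1 ltac:(lra).
    apply: Rle_trans H1 _; apply: Rmult_le_compat_r; first lra.
    have : 0 <= q.
      rewrite /q; apply: Rdiv_le_0_compat; last lra.
      apply: Rmult_le_pos; first by repeat apply: Rmult_le_pos => //; lra.
      have : exp (- (l - k) * delta) <= 1 by rewrite -exp_0; apply: exp_le; nra.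
      rewrite /ea in Hea; lra.
    move=> Hq0; have := Rmult_le_pos _ _ Hq0 HCW; lra.
  have HDs := HDt s1 Hs1.
  have Hpd r : s1 - D0 - delta <= r -> exp (- k * r) <= p * exp (- k * s1).
    by move=> Hr; rewrite /p -exp_plus; apply: exp_le; nra.
  set J := ea * z + M * W * ((1 - exp (- (l - k) * delta)) / (l - k)).
  have Hz : 0 <= z.
    have : 0 <= M * W / (l - k) by apply: Rdiv_le_0_compat; nra.
    rewrite /z; nra.
  have HJ : 0 <= J.
    have : 0 <= (1 - exp (- (l - k) * delta)) / (l - k).
      apply: Rdiv_le_0_compat; last lra.
      have : exp (- (l - k) * delta) <= 1 by rewrite -exp_0; apply: exp_le; nra.
      lra.
    move=> H; rewrite /J; have := Rmult_le_pos _ _ Hea Hz; have :=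
      Rmult_le_pos _ _ (Rmult_le_pos _ _ HM HW0) H; lra.
  have Hinc x y : s1 - D0 - delta <= x <= y -> y <= s1 - D0 + delta -> y - x <= delta ->
      norm (minus (Z y) (Z x)) <= p * exp (- k * s1) * J.
    move=> Hx Hy Hxy.
    rewrite /T1 in Hs1T.
    have := perturbed_increment V Acl a M l is_linear_Acl Ha0 Ha HM Hdec Z w T k W HZw Hcw kl
      HWw z delta x y
      ltac:(lra) ltac:(lra) Hxy (Rlt_le _ _ k0) HZb.
    move=> H; apply: Rle_trans H _; apply: Rmult_le_compat_r => //.
    apply: Hpd; lra.
  have Hdiff : norm (minus (Z (s1 - D s1)) (Z (s1 - D0))) <= p * exp (- k * s1) * J.
    case: (Rle_dec (s1 - D0) (s1 - D s1)) => Hle.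
      apply: Hinc; lra.
    rewrite norm_minus_sym; apply: Hinc; lra.
  rewrite /T1 in Hs1T.
  have HKu r : t0 <= r <= T -> u r = plus (K (Z r)) (d2 r).
    move=> Hr; rewrite (ld_u HD r) ?Hphi1; try lra.
    exact: scal_one.
  have Hwdec : w s1 = plus (F (d2 s1)) (plus (plus (B (K (minus (Z (s1 - D s1)) (Z
    (s1 - D0))))) (B (minus (d2 (s1 - D s1)) (d2 (s1 - D0))))) (B (d1 s1))).
    rewrite /w !HKu; try lra.
    congr (plus _ _); first by congr F; module_eq U.
    congr (plus _ _).
    rewrite (linear_minus K) // -(linear_plus B) //; congr B; module_eq U.
  have Hd2 r : s1 - D0 - delta <= r <= s1 -> norm (d2 r) <= p * exp (- k * s1) * E.
    move=> Hr; apply: Rle_trans (ld_d2 HD r _) _; first lra.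
    rewrite Rmult_comm; apply: Rmult_le_compat_r => //; apply: Hpd; lra.
  set e := exp (- k * s1) in Hdiff Hd2.
  have He : 0 < e by apply: exp_pos.
  have N1 : norm (F (d2 s1)) <= f * (E * e).
    apply: Rle_trans (Hf _) _; apply: Rmult_le_compat_l; first lra.
    exact: (ld_d2 HD s1 Hs1).
  have N2 : norm (B (K (minus (Z (s1 - D s1)) (Z (s1 - D0))))) <= g * (p * e * J).
    apply: Rle_trans (Hg _) _; exact: Rmult_le_compat_l.
  have N3 : norm (B (minus (d2 (s1 - D s1)) (d2 (s1 - D0)))) <= b * (2 * (p * e * E)).
    apply: Rle_trans (Hb _) _; apply: Rmult_le_compat_l; first lra.
    apply: Rle_trans (norm_minus_le _ _) _.
    have := Hd2 (s1 - D s1) ltac:(lra); have := Hd2 (s1 - D0) ltac:(lra); lra.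
  have N4 : norm (B (d1 s1)) <= b * (E * e).
    apply: Rle_trans (Hb _) _; apply: Rmult_le_compat_l; first lra.
    exact: (ld_d1 HD s1 Hs1).
  have Hwn : norm (w s1) <= (f * E + g * p * J + 2 * b * p * E + b * E) * e.
    rewrite Hwdec.
    apply: Rle_trans (norm_triangle _ _) _.
    have T2 := norm_triangle (plus (B (K (minus (Z (s1 - D s1)) (Z (s1 - D0))))) (B (minus (d2
      (s1 - D s1)) (d2 (s1 - D0))))) (B (d1 s1)).
    have T3 := norm_triangle (B (K (minus (Z (s1 - D s1)) (Z (s1 - D0))))) (B (minus (d2
      (s1 - D s1)) (d2 (s1 - D0)))).
    apply: (Rle_trans _ _ _ (Rplus_le_compat _ _ _ _ N1 (Rle_trans _ _ _ T2
      (Rplus_le_compat _ _ _ _ (Rle_trans _ _ _ T3 (Rplus_le_compat _ _ _ _ N2 N3)) N4)))).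
    lra.
  have {}Hwn : W <= f * E + g * p * J + 2 * b * p * E + b * E by apply/weight_le.
  (* The contributions of W through |Z| and through the increment add up to q. *)
  have HgJ : g * p * J = g * p * ea * M * norm (Z 0) + q * W.
    rewrite /J /z /q /ea; field; lra.
  rewrite HgJ in Hwn.
  apply: (Rmult_le_reg_r (1 - q)); first lra.
  have -> : CW * (norm (Z 0) + E) * (1 - q) = (Cm + Cr) * (norm (Z 0) + E) by rewrite -HCWq; ring.
  rewrite /Cm.
  have P1 : 0 <= g * p * ea * M by repeat apply: Rmult_le_pos => //; lra.
  have P2 : 0 <= b * p by apply: Rmult_le_pos; lra.
  have P3 := Rmult_le_pos _ _ P1 HE.
  have P4 := Rmult_le_pos _ _ P2 Hz0.
  have P5 : 0 <= Cr * (norm (Z 0) + E) by apply: Rmult_le_pos; lra.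
  have P6 : 0 <= f * norm (Z 0) by apply: Rmult_le_pos; lra.
  have P7 : 0 <= b * norm (Z 0) by apply: Rmult_le_pos; lra.
  lra.
apply: Rle_trans (HZb t Ht) _.
apply: Rmult_le_compat_r; first by left; apply: exp_pos.
rewrite /z.
have : M * W / (l - k) <= M * CW / (l - k) * (norm (Z 0) + E).
  have -> : M * CW / (l - k) * (norm (Z 0) + E) = M * (CW * (norm (Z 0) + E)) / (l - k) by
    field; lra.
  apply: Rmult_le_compat_r; first by left; apply: Rinv_0_lt_compat; lra.
  exact: Rmult_le_compat_l.
have := Rmult_le_pos _ _ HM HE; lra.
Qed.

End SmallGain.

(** * Inner products and Riesz bases *)

Section ScalarField.
Variable k : scalar_kind.

(** Real and complex scalars are treated at once by computing in the complex
    numbers. *)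
Lemma toC_inj (x y : scalars k) : toC k x = toC k y -> x = y.
Proof. case: k x y => x y //=; exact: RtoC_inj. Qed.

Lemma toC_plus (x y : scalars k) : toC k (plus x y) = Cplus (toC k x) (toC k y).
Proof. by case: k x y => x y //=; rewrite -RtoC_plus. Qed.

Lemma toC_mult (x y : scalars k) : toC k (mult x y) = Cmult (toC k x) (toC k y).
Proof. by case: k x y => x y //=; rewrite -RtoC_mult. Qed.

Lemma toC_opp (x : scalars k) : toC k (opp x) = Copp (toC k x).
Proof. by case: k x => x //=; rewrite -RtoC_opp. Qed.

Lemma toC_conj (x : scalars k) : toC k (sconj k x) = Cconj (toC k x).
Proof. by case: k x => x //=; rewrite /RtoC /Cconj /= Ropp_0. Qed.

Lemma toC_ofR (r : R) : toC k (ofR k r) = RtoC r.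
Proof. by case: k. Qed.

Lemma abs_toC (x : scalars k) : abs x = Cmod (toC k x).
Proof. by case: k x => x //=; rewrite Cmod_R. Qed.

Lemma abs_mult_eq (x y : scalars k) : abs (mult x y) = abs x * abs y.
Proof. by rewrite !abs_toC toC_mult Cmod_mult. Qed.

End ScalarField.

Section HilbertSpace.
Variables (k : scalar_kind) (H : Hilbert k).
Implicit Types x y z : H.

Lemma inner_zero_l y : inner (zero : H) y = zero.
Proof. by rewrite -(scal_zero_l (zero : H)) inner_scal_l mult_zero_l. Qed.

Lemma inner_opp_l x y : inner (opp x) y = opp (inner x y).
Proof. by rewrite -(scal_opp_one x) inner_scal_l -opp_mult_l mult_one_l. Qed.

Lemma inner_minus_l x y z : inner (minus x y) z = minus (inner x z) (inner y z).
Proof. by rewrite /minus inner_plus_l inner_opp_l. Qed.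

Lemma inner_norm_sq x y c :
  norm (minus x (scal c y)) ^ 2
  = norm x ^ 2 - 2 * Re (Cmult (Cconj (toC k c)) (toC k (inner x y)))
    + abs c ^ 2 * norm y ^ 2.
Proof.
have E : toC k (inner (minus x (scal c y)) (minus x (scal c y)))
  = Cplus (Cminus (toC k (inner x x)) (Cplus (Cmult (Cconj (toC k c)) (toC k (inner x y)))
    (Cconj (Cmult (Cconj (toC k c)) (toC k (inner x y))))))
     (Cmult (Cmult (toC k c) (Cconj (toC k c))) (toC k (inner y y))).
  rewrite inner_minus_l /minus toC_plus toC_opp inner_scal_l toC_mult.
  rewrite (inner_conj _ _ (plus x (opp (scal c y))) x) (inner_conj _ _ (plus x (opp (scal c y))) y).
  rewrite !toC_conj !inner_plus_l !inner_opp_l !toC_plus !toC_opp !inner_scal_l !toC_mult.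
  rewrite (inner_conj _ _ x y) toC_conj !inner_norm.
  move: (toC k c) (toC k (inner x y)) (norm x) (norm y) => [a b] [p q] nx ny.
  by rewrite /Cplus /Cminus /Cmult /Cconj /Copp /RtoC /=; congr (_, _); ring.
rewrite !inner_norm in E.
have := f_equal fst E.
rewrite abs_toC.
have -> : Cmod (toC k c) ^ 2 = (fst (toC k c)) ^ 2 + (snd (toC k c)) ^ 2.
  rewrite /Cmod pow2_sqrt //; have := pow2_ge_0 (fst (toC k c)); have :=
    pow2_ge_0 (snd (toC k c)); lra.
move: (toC k c) (toC k (inner x y)) (norm x) (norm y) (norm (minus x
  (scal c y))) => [a b] [p q] nx ny nz.
rewrite /Cplus /Cminus /Cmult /Cconj /Copp /RtoC /Re /=; lra.
Qed.

(** The square of the distance from [x] to its projection on [y] is nonnegative. *)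
Lemma cauchy_schwarz x y : abs (inner x y) <= norm x * norm y.
Proof.
case: (Req_dec (norm y) 0) => Hy.
  have -> : y = zero by apply: norm_eq_zero.
  rewrite inner_conj inner_zero_l.
  have -> : sconj k zero = zero by apply: toC_inj; rewrite toC_conj; case: k => /=;
    rewrite /Cconj /= ?Ropp_0.
  rewrite abs_zero norm_zero; lra.
have Hy0 : 0 < norm y by have := norm_ge_0 y; lra.
have := inner_norm_sq x y (mult (ofR k (/ norm y ^ 2)) (inner x y)).
rewrite abs_mult_eq abs_ofR toC_mult toC_ofR.
have -> : Re (Cmult (Cconj (Cmult (RtoC (/ norm y ^ 2)) (toC k (inner x y)))) (toC k
  (inner x y))) = / norm y ^ 2 * abs (inner x y) ^ 2.
  rewrite abs_toC.
  have -> : Cmod (toC k (inner x y)) ^ 2 = (fst (toC k (inner x y))) ^ 2 +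
    (snd (toC k (inner x y))) ^ 2.
    rewrite /Cmod pow2_sqrt //; have := pow2_ge_0 (fst (toC k (inner x y))); have :=
      pow2_ge_0 (snd (toC k (inner x y))); lra.
  by move: (toC k (inner x y)) => [p q]; rewrite /Cmult /Cconj /Re /=; ring.
have Hy2 : 0 < norm y ^ 2 by apply: pow_lt.
rewrite Rabs_pos_eq; last by left; apply: Rinv_0_lt_compat.
move: (abs_ge_0 (inner x y)) (norm_ge_0 x) (pow2_ge_0 (norm (minus x (scal (mult (ofR k
  (/ norm y ^ 2)) (inner x y)) y)))).
move: (abs (inner x y)) (norm x) (norm (minus _ _)) => s nx nz Hs Hnx Hnz Heq.
have {}Heq : nz ^ 2 = nx ^ 2 - s ^ 2 / norm y ^ 2.
  rewrite Heq; field; lra.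
have Hle : s ^ 2 / norm y ^ 2 <= nx ^ 2 by lra.
have {}Hle := proj1 (Rle_div_l _ _ _ Hy2) Hle.
rewrite -Rpow_mult_distr in Hle.
have Hp := Rmult_le_pos _ _ Hnx (Rlt_le _ _ Hy0).
apply: Rnot_lt_le => Hlt; nra.
Qed.
End HilbertSpace.

Section RieszBasis.
Variables (k : scalar_kind) (H : Hilbert k) (phi psi : nat -> H).
Hypothesis (Hbi : biorthogonal phi psi).
Notation cf x := (fun n => abs (inner x (psi n))).
Notation comb a N := (sum_n (fun n => scal (a n) (phi n)) N).

Lemma inner_comb (a : nat -> scalars k) N j :
  inner (comb a N : H) (psi j) = if Nat.leb j N then a j else zero.
Proof.
elim: N => [|N IH].
  rewrite sum_O inner_scal_l Hbi; case: j => [|j] /=.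
    by rewrite mult_one_r.
  by rewrite mult_zero_r.
rewrite sum_Sn inner_plus_l IH inner_scal_l Hbi.
case: (Nat.eqb_spec (S N) j) => [<-|Hne].
  rewrite (proj2 (Nat.leb_gt _ _)); last lia.
  by rewrite Nat.leb_refl mult_one_r plus_zero_l.
rewrite mult_zero_r plus_zero_r.
case: (Nat.leb_spec j N) => Hj; case: (Nat.leb_spec j (S N)) => Hj' //; lia.
Qed.

Lemma comb_extend (a : nat -> scalars k) N M : (N <= M)%nat ->
  comb (fun n => if Nat.leb n N then a n else zero) M = comb a N.
Proof.
move=> HNM; elim: M HNM => [|M IH] HM.
  have -> : N = 0%nat by lia.
  by rewrite !sum_O.
case: (Nat.eq_dec N (S M)) => [->|Hne].
  by apply: sum_n_ext_loc => n Hn; rewrite (proj2 (Nat.leb_le _ _)).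
rewrite sum_Sn IH; last lia.
by rewrite (proj2 (Nat.leb_gt _ _)); [rewrite scal_zero_l plus_zero_r|lia].
Qed.

Lemma l2_mono a N M : (N <= M)%nat -> l2 N a <= l2 M a.
Proof.
elim=> [|{}M _ IH]; first lra.
apply: Rle_trans IH _; rewrite l2_S.
rewrite -[X in X <= _](sqrt_pow2 (l2 M a)); last exact: l2_ge0.
apply: sqrt_le_1_alt; have := pow2_ge_0 (a (S M)); lra.
Qed.

Variables (mR MR : R).
Hypothesis (HmR : 0 < mR) (HMR : 0 < MR)
  (Hdense : forall (x : H) (eps : R), 0 < eps ->
     exists (N : nat) (a : nat -> scalars k), norm (minus x (comb a N)) < eps)
  (Hbounds : forall (N : nat) (a : nat -> scalars k),
      mR * sum_n (fun n => abs (a n) ^ 2) N <= norm (comb a N) ^ 2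
        <= MR * sum_n (fun n => abs (a n) ^ 2) N).

Lemma comb_lower N a : l2 N (fun n => abs (a n)) <= / sqrt mR * norm (comb a N).
Proof.
have [H1 _] := Hbounds N a.
have Hs : 0 < sqrt mR by apply: sqrt_lt_R0.
apply: (Rmult_le_reg_l (sqrt mR)) => //.
rewrite -Rmult_assoc Rinv_r ?Rmult_1_l; last lra.
rewrite -(sqrt_pow2 (norm _)); last exact: norm_ge_0.
rewrite /l2 -sqrt_mult_alt; last lra.
exact: sqrt_le_1_alt.
Qed.

Lemma comb_upper N a : norm (comb a N) <= sqrt MR * l2 N (fun n => abs (a n)).
Proof.
have [_ H1] := Hbounds N a.
rewrite -(sqrt_pow2 (norm _)); last exact: norm_ge_0.
rewrite /l2 -sqrt_mult_alt; last lra.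
exact: sqrt_le_1_alt.
Qed.

(** For a finite combination the coefficients are those of the lower Riesz bound.  The
    general case follows by density, since for fixed [N] the left side is continuous. *)
Lemma bessel x N : l2 N (cf x) <= / sqrt mR * norm x.
Proof.
have Hs : 0 < / sqrt mR by apply: Rinv_0_lt_compat; apply: sqrt_lt_R0.
have Hc := l2_ge0 N (fun n => norm (psi n)).
set c := l2 N _ in Hc.
apply: le_epsilon => eps Heps.
pose e := eps / (/ sqrt mR + c).
have He : 0 < e by apply: Rdiv_lt_0_compat; lra.
have [N' [a Ha]] := Hdense x e He.
set p := comb a N' in Ha.
have Hp : l2 N (cf p) <= / sqrt mR * norm p.
  apply: Rle_trans (l2_mono _ N (max N N') (Nat.le_max_l _ _)) _.
  have := comb_lower (max N N') (fun n => if Nat.leb n N' then a n else zero).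
  rewrite comb_extend; last exact: Nat.le_max_r.
  apply: Rle_trans; right; apply: l2_ext => n.
  by rewrite /p inner_comb.
have Hxp : l2 N (cf x) <= l2 N (cf p) + e * c.
  rewrite /c -l2_scal; [|lra|by move=> i; apply: norm_ge_0].
  apply: Rle_trans (l2_triangle _ _ _ _ _); last first.
  - move=> i; apply: Rmult_le_pos; [lra|exact: norm_ge_0].
  - by move=> i; apply: abs_ge_0.
  apply: l2_le => i; split; first exact: abs_ge_0.
  have -> : inner x (psi i) = plus (inner p (psi i)) (inner (minus x p) (psi i)).
    by rewrite -inner_plus_l; congr inner; rewrite /minus
      (plus_comm x) plus_assoc plus_opp_r plus_zero_l.
  apply: Rle_trans (abs_triangle _ _) _; apply: Rplus_le_compat_l.
  apply: Rle_trans (cauchy_schwarz _ _ _ _) _.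
  apply: Rmult_le_compat_r; [exact: norm_ge_0|lra].
have Hpx : norm p <= norm x + e.
  have -> : p = plus x (opp (minus x p)).
    by rewrite opp_minus /minus (plus_comm p) plus_assoc plus_opp_r plus_zero_l.
  apply: Rle_trans (norm_triangle _ _) _; rewrite norm_opp; lra.
have : / sqrt mR * norm p <= / sqrt mR * (norm x + e) by apply: Rmult_le_compat_l; lra.
have : e * (/ sqrt mR + c) = eps by rewrite /e /Rdiv Rmult_assoc Rinv_l; lra.
lra.
Qed.

(** The partial sums [P] of the expansion are bounded uniformly in [N], by the two Riesz
    bounds, and fix the finite combinations; hence they converge to [x]. *)
Lemma riesz_upper x Q : (forall N, l2 N (cf x) <= Q) -> norm x <= sqrt MR * Q.
Proof.
move=> HQ.
have Hs : 0 < / sqrt mR by apply: Rinv_0_lt_compat; apply: sqrt_lt_R0.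
have HS : 0 < sqrt MR by apply: sqrt_lt_R0.
apply: le_epsilon => eps Heps.
pose e := eps / (1 + sqrt MR * / sqrt mR).
have Hpos := Rmult_lt_0_compat _ _ HS Hs.
have He : 0 < e by apply: Rdiv_lt_0_compat; lra.
have [N [a Ha]] := Hdense x e He.
set p := comb a N in Ha.
pose P y := comb (fun n => inner y (psi n)) N.
have HPn y : norm (P y) <= sqrt MR * l2 N (cf y) by apply: comb_upper.
have HPp : P p = p.
  by apply: sum_n_ext_loc => n Hn; rewrite /p inner_comb (proj2 (Nat.leb_le _ _)).
have HPm y z : P (plus y z) = plus (P y) (P z).
  rewrite /P -sum_n_plus; apply: sum_n_ext => n.
  by rewrite inner_plus_l scal_distr_r.
have Hx : x = plus (minus x p) p by rewrite /minus -plus_assoc plus_opp_l plus_zero_r.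
have Hp : p = plus (P (minus p x)) (P x).
  by rewrite -HPm /minus -plus_assoc plus_opp_l plus_zero_r HPp.
have N1 : norm (P x) <= sqrt MR * Q.
  by apply: Rle_trans (HPn x) _; apply: Rmult_le_compat_l; [lra|exact: HQ].
have N2 : norm (P (minus p x)) <= sqrt MR * (/ sqrt mR * e).
  apply: Rle_trans (HPn _) _; apply: Rmult_le_compat_l; first lra.
  apply: Rle_trans (bessel _ _) _; apply: Rmult_le_compat_l; first lra.
  by left; rewrite norm_minus_sym.
have N3 : norm p <= norm (P (minus p x)) + norm (P x) by rewrite {1}Hp; apply: norm_triangle.
have N4 : norm x <= norm (minus x p) + norm p by rewrite {1}Hx; apply: norm_triangle.
have : e * (1 + sqrt MR * / sqrt mR) = eps by rewrite /e /Rdiv Rmult_assoc Rinv_l; lra.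
lra.
Qed.
End RieszBasis.

(** All that is used of the Riesz basis: the coefficients are square summable and
    control the norm. *)
Lemma riesz_frame k (H : Hilbert k) (phi psi : nat -> H) :
  riesz_basis phi -> biorthogonal phi psi ->
  exists cb cu, 0 < cb /\ 0 < cu /\
    (forall x N, l2 N (fun n => abs (inner x (psi n))) <= cb * norm x) /\
    (forall x Q, (forall N, l2 N (fun n => abs (inner x (psi n))) <= Q) -> norm x <= cu * Q).
Proof.
move=> [Hd [mR [MR [Hm [HM Hb]]]]] Hbi.
exists (/ sqrt mR), (sqrt MR); split; first by apply: Rinv_0_lt_compat; apply: sqrt_lt_R0.
split; first exact: sqrt_lt_R0.
split=> [x N|x Q HQ]; [exact: bessel Hbi _ _ _ Hd Hb _ _|exact: riesz_upper Hbi _ _ _ _ Hd Hb _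
  _ _].
Qed.

(** * The semigroup in spectral coordinates *)

Lemma real_linear k (U V : CompleteNormedModule (scalars k)) (L : U -> V) :
  is_linear L -> is_linear (L : real_space k U -> real_space k V).
Proof.
move=> HL; split.
- exact: (linear_plus L HL).
- move=> r x; exact: (linear_scal L HL (ofR k r) x).
- exact: (linear_norm L HL).
Qed.

Section Semigroup.
Variables (k : scalar_kind) (H : Hilbert k) (T : unbounded_operator H H)
  (S : R -> H -> H) (lam : nat -> scalars k) (phi psi : nat -> H).
Hypothesis (Hgen : generates T S) (Hrs : riesz_spectral T lam phi)
  (Hbi : biorthogonal phi psi).

Lemma S_linear t : 0 <= t -> is_linear (S t).
Proof. by case: Hgen => -[H1 _] _; exact: H1. Qed.

Lemma S_0 x : S 0 x = x.
Proof. by case: Hgen => -[_ [H1 _]] _; exact: H1. Qed.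

Lemma S_plus s t x : 0 <= s -> 0 <= t -> S (s + t) x = S s (S t x).
Proof. by case: Hgen => -[_ [_ [H1 _]]] _; exact: H1. Qed.

(** [S h] commutes with the generator, so [S h (phi j)] is again an eigenvector; simplicity
    of the eigenvalue makes it a multiple of [phi j]. *)
Lemma S_eigenvector j h : 0 <= h -> exists c, S h (phi j) = scal c (phi j).
Proof.
move=> Hh.
have [Hd [_ He]] := rs_eigen _ _ _ Hrs j.
have HS := S_linear h Hh.
have Hlim := proj1 (proj2 Hgen (phi j) _) (conj Hd He).
have Hlim2 : filterlim (fun s => scal (ofR k (/ s)) (minus (S s (S h (phi j))) (S h (phi j))))
    (at_right 0) (locally (scal (lam j) (S h (phi j)))).
  rewrite -(linear_scal _ HS).
  apply: (filterlim_ext_loc (fun s => S h (scal (ofR k (/ s)) (minus (S s (phi j)) (phi j))))).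
    exists (mkposreal 1 Rlt_0_1) => s _ Hs.
    rewrite (linear_scal _ HS) (linear_minus _ _ _ HS) -!S_plus; try lra.
    by rewrite (Rplus_comm s).
  apply: filterlim_comp Hlim _; exact: linear_cont.
have [Hd2 He2] := proj2 (proj2 Hgen _ _) Hlim2.
exact: (rs_simple _ _ _ Hrs j _ Hd2 He2).
Qed.

(** The factor by which [S h] multiplies [phi j], that is [exp (lam j h)]. *)
Definition mode j h := inner (S h (phi j)) (psi j).

Lemma S_mode j h : 0 <= h -> S h (phi j) = scal (mode j h) (phi j).
Proof.
move=> Hh; have [c Hc] := S_eigenvector j h Hh.
by rewrite /mode Hc inner_scal_l Hbi Nat.eqb_refl mult_one_r.
Qed.

Lemma mode_0 j : mode j 0 = one.
Proof. by rewrite /mode S_0 Hbi Nat.eqb_refl. Qed.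

Lemma mode_plus j s t : 0 <= s -> 0 <= t -> mode j (s + t) = mult (mode j t) (mode j s).
Proof.
move=> Hs Ht; rewrite {1}/mode S_plus // (S_mode j t) // linear_scal; last exact: S_linear.
by rewrite inner_scal_l.
Qed.

(** The generator limit at [phi j], tested against [psi j]. *)
Lemma mode_deriv j eps : 0 < eps -> exists d, 0 < d /\ forall h, 0 < h < d ->
  abs (minus (minus (mode j h) one) (mult (ofR k h) (lam j))) <= eps * h.
Proof.
move=> Heps.
have [Hd [_ He]] := rs_eigen _ _ _ Hrs j.
have Hlim := proj1 (proj2 Hgen (phi j) _) (conj Hd He).
have Hp : 0 < norm (psi j) + 1 by have := norm_ge_0 (psi j); lra.
have He' : 0 < eps / (norm (psi j) + 1) by apply: Rdiv_lt_0_compat.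
have := Hlim _ (locally_le_locally_norm _ _ (locally_norm_ball_norm _ (mkposreal _ He'))).
case=> d Hd'; exists d; split; first exact: cond_pos.
move=> h Hh.
have /= := Hd' h _ (proj1 Hh).
have Hb : ball 0 d h.
  rewrite /ball /= /AbsRing_ball /abs /= /minus /plus /opp /= Ropp_0 Rplus_0_r Rabs_pos_eq; lra.
move=> /(_ Hb); rewrite /ball_norm /= => Hn.
set y := minus _ _ in Hn.
have Hy : abs (inner y (psi j)) <= eps.
  apply: Rle_trans (cauchy_schwarz _ _ _ _) _.
  apply: (Rle_trans _ (eps / (norm (psi j) + 1) * (norm (psi j) + 1))); last by right; field; lra.
  apply: Rmult_le_compat; [exact: norm_ge_0|exact: norm_ge_0|by left|lra].
have -> : minus (minus (mode j h) one) (mult (ofR k h) (lam j)) = mult (ofR k h) (inner y (psi j)).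
  rewrite /y !(inner_minus_l, inner_scal_l) Hbi Nat.eqb_refl -/(mode j h) mult_one_r.
  rewrite /minus mult_distr_l mult_assoc -ofR_mult Rinv_r ?ofR_one ?mult_one_l; last lra.
  by rewrite -opp_mult_r.
rewrite abs_mult_eq abs_ofR Rabs_pos_eq; last lra.
rewrite Rmult_comm; apply: Rmult_le_compat_r => //; lra.
Qed.

Section Projection.
Variables (V : CompleteNormedModule (scalars k)) (L : V -> V).
Hypothesis (HL : is_linear L).
Notation E := (@expop (real_space k V) L).

Let HLr : @is_linear R_AbsRing (real_space k V) (real_space k V) L := real_linear k V V L HL.

Lemma expop_scal (c : scalars k) t (w : V) : (E t (scal c w : V) : V) = scal c (E t w : V).
Proof.
have [a [Ha1 Ha]] := linear_norm L HL.
have Ha0 : 0 <= a by lra.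
apply: (expop_unique (real_space k V) L a Ha0 Ha).
have Hser := expop_series (real_space k V) L a Ha0 Ha t w.
have Hsc : @is_linear R_AbsRing (real_space k V) (real_space k V) (fun y : V => scal c y).
  apply: (real_linear k V V); apply: is_linear_scal_r.
  by move=> u v; apply: toC_inj; rewrite !toC_mult Cmult_comm.
apply: is_series_ext (is_series_linear _ _ _ Hsc Hser) => i.
etransitivity; first exact: (linear_scal _ Hsc).
congr (scal _ _).
elim: i => [|i IHi] //=; rewrite -IHi.
by rewrite (linear_scal _ HL).
Qed.

(** Both sides are semigroups in time, and they differ by [o(h)] over a step [h]; the
    errors of [n = t / h] steps add up to [n o(h)].  This telescoping needs only
    the right derivative at 0, whereas a differential equation for [mode] would also
    require a left derivative. *)
Lemma expop_eigen j (w : V) : L w = scal (lam j) w ->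
  forall t, 0 <= t -> E t w = scal (mode j t) w.
Proof.
move=> Hw t Ht.
have [a [Ha1 Ha]] := linear_norm L HL.
have Ha0 : 0 <= a by lra.
pose al := abs (lam j); have Hal : 0 <= al by apply: abs_ge_0.
pose q := al + 1 + a.
have Hnw := norm_ge_0 w.
have NE s y : 0 <= s -> norm (E s y : V) <= exp (q * s) * norm (y : V).
  move=> Hs; apply: (Rle_trans _ _ _ (norm_expop_le (real_space k V) L a Ha0 Ha s y)).
  apply: Rmult_le_compat_r; first exact: norm_ge_0.
  by apply: exp_le; rewrite Rabs_pos_eq // /q; nra.
have step eps : 0 < eps <= 1 -> exists d, 0 < d /\ forall h, 0 < h < d ->
    norm (minus (scal (mode j h) w) (E h w : V)) <= 2 * eps * h * norm w /\
      abs (mode j h) <= exp (q * h).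
  move=> Heps.
  have [d1 [Hd1 H1]] := mode_deriv j eps (proj1 Heps).
  pose d2 := ln (1 + eps / a) / a.
  have Hea : 0 < eps / a by apply: Rdiv_lt_0_compat; lra.
  have Hln : 0 < ln (1 + eps / a) by rewrite -ln_1; apply: ln_increasing; lra.
  have Hd2 : 0 < d2 by apply: Rdiv_lt_0_compat; lra.
  exists (Rmin d1 d2); split; first exact: Rmin_pos.
  move=> h Hh.
  have Hh1 : h < d1 by apply: Rlt_le_trans (proj2 Hh) (Rmin_l _ _).
  have Hh2 : h < d2 by apply: Rlt_le_trans (proj2 Hh) (Rmin_r _ _).
  have {}H1 := H1 h (conj (proj1 Hh) Hh1).
  set r := minus (minus (mode j h) one) (mult (ofR k h) (lam j)) in H1.
  have Hm : mode j h = plus r (plus one (mult (ofR k h) (lam j))).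
    by rewrite /r; apply: toC_inj; rewrite !toC_plus !toC_opp; ring.
  split; last first.
    rewrite Hm.
    apply: Rle_trans (abs_triangle _ _) _.
    have H2 := abs_triangle one (mult (ofR k h) (lam j)).
    rewrite abs_one abs_mult_eq abs_ofR (Rabs_pos_eq h) -/al in H2; last lra.
    have H3 : eps * h <= 1 * h by apply: Rmult_le_compat_r; lra.
    have H4 : 0 <= a * h by nra.
    apply: (Rle_trans _ _ _ (Rplus_le_compat _ _ _ _ (Rle_trans _ _ _ H1 H3) H2)).
    have := exp_ineq1_le (q * h); rewrite /q; lra.
  have Hr := expop_remainder (real_space k V) L a HLr Ha0 Ha 0 h w.
  rewrite Rplus_0_l (expop_0 (real_space k V) L a Ha0 Ha) Rabs_R0 Rmult_0_l exp_0 Rmult_1_l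
    (Rabs_pos_eq h) in Hr; last lra.
  have Hexp : exp (h * a) - 1 <= eps / a.
    have : h * a <= ln (1 + eps / a).
      have -> : ln (1 + eps / a) = d2 * a by rewrite /d2; field; lra.
      nra.
    move/exp_le; rewrite exp_ln; lra.
  have Hha : 0 <= h * a by nra.
  have Hexp2 : exp (h * a) - 1 - h * a <= eps * h.
    have H3 := exp_minus1_le _ Hha.
    have H4 : h * a * (exp (h * a) - 1) <= h * a * (eps / a) by apply: Rmult_le_compat_l.
    have H5 : h * a * (eps / a) = eps * h by field; lra.
    lra.
  have -> : minus (scal (mode j h) w) (E h w : V) =
    minus (scal r w) (minus (minus (E h w) w) (scal (ofR k h) (L w)) : V).
    rewrite Hm Hw !scal_distr_r scal_one scal_assoc; module_eq (real_space k V).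
  rewrite /minus; apply: Rle_trans (norm_triangle _ _) _; rewrite norm_opp.
  have N1 : norm (scal r w) <= eps * h * norm w.
    by apply: Rle_trans (norm_scal _ _) _; apply: Rmult_le_compat_r.
  have N2 : norm (minus (minus (E h w) w) (scal (ofR k h) (L w)) : V) <= eps * h * norm w.
    apply: (Rle_trans _ _ _ Hr); apply: Rmult_le_compat_r => //.
  have := Rplus_le_compat _ _ _ _ N1 N2; rewrite /minus; lra.
(* One step more: the new error is mode h times the old one, plus the one-step error
   carried along by the exponential. *)
have tele eps h n : 0 < h -> norm (minus (scal (mode j h) w) (E h w : V)) <=
  2 * eps * h * norm w -> abs (mode j h) <= exp (q * h) ->
    norm (minus (scal (mode j (INR n * h)) w) (E (INR n * h) w : V)) <=
      INR n * exp (q * (INR n * h)) * (2 * eps * h * norm w).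
  move=> Hh Hs Hm; elim: n => [|n IH].
    rewrite /= !Rmult_0_l mode_0 (expop_0
      (real_space k V) L a Ha0 Ha) scal_one minus_eq_zero norm_zero; lra.
  have Hn := pos_INR n.
  have Hnh : 0 <= INR n * h by nra.
  rewrite S_INR Rmult_plus_distr_r Rmult_1_l mode_plus //; last lra.
  rewrite (expop_plus (real_space k V) L a HLr Ha0 Ha).
  have HEl := is_linear_expop (real_space k V) L a HLr Ha0 Ha (INR n * h).
  have Escal := fun c => expop_scal c (INR n * h) w.
  have -> : minus (scal (mult (mode j h) (mode j (INR n * h))) w) (E (INR n * h) (E h w) : V)
     = plus (scal (mode j h) (minus (scal (mode j (INR n * h)) w) (E (INR n * h) w : V)))
            (E (INR n * h) (minus (scal (mode j h) w) (E h w : V)) : V).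
    have Em : (E (INR n * h) (minus (scal (mode j h) w) (E h w : V) : V) : V) =
      minus (E (INR n * h) (scal (mode j h) w) : V) (E (INR n * h) (E h w) : V).
      exact: (linear_minus (U := real_space k V) (V :=
        real_space k V) (E (INR n * h)) (scal (mode j h) w) (E h w) HEl).
    rewrite Em Escal.
    rewrite /minus scal_distr_l scal_opp_r scal_assoc; module_eq (real_space k V).
  apply: Rle_trans (norm_triangle _ _) _.
  have N1 : norm (scal (mode j h) (minus (scal (mode j (INR n * h)) w) (E (INR n * h) w : V)))
     <= exp (q * h) * (INR n * exp (q * (INR n * h)) * (2 * eps * h * norm w)).
    apply: Rle_trans (norm_scal _ _) _.
    apply: Rmult_le_compat => //; [exact: abs_ge_0|exact: norm_ge_0].
  have N2 : norm (E (INR n * h) (minus (scal (mode j h) w) (E h w : V)) : V) <=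
    exp (q * (INR n * h)) * (2 * eps * h * norm w).
    apply: Rle_trans (NE _ _ Hnh) _.
    by apply: Rmult_le_compat_l => //; left; apply: exp_pos.
  apply: Rle_trans (Rplus_le_compat _ _ _ _ N1 N2) _.
  have -> : q * (INR n * h + h) = q * h + q * (INR n * h) by ring.
  rewrite exp_plus.
  have e1 : 1 <= exp (q * h) by apply: exp_ge1; rewrite /q; nra.
  have P : 0 <= exp (q * (INR n * h)) * (2 * eps * h * norm w).
    apply: Rle_trans N2; exact: norm_ge_0.
  nra.
symmetry; apply: plus_reg_r (opp (E t w : V)) _ _ _.
rewrite plus_opp_r; apply: norm_eq_zero.
apply: Rle_antisym; last exact: norm_ge_0.
apply: le_epsilon => e0 He0; rewrite Rplus_0_l.
pose cst := t * exp (q * t) * 2 * norm w.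
have Hcst : 0 <= cst.
  by rewrite /cst; have := Rmult_le_pos _ _ Ht (Rlt_le _ _ (exp_pos (q * t))); nra.
pose eps := Rmin 1 (e0 / (cst + 1)).
have Heps : 0 < eps <= 1.
  split; [apply: Rmin_pos; [lra|apply: Rdiv_lt_0_compat; lra]|exact: Rmin_l].
have Heps2 : eps * (cst + 1) <= e0 by apply/Rle_div_r; [lra|apply: Rmin_r].
have [d [Hd Hst]] := step eps Heps.
case: (Req_dec t 0) => [->|Ht0].
  rewrite mode_0 (expop_0 (real_space k V) L a Ha0 Ha) scal_one plus_opp_r norm_zero; lra.
have [n Hn] := INR_unbounded (t / d).
have Hn0 : 0 < INR n by apply: Rle_lt_trans Hn; apply: Rdiv_le_0_compat.
have Hh : 0 < t / INR n < d.
  split; first by apply: Rdiv_lt_0_compat; lra.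
  apply/Rlt_div_l => //; have /Rlt_div_l := Hn; move/(_ Hd); lra.
have [Hs1 Hs2] := Hst _ Hh.
have := tele eps _ n (proj1 Hh) Hs1 Hs2.
have -> : INR n * (t / INR n) = t by field; lra.
move=> Hf; apply: (Rle_trans _ _ _ Hf).
have -> : INR n * exp (q * t) * (2 * eps * (t / INR n) * norm w) = eps * cst by rewrite /cst;
  field; lra.
nra.
Qed.

Variable Pi : H -> V.
Hypothesis (HPi : is_linear Pi) (Heig : forall j, L (Pi (phi j)) = scal (lam j) (Pi (phi j))).

(** Both sides are bounded and linear in [x] and agree on the [phi j]. *)
Lemma projection_semigroup t x : 0 <= t -> Pi (S t x) = E t (Pi x).
Proof.
move=> Ht.
have [a [Ha1 Ha]] := linear_norm L HL.
have Ha0 : 0 <= a by lra.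
have HEl := is_linear_expop (real_space k V) L a HLr Ha0 Ha t.
have Escal := fun c => expop_scal c t.
have Hcomb (b : nat -> scalars k) N : Pi (S t (sum_n (fun n => scal (b n) (phi n)) N)) =
  E t (Pi (sum_n (fun n => scal (b n) (phi n)) N)).
  have H1 n : Pi (S t (scal (b n) (phi n))) = E t (Pi (scal (b n) (phi n))).
    rewrite (linear_scal _ (S_linear t Ht)) !(linear_scal _ HPi) Escal; congr (scal _ _).
    rewrite S_mode // (linear_scal _ HPi); symmetry; exact: expop_eigen.
  elim: N => [|N IH]; first by rewrite !sum_O.
  rewrite sum_Sn (linear_plus _ (S_linear t Ht)).
  move: IH (H1 (Datatypes.S N)).
  move: (sum_n _ _) (scal _ _) => X1 X2 IH1 IH2.
  rewrite (linear_plus _ HPi) IH1 IH2 (linear_plus _ HPi).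
  symmetry; exact: (linear_plus (U := real_space k V) (V := real_space k V) (E t) HEl).
pose D y : V := minus (Pi (S t y)) (E t (Pi y) : V).
have [c [Hc HD]] : exists c, 0 < c /\ forall y, norm (D y) <= c * norm y.
  have [p [Hp HP]] := linear_norm Pi HPi.
  have [s [Hs HS]] := linear_norm _ (S_linear t Ht).
  have [e [He HE]] := linear_norm _ HEl.
  exists (p * s + e * p); split; first nra.
  move=> y; rewrite /D /minus; apply: Rle_trans (norm_triangle _ _) _; rewrite norm_opp.
  have N1 : norm (Pi (S t y)) <= p * (s * norm y).
    by apply: Rle_trans (HP _) _; apply: Rmult_le_compat_l; [lra|exact: HS].
  have N2 : norm (E t (Pi y) : V) <= e * (p * norm y).
    by apply: Rle_trans (HE _) _; apply: Rmult_le_compat_l; [lra|exact: HP].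
  lra.
apply: (plus_reg_r (opp (E t (Pi x) : V))); rewrite plus_opp_r.
apply: norm_eq_zero; apply: Rle_antisym; last exact: norm_ge_0.
apply: le_epsilon => eps Heps; rewrite Rplus_0_l.
have He : 0 < eps / c by apply: Rdiv_lt_0_compat.
have [N [b Hb]] := proj1 (rs_basis _ _ _ Hrs) x _ He.
set p := sum_n _ _ in Hb.
have -> : plus (Pi (S t x)) (opp (E t (Pi x) : V)) = D (minus x p).
  rewrite /D !(linear_minus _ _ _ (S_linear t Ht)) !(linear_minus _ _ _ HPi).
  have Em : (E t (minus (Pi x) (Pi p) : V) : V) = minus (E t (Pi x) : V) (E t (Pi p) : V).
    exact: (linear_minus (U := real_space k V) (V := real_space k V) (E t) (Pi x) (Pi p) HEl).
  rewrite Em Hcomb -/p.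
  module_eq (real_space k V).
apply: Rle_trans (HD _) _.
have := Rmult_le_compat_l c _ _ (Rlt_le _ _ Hc) (Rlt_le _ _ Hb).
have -> : c * (eps / c) = eps by field; lra.
done.
Qed.
End Projection.
End Semigroup.

(** * Matrices and truncated operators *)

Section MatrixFacts.
Variable k : scalar_kind.
Notation K := (scalars k).

Lemma mat_eq m n (A B : Mat k m n) :
  (forall i j, (i < m)%nat -> (j < n)%nat ->
     coeff_mat zero (A : matrix m n) i j = coeff_mat zero (B : matrix m n) i j) -> A = B.
Proof. exact: (proj2 (coeff_mat_ext_aux (zero : K) zero A B)). Qed.

Lemma coeff_Mmul m n p (A : Mat k m n) (B : Mat k n p) i j :
  (i < m)%nat -> (j < p)%nat ->
  coeff_mat zero (Mmul A B : matrix m p) i j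
  = sum_n (fun l => mult (coeff_mat zero (A : matrix m n) i l) (coeff_mat zero
    (B : matrix n p) l j)) (pred n).
Proof. move=> Hi Hj; exact: coeff_mat_bij. Qed.

Lemma coeff_plus m n (A B : Mat k m n) i j :
  coeff_mat zero (plus A B : matrix m n) i j
  = plus (coeff_mat zero (A : matrix m n) i j) (coeff_mat zero (B : matrix m n) i j).
Proof. exact: coeff_Mplus. Qed.

Lemma coeff_scal m n a (A : Mat k m n) i j :
  coeff_mat zero (scal a A : matrix m n) i j = mult a (coeff_mat zero (A : matrix m n) i j).
Proof. exact: coeff_mat_scal. Qed.

Lemma coeff_le_norm m n (A : Mat k m n) i j :
  abs (coeff_mat zero (A : matrix m n) i j) <= norm A.
Proof.
case: (Nat.lt_ge_cases i m) => Hi; last first.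
  rewrite coeff_mat_out; auto; rewrite abs_zero; exact: norm_ge_0.
case: (Nat.lt_ge_cases j n) => Hj; last first.
  rewrite coeff_mat_out; auto; rewrite abs_zero; exact: norm_ge_0.
exact: mat_norm_coeff_le.
Qed.

Lemma norm_le_coeff m n (A : Mat k m n) c : 0 <= c ->
  (forall i j, (i < m)%nat -> (j < n)%nat ->
     abs (coeff_mat zero (A : matrix m n) i j) <= c) ->
  norm A <= INR (S (pred m)) * (INR (S (pred n)) * c).
Proof. exact: mat_norm_bound. Qed.

Lemma abs_sum_le (u : nat -> K) c n : (forall i, abs (u i) <= c) ->
  abs (sum_n u n) <= INR (S n) * c.
Proof.
move=> Hu; elim: n => [|n IH]; first by rewrite sum_O /= Rmult_1_l.
rewrite sum_Sn [INR (S (S n))]S_INR Rmult_plus_distr_r Rmult_1_l.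
apply: Rle_trans (abs_triangle _ _) _; exact: Rplus_le_compat.
Qed.

Lemma norm_Mmul_le m n p : exists c, 0 < c /\
  forall (A : Mat k m n) (B : Mat k n p), norm (Mmul A B) <= c * norm A * norm B.
Proof.
have P q : 0 < INR (S q) by apply: lt_0_INR; lia.
exists (INR (S (pred m)) * (INR (S (pred p)) * INR (S (pred n)))).
split; first by repeat apply: Rmult_lt_0_compat.
move=> A B.
have HAB := Rmult_le_pos _ _ (norm_ge_0 A) (norm_ge_0 B).
apply: Rle_trans (norm_le_coeff _ _ _ (INR (S (pred n)) * (norm A * norm B)) _ _) _.
- by apply: Rmult_le_pos => //; left.
- move=> i j Hi Hj; rewrite coeff_Mmul //; apply: abs_sum_le => l.
  rewrite abs_mult_eq; apply: Rmult_le_compat; try exact: abs_ge_0; exact: coeff_le_norm.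
- right; ring.
Qed.

Lemma Mmul_linear_r m n p (A : Mat k m n) : is_linear (fun B : Mat k n p => Mmul A B : Mat k m p).
Proof.
split.
- move=> B C; exact: Mmult_distr_l.
- move=> a B; apply: mat_eq => i j Hi Hj.
  rewrite coeff_scal !coeff_Mmul // -sum_n_mult_l; apply: sum_n_ext => l.
  rewrite coeff_scal; apply: toC_inj; rewrite !toC_mult; ring.
- have [c [Hc H]] := norm_Mmul_le m n p.
  exists (c * (norm A + 1)); have := norm_ge_0 A => HA; split; first nra.
  move=> B; apply: Rle_trans (H A B) _.
  apply: Rmult_le_compat_r; [exact: norm_ge_0|nra].
Qed.

Lemma Mmul_linear_l m n p (B : Mat k n p) : is_linear (fun A : Mat k m n => Mmul A B : Mat k m p).
Proof.
split.
- move=> A C; exact: Mmult_distr_r.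
- move=> a A; apply: mat_eq => i j Hi Hj.
  rewrite coeff_scal !coeff_Mmul // -sum_n_mult_l; apply: sum_n_ext => l.
  by rewrite coeff_scal mult_assoc.
- have [c [Hc H]] := norm_Mmul_le m n p.
  exists (c * (norm B + 1)); have := norm_ge_0 B => HB; split; first nra.
  move=> A; apply: Rle_trans (H A B) _.
  have := norm_ge_0 A; nra.
Qed.

Lemma op_norm_ub m n (A : Mat k m n) (x : Kvec k n) :
  norm x <= 1 -> norm (Mmul A x : Kvec k m) <= op_norm A.
Proof.
move=> Hx; rewrite /op_norm.
set P := fun r => _.
have [Hub Hlub] := Lub_Rbar_correct P.
have [c [Hc Hb]] := linear_norm _ (Mmul_linear_r m n 1 A).
have Hfin : Rbar_le (Lub_Rbar P) c.
  apply: Hlub => r [y [Hy ->]] /=; apply: Rle_trans (Hb y) _.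
  rewrite -[X in _ <= X]Rmult_1_r; apply: Rmult_le_compat_l; [lra|exact: Hy].
have H1 : Rbar_le (norm (Mmul A x : Kvec k m)) (Lub_Rbar P) by apply: Hub; exists x.
by move: H1 Hfin; case: (Lub_Rbar P).
Qed.

Lemma op_norm_ge0 m n (A : Mat k m n) : 0 <= op_norm A.
Proof.
have Hz : norm (zero : Kvec k n) <= 1 by rewrite norm_zero; lra.
exact: Rle_trans (norm_ge_0 _) (op_norm_ub m n A zero Hz).
Qed.

Lemma norm_Mmul_op m n (A : Mat k m n) (x : Kvec k n) :
  norm (Mmul A x : Kvec k m) <= op_norm A * norm x.
Proof.
have HL := Mmul_linear_r m n 1 A.
case: (Req_dec (norm x) 0) => Hx.
  have -> : x = zero by apply: norm_eq_zero.
  rewrite (linear_zero _ HL) !norm_zero; lra.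
have Hx0 : 0 < norm x by have := norm_ge_0 x; lra.
pose y := scal (ofR k (/ norm x)) x.
have Hy : norm y <= 1.
  apply: Rle_trans (norm_scal _ _) _; rewrite abs_ofR Rabs_pos_eq; last by left;
    apply: Rinv_0_lt_compat.
  rewrite Rinv_l; lra.
have -> : x = scal (ofR k (norm x)) y.
  by rewrite /y scal_assoc -ofR_mult Rinv_r // ofR_one scal_one.
rewrite (linear_scal _ HL).
have -> : norm (scal (ofR k (norm x)) y) = norm x.
  by rewrite /y scal_assoc -ofR_mult Rinv_r // ofR_one scal_one.
apply: Rle_trans (norm_scal _ _) _; rewrite abs_ofR Rabs_pos_eq; last lra.
rewrite Rmult_comm; apply: Rmult_le_compat_r; first lra.
exact: op_norm_ub.
Qed.

(** The matrix exponential is the orbit of the identity matrix under left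
    multiplication; evaluation at [x] is linear and continuous. *)
Lemma Mexp_apply n (A : Mat k n n) t (x : Kvec k n) :
  (Mmul (Mexp (scal (ofR k t) A)) x : Kvec k n)
  = expop (V := real_space k (Kvec k n)) (fun y : Kvec k n => Mmul A y : Kvec k n) t x.
Proof.
pose L := fun X : Mat k n n => Mmul A X : Mat k n n.
have HL := real_linear k _ _ _ (Mmul_linear_r n n n A).
have [a [Ha1 Ha]] := linear_norm _ HL.
have [b [Hb1 Hb]] := linear_norm _ (real_linear k _ _ _ (Mmul_linear_r n n 1 A)).
have Ha0 : 0 <= a by lra.
have Hb0 : 0 <= b by lra.
pose I : Mat k n n := (Mone : @matrix K n n).
have Hpow j : (pow_n (scal (ofR k t) A : @matrix_Ring K n) j : Mat k n n)
   = scal (ofR k (t ^ j)) (Nat.iter j L I).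
  elim: j => [|j IH]; first by rewrite /= ofR_one scal_one.
  change (Mmul (scal (ofR k t) A) (pow_n (scal (ofR k t) A : @matrix_Ring K n) j : Mat k n n) =
    scal (ofR k (t ^ S j)) (Nat.iter (S j) L I)).
  rewrite IH (linear_scal _ (Mmul_linear_r n n n _)) (linear_scal _
    (Mmul_linear_l n n n _)) scal_assoc -ofR_mult.
  by rewrite (Rmult_comm (t ^ j)).
have Hser := expop_series (real_space k (Mat k n n)) L a Ha0 Ha t I.
have HM : Mexp (scal (ofR k t) A) = expop (V := real_space k (Mat k n n)) L t I.
  rewrite /Mexp.
  have Hser' : is_series (V := Mat k n n) (fun j => scal (ofR k (/ INR (fact j))) (pow_n (scal
    (ofR k t) A : @matrix_Ring K n) j : Mat k n n)) (expop (V := real_space k (Mat k n n)) L t I).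
    apply: (is_series_ext (V := Mat k n n) (fun j => scal (ofR k (t ^ j / INR (fact j)))
      (Nat.iter j L I))); last exact: Hser.
    move=> j; rewrite Hpow scal_assoc -ofR_mult; congr (scal (ofR k _) _); rewrite /Rdiv; ring.
  apply: (iota_unique (V := Mat k n n)); last exact: Hser'.
  move=> y Hy; exact: (is_series_unique_V _ _ _ Hy Hser').
rewrite HM; symmetry.
apply: (expop_unique (real_space k (Kvec k n)) _ b Hb0 Hb).
have := is_series_linear (U := real_space k (Mat k n n)) (V :=
  real_space k (Kvec k n)) (fun X => Mmul X x) _ _
  (real_linear k _ _ _ (Mmul_linear_l n n 1 x)) Hser.
apply: is_series_ext => j.
etransitivity; first exact: (linear_scal (U := real_space k (Mat k n n)) (V :=
  real_space k (Kvec k n)) (fun X => Mmul X x) (real_linear k _ _ _ (Mmul_linear_l n n 1 x))).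
congr (scal _ _).
elim: j => [|j IH]; first exact: (Mmult_one_l (x : matrix n 1)).
rewrite /= -IH; symmetry; exact: Mmult_assoc.
Qed.

Lemma norm_Kvec1 (x : Kvec k 1) : norm x = abs (coeff_mat zero (x : matrix 1 1) 0 0).
Proof.
change (mat_norm k (x : @matrix K 1 1) = abs (coeff_mat zero (x : matrix 1 1) 0 0)).
rewrite /mat_norm /= !sum_O sqrt_pow2 //; exact: abs_ge_0.
Qed.

Section Coordinates.
Variable (H : Hilbert k).

Lemma coeff_Y (psi : nat -> H) N x i j : (i < N)%nat -> (j < 1)%nat ->
  coeff_mat zero (Y_trunc psi N x : matrix N 1) i j = inner x (psi i).
Proof. exact: coeff_mat_bij. Qed.

Lemma Y_linear (psi : nat -> H) N : is_linear (Y_trunc psi N).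
Proof.
split.
- move=> x y; apply: mat_eq => i j Hi Hj.
  by rewrite coeff_plus !coeff_Y // inner_plus_l.
- move=> a x; apply: mat_eq => i j Hi Hj.
  by rewrite coeff_scal !coeff_Y // inner_scal_l.
- pose c := l2 N (fun i => norm (psi i)).
  have Hc : 0 <= c by apply: l2_ge0.
  have P q : 0 < INR (S q) by apply: lt_0_INR; lia.
  exists (INR (S (pred N)) * (INR (S (pred 1)) * (c + 1))); split.
    by repeat apply: Rmult_lt_0_compat => //; lra.
  move=> x.
  apply: Rle_trans (norm_le_coeff _ _ _ ((c + 1) * norm x) _ _) _.
  + by apply: Rmult_le_pos; [lra|exact: norm_ge_0].
  + move=> i j Hi Hj; rewrite coeff_Y //; apply: Rle_trans (cauchy_schwarz _ _ _ _) _.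
    rewrite Rmult_comm; apply: Rmult_le_compat_r; first exact: norm_ge_0.
    have : norm (psi i) <= c by apply: (l2_coeff_le N (fun i => norm (psi i))); [move=> ?;
      exact: norm_ge_0|lia].
    lra.
  + right; ring.
Qed.

Lemma coeff_A_trunc_mul (lam : nat -> K) N (x : Kvec k N) i j : (i < N)%nat -> (j < 1)%nat ->
  coeff_mat zero (Mmul (A_trunc lam N) x : matrix N 1) i j =
    mult (lam i) (coeff_mat zero (x : matrix N 1) i j).
Proof.
move=> Hi Hj; rewrite coeff_Mmul //.
have E n : sum_n (fun l => mult (coeff_mat zero (A_trunc lam N : matrix N N) i l)
  (coeff_mat zero (x : matrix N 1) l j)) n
  = if Nat.leb i n then mult (lam i) (coeff_mat zero (x : matrix N 1) i j) else zero.
  have T l : mult (coeff_mat zero (A_trunc lam N : matrix N N) i l) (coeff_mat zero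
    (x : matrix N 1) l j)
    = if Nat.eqb i l then mult (lam i) (coeff_mat zero (x : matrix N 1) i j) else zero.
    case: (Nat.lt_ge_cases l N) => Hl.
      rewrite /A_trunc coeff_mat_bij //.
      by case: (Nat.eqb_spec i l) => [->|_] //; rewrite mult_zero_l.
    rewrite coeff_mat_out; auto; rewrite mult_zero_l.
    by case: (Nat.eqb_spec i l) => // E; lia.
  elim: n => [|n IH]; first by rewrite sum_O T; case: i {T Hi}.
  rewrite sum_Sn IH T.
  case: (Nat.leb_spec i n) => H1; case: (Nat.eqb_spec i (S n)) => H2;
    case: (Nat.leb_spec i (S n)) => H3; try lia.
  - by rewrite plus_zero_r.
  - by rewrite plus_zero_l.
  - by rewrite plus_zero_l.
by rewrite E (proj2 (Nat.leb_le _ _)) //; lia.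
Qed.

(** The renumbering [sigma] covers the leading block ([sigma] the identity) and a
    single coefficient [n] ([sigma] constant, [N = 1]) with one statement. *)
Lemma Y_eigen (lam : nat -> K) (phi psi : nat -> H) N (sigma : nat -> nat) : biorthogonal phi psi ->
  forall j, Mmul (A_trunc (fun i => lam (sigma i)) N) (Y_trunc (fun i => psi (sigma i)) N (phi j))
     = scal (lam j) (Y_trunc (fun i => psi (sigma i)) N (phi j)).
Proof.
move=> Hbi j; apply: mat_eq => i l Hi Hl.
rewrite coeff_A_trunc_mul // coeff_scal !coeff_Y // Hbi.
by case: (Nat.eqb_spec j (sigma i)) => [->|_] //; rewrite !mult_zero_r.
Qed.

Lemma basis_expansion m (v : Kvec k m) : (0 < m)%nat ->
  v = sum_n (fun j => scal (coeff_mat zero (v : matrix m 1) j 0) (basis_vec k m j)) (pred m).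
Proof.
move=> Hm; apply: mat_eq => i j Hi Hj.
have -> : j = 0%nat by lia.
have E n : coeff_mat zero (sum_n (fun j => scal (coeff_mat zero (v : matrix m 1) j 0)
  (basis_vec k m j)) n : matrix m 1) i 0
   = if Nat.leb i n then coeff_mat zero (v : matrix m 1) i 0 else zero.
  have T l : coeff_mat zero (scal (coeff_mat zero (v : matrix m 1) l 0)
    (basis_vec k m l) : matrix m 1) i 0
    = if Nat.eqb i l then coeff_mat zero (v : matrix m 1) i 0 else zero.
    rewrite coeff_scal /basis_vec coeff_mat_bij //.
    by case: (Nat.eqb_spec i l) => [->|_]; rewrite ?mult_one_r ?mult_zero_r.
  elim: n => [|n IH]; first by rewrite sum_O T; case: i {T Hi}.
  rewrite sum_Sn coeff_plus IH T.
  case: (Nat.leb_spec i n) => H1; case: (Nat.eqb_spec i (S n)) => H2;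
    case: (Nat.leb_spec i (S n)) => H3; try lia.
  - by rewrite plus_zero_r.
  - by rewrite plus_zero_l.
  - by rewrite plus_zero_l.
by rewrite E (proj2 (Nat.leb_le _ _)) //; lia.
Qed.

Lemma is_linear_sum {U V : NormedModule K} (F : U -> V) (u : nat -> U) n : is_linear F ->
  F (sum_n u n) = sum_n (fun i => F (u i)) n.
Proof.
move=> HF; elim: n => [|n IH]; first by rewrite !sum_O.
by rewrite !sum_Sn (linear_plus _ HF) IH.
Qed.

Lemma inner_sum (u : nat -> H) n y : inner (sum_n u n) y = sum_n (fun i => inner (u i) y) n.
Proof.
elim: n => [|n IH]; first by rewrite !sum_O.
by rewrite !sum_Sn inner_plus_l IH.
Qed.

(** The right side is what integration by parts leaves in [mild_projection]; expanding
    [v] on the canonical basis identifies it with the input matrix. *)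
Lemma B_trunc_apply m (A : unbounded_operator H H) (B : Kvec k m -> H) (lam : nat ->
  K) (psi : nat -> H) N :
  is_linear B -> is_linear (fun v => A (B v)) ->
  forall v, Mmul (B_trunc A B lam psi N) v
    = minus (Y_trunc psi N (A (B v))) (Mmul (A_trunc lam N) (Y_trunc psi N (B v))).
Proof.
move=> HB HAB v.
case: (Nat.eq_dec m 0) => Hm.
  have Hv : v = zero by subst m; apply: mat_eq => i j Hi; lia.
  rewrite Hv (linear_zero _ (Mmul_linear_r _ _ _ _)) (linear_zero _ HAB)
    (linear_zero _ HB) !(linear_zero _ (Y_linear _ _)) (linear_zero _ (Mmul_linear_r _ _ _ _)).
  by rewrite minus_eq_zero.
have Hv := basis_expansion m v ltac:(lia).
apply: mat_eq => i j Hi Hj.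
have -> : j = 0%nat by lia.
rewrite /minus coeff_plus coeff_Mmul; try lia.
have -> : coeff_mat zero (opp (Mmul (A_trunc lam N) (Y_trunc psi N (B v))) : matrix N 1) i 0 =
  opp (coeff_mat zero (Mmul (A_trunc lam N) (Y_trunc psi N (B v)) : matrix N 1) i 0).
  exact: coeff_Mopp.
rewrite coeff_A_trunc_mul; try lia.
rewrite !coeff_Y; try lia.
rewrite {2 3}Hv (is_linear_sum _ _ _ HAB) (is_linear_sum _ _ _ HB) !inner_sum.
rewrite -sum_n_mult_l.
have -> (u : nat -> K) n : opp (sum_n u n) = sum_n (fun i => opp (u i)) n.
  elim: n => [|n IH]; first by rewrite !sum_O.
  by rewrite !sum_Sn opp_plus IH.
rewrite -sum_n_plus; apply: sum_n_ext_loc => l Hl.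
rewrite /B_trunc coeff_mat_bij; try lia.
rewrite (linear_scal _ HAB) (linear_scal _ HB) !inner_scal_l.
by apply: toC_inj; rewrite !(toC_mult, toC_plus, toC_opp); ring.
Qed.

End Coordinates.
End MatrixFacts.

(** * Continuously differentiable extensions *)

Section C1Extension.
Variable V : NormedModule R_AbsRing.

Lemma Rmax_dist a s t : Rabs (Rmax a s - Rmax a t) <= Rabs (s - t).
Proof. rewrite /Rmax; case: Rle_dec => H1; case: Rle_dec => H2; split_Rabs; lra. Qed.

(** Continuation by the tangent at [a].  It makes the two-sided fundamental theorem of
    calculus applicable to data given on a half-line. *)
Lemma C1_extension a (f : R -> V) : C1_on (fun t => a <= t) f ->
  exists F dF : R -> V, (forall t, is_derive F t (dF t)) /\ (forall t, continuous dF t) /\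
    (forall t, a <= t -> F t = f t).
Proof.
move=> [df [Hd Hc]].
pose F t := match Rle_dec a t with left _ => f t | right _ => plus (f a) (scal (t - a) (df a)) end.
have F1 t : a <= t -> F t = f t by rewrite /F; case: Rle_dec.
have F2 t : t <= a -> F t = plus (f a) (scal (t - a) (df a)).
  rewrite /F; case: Rle_dec => // H1 H2; have -> : t = a by lra.
  module_eq V.
exists F, (fun t => df (Rmax a t)); split; last split=> //.
- move=> t; apply/is_derive_eps => eps Heps.
  case: (Rle_lt_dec a t) => Hat; last first.
    exists (a - t); split; first lra.
    move=> s Hs; rewrite Rmax_left; last lra.
    rewrite !F2; try (split_Rabs; lra).
    have -> : minus (minus (plus (f a) (scal (s - a) (df a))) (plus (f a) (scal (t - a)
      (df a)))) (scal (s - t) (df a)) = zero by module_eq V.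
    by rewrite norm_zero; apply: Rmult_le_pos; [lra|exact: Rabs_pos].
  rewrite Rmax_right //.
  have [d [Hd0 Hd1]] := proj1 (is_derive_on_eps (fun t => a <=
    t) f t (df t) Hat) (Hd t Hat) eps Heps.
  case: (Req_dec t a) => Hta.
    subst t; exists d; split=> // s Hs.
    case: (Rle_lt_dec a s) => Has; first by rewrite !F1 //; apply: Hd1.
    rewrite !F2; try lra.
    have -> : minus (minus (plus (f a) (scal (s - a) (df a))) (plus (f a) (scal (a - a)
      (df a)))) (scal (s - a) (df a)) = zero by module_eq V.
    by rewrite norm_zero; apply: Rmult_le_pos; [lra|exact: Rabs_pos].
  exists (Rmin d (t - a)); split; first by apply: Rmin_pos; lra.
  move=> s Hs.
  have := Rmin_l d (t - a); have := Rmin_r d (t - a) => M1 M2.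
  by rewrite !F1 //; [apply: Hd1; [split_Rabs|]; lra|split_Rabs; lra].
- move=> t P HP.
  have [d Hd1] := Hc (Rmax a t) (Rmax_l _ _) P HP.
  exists d => s Hs; apply: Hd1; last exact: Rmax_l.
  apply: Rle_lt_trans (Rmax_dist a s t) Hs.
Qed.

Lemma is_derive_derive_on (I : R -> Prop) (f g : R -> V) t l : I t ->
  (forall s, I s -> f s = g s) -> is_derive f t l -> is_derive_on I g t l.
Proof.
move=> It Hfg /is_derive_eps Hd; apply/is_derive_on_eps => // eps Heps.
have [d [Hd0 Hd1]] := Hd eps Heps.
exists d; split=> // s Is Hs; rewrite -!Hfg //; exact: Hd1.
Qed.

(** [t] is not isolated in the half-line: divide the two expansions at [t + h] by
    [h]. *)
Lemma is_derive_on_unique a (f : R -> V) t l1 l2 : a <= t ->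
  is_derive_on (fun s => a <= s) f t l1 -> is_derive_on (fun s => a <= s) f t l2 -> l1 = l2.
Proof.
move=> Hat /(is_derive_on_eps (fun s => a <= s) f t l1 Hat) H1 /(is_derive_on_eps
  (fun s => a <= s) f t l2 Hat) H2.
have Hz : minus l1 l2 = zero.
  apply: norm_eq_zero; apply: Rle_antisym; last exact: norm_ge_0.
  apply: le_epsilon => eps Heps; rewrite Rplus_0_l.
  have [d1 [Hd1 K1]] := H1 (eps / 2) ltac:(lra).
  have [d2 [Hd2 K2]] := H2 (eps / 2) ltac:(lra).
  pose h := Rmin d1 d2 / 2.
  have Hm := Rmin_pos _ _ Hd1 Hd2.
  have Hh : 0 < h < d1 /\ h < d2.
    have := Rmin_l d1 d2; have := Rmin_r d1 d2; rewrite /h; lra.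
  have Ht : t + h - t = h by ring.
  have {}K1 := K1 (t + h) ltac:(lra); have {}K2 := K2 (t + h) ltac:(lra).
  rewrite Ht Rabs_pos_eq in K1 K2; try lra.
  have -> : minus l1 l2 = scal (/ h) (minus (minus (minus (f (t +
    h)) (f t)) (scal h l2)) (minus (minus (f (t + h)) (f t)) (scal h l1))).
    module_eq V; field; lra.
  apply: Rle_trans (norm_scal_R _ _) _.
  rewrite Rabs_inv Rabs_pos_eq; last lra.
  have H3 := norm_minus_le (minus (minus (f (t + h)) (f t)) (scal h l2)) (minus (minus (f (t +
    h)) (f t)) (scal h l1)).
  have H4 := K1 ltac:(lra); have H5 := K2 ltac:(lra).
  apply: (Rmult_le_reg_l h); first lra.
  rewrite -Rmult_assoc Rinv_r; lra.
have -> : l1 = plus (minus l1 l2) l2 by module_eq V.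
by rewrite Hz plus_zero_l.
Qed.
End C1Extension.

(** * Continuity of the semigroup and projection of mild solutions *)

(** [|1 + h z|^2 = 1 + 2 h Re z + h^2 |z|^2] is at most the square of the right side. *)
Lemma abs_one_plus k (z : scalars k) h : 0 <= h ->
  abs (plus one (mult (ofR k h) z)) <= 1 + sRe z * h + abs z ^ 2 * h ^ 2.
Proof.
move=> Hh; rewrite !abs_toC toC_plus toC_mult toC_ofR /sRe.
have -> : toC k one = RtoC 1 by case: k z.
move: (toC k z) => [x y].
have Hc : Cmod (x, y) ^ 2 = x ^ 2 + y ^ 2.
  rewrite /Cmod pow2_sqrt //=; have := pow2_ge_0 x; have := pow2_ge_0 y; rewrite /=; lra.
rewrite Hc /=.
have Hy := pow2_ge_0 (y * h).
have Hx := pow2_ge_0 (x * h + 1).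
have Hq : 0 <= 1 + x * h + (x ^ 2 + y ^ 2) * h ^ 2.
  have := pow2_ge_0 (x * h + 1 / 2); nra.
rewrite -[X in _ <= X]sqrt_pow2; last by rewrite /= in Hq *; lra.
apply: sqrt_le_1_alt => /=.
have H1 : 0 <= (x ^ 2 + y ^ 2) * h ^ 2.
  by apply: Rmult_le_pos; [have := pow2_ge_0 x; have := pow2_ge_0 y; lra|exact: pow2_ge_0].
have H2 := pow2_ge_0 (x * h + (x ^ 2 + y ^ 2) * h ^ 2).
move: H1 H2; rewrite /=; lra.
Qed.

Lemma expop_mode_growth k (lam : nat -> scalars k) n t (x : Kvec k 1) : 0 <= t ->
  norm (expop (V := real_space k (Kvec k 1)) (fun y : Kvec k 1 => Mmul (A_trunc
    (fun _ => lam n) 1) y : Kvec k 1) t x : Kvec k 1)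
  <= exp (sRe (lam n) * t) * norm x.
Proof.
move=> Ht.
set L := fun y : Kvec k 1 => _.
have HL : @is_linear R_AbsRing (real_space k (Kvec k 1)) (real_space k (Kvec k 1)) L.
  by apply: (real_linear k (Kvec k 1) (Kvec k 1)); apply: Mmul_linear_r.
have [a [Ha1 Ha]] := linear_norm _ HL.
apply: (expop_growth (real_space k (Kvec k 1)) L a HL (Rlt_le _ _ Ha1) Ha (sRe (lam n)) (abs
  (lam n) ^ 2)) Ht.
  exact: pow2_ge_0.
move=> h y Hh.
have -> : plus y (scal h (L y : real_space k (Kvec k 1))) =
  scal (plus one (mult (ofR k h) (lam n))) (y : Kvec k 1) :> Kvec k 1.
  rewrite scal_distr_r scal_one -scal_assoc.
  congr (plus _ (scal (ofR k h) _)); apply: mat_eq => i j Hi Hj.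
  by rewrite coeff_scal /L coeff_A_trunc_mul.
apply: (Rle_trans _ _ _ (norm_scal _ (y : Kvec k 1))).
apply: Rmult_le_compat_r; first exact: norm_ge_0.
exact: abs_one_plus.
Qed.

Section SemigroupContinuity.
Variables (k : scalar_kind) (H : Hilbert k) (T : unbounded_operator H H)
  (S : R -> H -> H) (lam : nat -> scalars k) (phi psi : nat -> H).
Hypothesis (Hgen : generates T S) (Hrs : riesz_spectral T lam phi)
  (Hbi : biorthogonal phi psi).

Lemma semigroup_coeff_le n t x : 0 <= t ->
  abs (inner (S t x) (psi n)) <= exp (sRe (lam n) * t) * abs (inner x (psi n)).
Proof.
move=> Ht.
have E y : abs (inner y (psi n)) = norm (Y_trunc (fun _ => psi n) 1 y).
  by rewrite norm_Kvec1 coeff_Y //; lia.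
rewrite !E.
have := projection_semigroup k H T S lam phi psi Hgen Hrs Hbi (Kvec k 1)
  (fun y : Kvec k 1 => Mmul (A_trunc (fun _ => lam n) 1) y : Kvec k 1) (Mmul_linear_r k _ _ _ _)
  (Y_trunc (fun _ => psi n) 1) (Y_linear k H _ 1) (Y_eigen k H lam phi psi 1
    (fun _ => n) Hbi) t x Ht.
move=> ->; exact: expop_mode_growth.
Qed.

Variable omega : R.
Hypothesis (Hom0 : 0 <= omega) (Hom : forall n, sRe (lam n) <= omega).

(** The usual bound follows here from the spectral coordinates, because every
    coefficient grows at most like [exp (omega t)]. *)
Lemma semigroup_growth : exists c, 0 < c /\ forall t x, 0 <= t ->
  norm (S t x) <= c * exp (omega * t) * norm x.
Proof.
have [cb [cu [Hcb [Hcu [Hb Hu]]]]] := riesz_frame k H phi psi (rs_basis _ _ _ Hrs) Hbi.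
exists (cu * cb); split; first exact: Rmult_lt_0_compat.
move=> t x Ht.
have -> : cu * cb * exp (omega * t) * norm x = cu * (exp (omega * t) * (cb * norm x)) by ring.
apply: Hu => N.
have He := exp_pos (omega * t).
apply: Rle_trans (Rmult_le_compat_l _ _ _ (Rlt_le _ _ He) (Hb x N)).
rewrite -l2_scal; [|lra|by move=> i; apply: abs_ge_0].
apply: l2_le => n; split; first exact: abs_ge_0.
apply: Rle_trans (semigroup_coeff_le n t x Ht) _.
apply: Rmult_le_compat_r; first exact: abs_ge_0.
apply: exp_le; apply: Rmult_le_compat_r => //; exact: Hom.
Qed.

Lemma semigroup_at_0 x eps : 0 < eps -> exists d, 0 < d /\ forall h, 0 <= h < d ->
  norm (minus (S h x) x) < eps.
Proof.
move=> Heps.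
have [[_ [H0 [_ Hc]]] _] := Hgen.
have [d Hd] := Hc x _ (locally_le_locally_norm _ _ (locally_norm_ball_norm x (mkposreal eps Heps))).
exists d; split; first exact: cond_pos.
move=> h Hh; case: (Req_dec h 0) => [->|Hh0].
  by rewrite H0 minus_eq_zero norm_zero.
apply: Hd; last lra.
rewrite /ball /= /AbsRing_ball /abs /= /minus /plus /opp /= Ropp_0 Rplus_0_r Rabs_pos_eq; lra.
Qed.

(** [Rmax s 0] extends the orbit to the real line by a constant. *)
Lemma semigroup_continuous x t :
  continuous (fun s => S (Rmax s 0) x : real_space k H) t.
Proof.
apply/(continuous_eps (V := R_NormedModule)) => eps Heps.
have [c [Hc HS]] := semigroup_growth.
pose b := c * exp (omega * (Rmax t 0)).
have Hb : 0 < b by apply: Rmult_lt_0_compat => //; apply: exp_pos.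
have [d [Hd Hx]] := semigroup_at_0 x (eps / b) ltac:(apply: Rdiv_lt_0_compat => //).
exists d; split=> // s Hs.
have {}Hs : Rabs (Rmax s 0 - Rmax t 0) < d.
  rewrite !(Rmax_comm _ 0); apply: Rle_lt_trans (Rmax_dist 0 s t) Hs.
move: Hs (Rmax_r s 0) (Rmax_r t 0) => Hs Hs0 Ht0.
set s' := Rmax s 0 in Hs Hs0 *; set t' := Rmax t 0 in b Hb Hx Hs Ht0 *.
have key p h : 0 <= p <= t' -> 0 <= h < d -> norm (minus (S (p + h) x) (S p x)) < eps.
  move=> Hp Hh.
  rewrite (S_plus k H T S Hgen); try lra.
  rewrite -(linear_minus _ _ _ (S_linear k H T S Hgen p (proj1 Hp))).
  have H1 := HS p (minus (S h x) x) (proj1 Hp).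
  apply: Rle_lt_trans H1 _.
  have H2 := Hx h Hh.
  have H3 : c * exp (omega * p) <= b.
    apply: Rmult_le_compat_l; first lra; apply: exp_le; apply: Rmult_le_compat_l => //; lra.
  have H4 : b * norm (minus (S h x) x) < eps.
    have := Rmult_lt_compat_l _ _ _ Hb H2.
    have -> // : b * (eps / b) = eps by field; lra.
  apply: Rle_lt_trans H4; apply: Rmult_le_compat_r => //; exact: norm_ge_0.
change (norm (minus (S s' x) (S t' x)) < eps).
case: (Rle_dec t' s') => Hst.
  have -> : s' = t' + (s' - t') by ring.
  apply: key; first lra; split_Rabs; lra.
rewrite norm_minus_sym.
have -> : t' = s' + (t' - s') by ring.
apply: key; first lra; split_Rabs; lra.
Qed.

(** Strong continuity and local boundedness give continuity of [S(g s) (f s)], needed to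
    make the integral of the mild formula an actual Riemann integral. *)
Lemma semigroup_apply_continuous (g : R -> R) (f : R -> H) t :
  continuous g t -> continuous (f : R -> real_space k H) t ->
  continuous (fun s => S (Rmax (g s) 0) (f s) : real_space k H) t.
Proof.
move=> Hg Hf.
have Hx : continuous (fun s => S (Rmax (g s) 0) (f t) : real_space k H) t.
  refine (continuous_comp g (fun s => S (Rmax s 0) (f t) : real_space k H) t Hg _).
  exact: semigroup_continuous.
apply/(continuous_eps (V := R_NormedModule)) => eps Heps.
have [c [Hc HS]] := semigroup_growth.
pose b := c * exp (omega * (Rmax (g t) 0 + 1)).
have Hb : 0 < b by apply: Rmult_lt_0_compat => //; apply: exp_pos.
have [d1 [Hd1 H1]] := proj1 (continuous_eps (V := R_NormedModule) _ _) Hx (eps / 2) ltac:(lra).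
have [d2 [Hd2 H2]] := proj1 (continuous_eps (V :=
  R_NormedModule) _ _) Hf (eps / 2 / b) ltac:(apply: Rdiv_lt_0_compat => //; lra).
have [d3 [Hd3 H3]] := proj1 (continuous_eps (V := R_NormedModule) (W :=
  R_NormedModule) _ _) Hg 1 Rlt_0_1.
exists (Rmin d1 (Rmin d2 d3)); split; first by repeat apply: Rmin_pos.
move=> s Hs.
have M1 := Rmin_l d1 (Rmin d2 d3); have M2 := Rmin_r d1 (Rmin d2 d3).
have M3 := Rmin_l d2 d3; have M4 := Rmin_r d2 d3.
have {}H1 := H1 s ltac:(lra); have {}H2 := H2 s ltac:(lra).
have {H3} Hgs : Rabs (g s - g t) < 1 by apply: (H3 s); lra.
have Hr : Rmax (g s) 0 <= Rmax (g t) 0 + 1.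
  have := Rmax_dist 0 (g s) (g t); rewrite !(Rmax_comm 0); split_Rabs; lra.
have Hr0 : 0 <= Rmax (g s) 0 by apply: Rmax_r.
have HSl := S_linear k H T S Hgen _ Hr0.
have -> : minus (S (Rmax (g s) 0) (f s) : real_space k H) (S (Rmax (g t) 0) (f t))
  = plus (S (Rmax (g s) 0) (minus (f s) (f t)) : real_space k H) (minus (S (Rmax (g s) 0)
    (f t) : real_space k H) (S (Rmax (g t) 0) (f t))).
  rewrite (linear_minus _ _ _ HSl); module_eq (real_space k H).
apply: Rle_lt_trans (norm_triangle _ _) _.
have N1 : norm (S (Rmax (g s) 0) (minus (f s) (f t))) <= eps / 2.
  apply: Rle_trans (HS _ _ Hr0) _.
  have H4 : c * exp (omega * Rmax (g s) 0) <= b.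
    apply: Rmult_le_compat_l; first lra; apply: exp_le; apply: Rmult_le_compat_l => //; lra.
  have H5 : b * norm (minus (f s) (f t)) <= eps / 2.
    have := Rmult_le_compat_l _ _ _ (Rlt_le _ _ Hb) (Rlt_le _ _ H2).
    have -> // : b * (eps / 2 / b) = eps / 2 by field; lra.
  apply: Rle_trans H5; apply: Rmult_le_compat_r => //; exact: norm_ge_0.
have := Rplus_le_lt_compat _ _ _ _ N1 H1; rewrite (_ : eps / 2 + eps / 2 = eps) //; lra.
Qed.

Section Mild.
Variables (m : nat) (A : unbounded_operator H H) (B : Kvec k m -> H).
Hypothesis (HB : is_linear B) (HAB : is_linear (fun v => A (B v))).
Variables (V : CompleteNormedModule (scalars k)) (L : V -> V) (Pi : H -> V).
Hypothesis (HL : is_linear L) (HPi : is_linear Pi)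
  (Heig : forall j, L (Pi (phi j)) = scal (lam j) (Pi (phi j))).
Notation E := (@expop (real_space k V) L).

(** Variation of constants for [Pi B v], whose derivative is [Pi B v'], is an integration
    by parts: added to the projected mild formula it cancels the terms with [v'] and the
    boundary terms. *)
Lemma mild_projection (X0 : H) (X : R -> H) (v dv : R -> Kvec k m) t :
  (forall s, is_derive (v : R -> real_space k (Kvec k m)) s (dv s)) ->
  (forall s, continuous (dv : R -> real_space k (Kvec k m)) s) ->
  0 <= t -> boundary_mild_formula A S B X0 X v dv t ->
  is_RInt (V := real_space k V) (fun s => E (t - s) (minus (Pi (A (B (v s)))) (L (Pi (B
    (v s)))))) 0 t
    (minus (Pi (X t) : real_space k V) (E t (Pi X0))).
Proof.
move=> Hv Hdv Ht HX.
have HLr := real_linear k _ _ _ HL.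
have HPr := real_linear k _ _ _ HPi.
have HBr := real_linear k _ _ _ HB.
have HABr := real_linear k _ _ _ HAB.
have [a [Ha1 Ha]] := linear_norm _ HLr.
have Ha0 : 0 <= a by lra.
have Hcv s : continuous (v : R -> real_space k (Kvec k m)) s by apply: ex_derive_continuous;
  eexists; apply: Hv.
have Hproj := projection_semigroup k H T S lam phi psi Hgen Hrs Hbi V L HL Pi HPi Heig.
pose f s : real_space k H := minus (A (B (v s))) (B (dv s)).
have Hf s : continuous (f : R -> real_space k H) s.
  apply: (continuous_minus (V := real_space k H)).
  - exact: (continuous_linear_comp _ _ _ HABr (Hcv s)).
  - exact: (continuous_linear_comp _ _ _ HBr (Hdv s)).
have Hint : ex_RInt (V := real_space k H) (fun s => S (t - s) (f s)) 0 t.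
  apply: (ex_RInt_ext (V := real_space k H) (fun s => S (Rmax (t - s) 0) (f s))).
    move=> s; rewrite (Rmin_left 0 t) // (Rmax_right 0 t) // => Hs.
    by rewrite Rmax_left; [|lra].
  apply: (ex_RInt_continuous (V := real_space k H)) => s _.
  apply: semigroup_apply_continuous; last exact: Hf.
  by apply: ex_derive_continuous; auto_derive.
have I1 := RInt_correct _ _ _ Hint.
have {}I1 := is_RInt_linear (U := real_space k H) (V := real_space k V) Pi _ _ _ _ HPr I1.
pose Z s : real_space k V := Pi (B (v s)).
pose w s : real_space k V := minus (Pi (B (dv s)) : real_space k V) (L (Pi (B (v s)))).
have HPB := is_linear_comp (U := real_space k (Kvec k m)) (V := real_space k H) (W :=
  real_space k V) _ _ HBr HPr.
have HLPB := is_linear_comp (U := real_space k (Kvec k m)) (V := real_space k V) (W :=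
  real_space k V) _ _ HPB HLr.
have I2 : is_RInt (V := real_space k V) (fun s => E (t - s) (w s)) 0 t (minus (Z t) (E (t - 0)
  (Z 0))).
  apply: (variation_of_constants (real_space k V) L a HLr Ha0 Ha Z w) => s _.
  - have -> : plus (L (Z s) : real_space k V) (w s) = Pi (B (dv s)) by rewrite /w /Z;
    module_eq (real_space k V).
    exact: (is_derive_linear_comp (X := real_space k (Kvec k m)) (Y :=
      real_space k V) _ _ _ _ HPB (Hv s)).
  - apply: (continuous_minus (V := real_space k V)).
    + exact: (continuous_linear_comp (X := real_space k (Kvec k m)) (Y :=
      real_space k V) _ _ _ HPB (Hdv s)).
    + exact: (continuous_linear_comp (X := real_space k (Kvec k m)) (Y :=
      real_space k V) _ _ _ HLPB (Hcv s)).
have I3 := is_RInt_plus _ _ _ _ _ _ I1 I2.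
have HE s := is_linear_expop (real_space k V) L a HLr Ha0 Ha s.
pose J : H := RInt (V := real_space k H) (fun s => S (t - s) (f s)) 0 t.
have {}HX : X t = plus (plus (S t (minus X0 (B (v 0)))) (B (v t))) J := HX.
have Hval : minus (Pi (X t) : real_space k V) (E t (Pi X0))
  = plus (Pi J : real_space k V) (minus (Z t) (E (t - 0) (Z 0))).
  rewrite HX !(linear_plus _ HPi) Hproj // Rminus_0_r.
  have -> : Pi (minus X0 (B (v 0))) = minus (Pi X0) (Pi (B (v 0))) by apply: linear_minus.
  have -> : E t (minus (Pi X0) (Pi (B (v 0))) : V) = minus (E t (Pi X0)) (E t (Pi (B (v 0)))).
    exact: (linear_minus (U := real_space k V) (V := real_space k V) (E t) _ _ (HE t)).
  rewrite /Z; module_eq (real_space k V).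
rewrite Hval; move: I3.
apply: is_RInt_ext => s; rewrite (Rmin_left 0 t) // (Rmax_right 0 t) // => Hs.
rewrite Hproj; last lra.
rewrite /f.
have -> : Pi (minus (A (B (v s))) (B (dv s))) = minus (Pi (A (B (v s)))) (Pi (B (dv s))) by
  apply: linear_minus.
rewrite -(linear_plus _ (HE (t - s))); congr (expop _ _ _).
by rewrite /w; module_eq (real_space k V).
Qed.
End Mild.
End SemigroupContinuity.

(** * Prediction and the truncated loop *)

Lemma expop_ext (V : CompleteNormedModule R_AbsRing) (A A' : V -> V) t x :
  is_linear A -> (forall y, A y = A' y) -> expop A' t x = expop A t x.
Proof.
move=> HA HAA'.
have [a [Ha1 Ha]] := linear_norm _ HA.
have Ha' y : norm (A' y) <= a * norm y by rewrite -HAA'.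
apply: (expop_unique V A' a (Rlt_le _ _ Ha1) Ha').
apply: is_series_ext (expop_series V A a (Rlt_le _ _ Ha1) Ha t x) => j; congr (scal _ _).
by elim: j => [|j IH] //=; rewrite IH HAA'.
Qed.

(** For a constant delay [D0], the state at [t + D0] is [exp (D0 A)] applied to the sum of
    the present state and of this integral over the input still on its way. *)
Definition predictor {V U : CompleteNormedModule R_AbsRing} (A : V -> V) (B : U ->
  V) (D0 : R) (u : R -> U) (t : R) : V :=
  RInt (fun s => expop A (t - s - D0) (B (u s))) (t - D0) t.

Section Predictor.
Variables (V U : CompleteNormedModule R_AbsRing) (A : V -> V) (B : U -> V) (D0 : R).
Hypothesis (HA : is_linear A) (HB : is_linear B).
Notation E := (expop A).
Variable u : R -> U.
Hypothesis Hu : forall t, continuous u t.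

Lemma convolution_integrand_continuous (g : R -> V) (f : R -> R) t :
  continuous f t -> continuous g t -> continuous (fun s => E (f s) (g s)) t.
Proof.
have [a [Ha1 Ha]] := linear_norm _ HA.
exact: (continuous_expop_apply V A a HA (Rlt_le _ _ Ha1) Ha).
Qed.

Lemma convolution_factor (g : R -> V) c t a b : (forall s, continuous g s) ->
  RInt (fun s => E (t - s - c) (g s)) a b = E t (RInt (fun s => E (- s - c) (g s)) a b).
Proof.
move=> Hg.
have [al [Ha1 Ha]] := linear_norm _ HA.
rewrite -RInt_linear.
- apply: RInt_ext => s _.
  rewrite -(expop_plus V A al HA (Rlt_le _ _ Ha1) Ha); congr (expop _ _ _); ring.
- exact: (is_linear_expop V A al HA (Rlt_le _ _ Ha1) Ha t).
- apply: ex_RInt_continuous => s _; apply: convolution_integrand_continuous => //.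
  by apply: ex_derive_continuous; auto_derive.
Qed.

Lemma is_derive_RInt_0 (f : R -> V) t : (forall s, continuous f s) ->
  is_derive (fun t => RInt f 0 t) t (f t).
Proof.
move=> Hf; apply: (is_derive_RInt f _ 0) => //.
exists (mkposreal 1 Rlt_0_1) => s _.
apply: RInt_correct; apply: ex_RInt_continuous => r _; exact: Hf.
Qed.

(** Factoring out [exp (t A)] leaves an integral with moving end points; the entering
    and the leaving end contribute [exp (- D0 A) B u(t)] and [B u(t - D0)]. *)
Lemma is_derive_predictor t :
  is_derive (predictor A B D0 u) t
    (plus (A (predictor A B D0 u t)) (minus (E (- D0) (B (u t))) (B (u (t - D0))))).
Proof.
have [a [Ha1 Ha]] := linear_norm _ HA.
have Ha0 := Rlt_le _ _ Ha1.
have HBu s : continuous (fun s => B (u s)) s by apply: continuous_linear_comp.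
pose q s := E (- s - D0) (B (u s)).
have Hq s : continuous q s.
  apply: convolution_integrand_continuous => //.
  by apply: ex_derive_continuous; auto_derive.
pose Q t := RInt q 0 t.
have Hex x y : ex_RInt q x y by apply: ex_RInt_continuous => s _; apply: Hq.
have HQ s : RInt q (s - D0) s = minus (Q s) (Q (s - D0)).
  rewrite /Q -(RInt_Chasles q 0 (s - D0) s) //; module_eq V.
have Hpred s : predictor A B D0 u s = E s (minus (Q s) (Q (s - D0))).
  by rewrite -HQ; apply: (convolution_factor (fun s => B (u s))).
apply: (is_derive_ext (fun s => E s (minus (Q s) (Q (s - D0))))) => [s|]; first by rewrite Hpred.
have HdQ : is_derive (fun s => minus (Q s) (Q (s - D0))) t (minus (q t) (scal 1 (q (t - D0)))).
  apply: is_derive_minus; first exact: is_derive_RInt_0.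
  apply: (is_derive_comp Q (fun s => s - D0)); first exact: is_derive_RInt_0.
  by auto_derive => //; ring.
have := is_derive_expop_apply V A a HA Ha0 Ha (fun s => s) t 1 _ _ (is_derive_id _) HdQ.
rewrite -Hpred.
have HE := is_linear_expop V A a HA Ha0 Ha t.
have -> : E t (minus (q t) (scal 1 (q (t - D0)))) = minus (E (- D0) (B (u t))) (B (u (t - D0))).
  rewrite (linear_minus _ _ _ HE) (linear_scal _ HE) /q -!(expop_plus V A a HA Ha0 Ha).
  have -> : t + (- t - D0) = - D0 by ring.
  have -> : t + (- (t - D0) - D0) = 0 by ring.
  rewrite (expop_0 V A a Ha0 Ha); module_eq V.
have -> // : scal 1 (A (predictor A B D0 u t)) = A (predictor A B D0 u t) by
  apply: (scal_one (A _)).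
Qed.

Lemma predictor_norm b W k t : 0 <= D0 -> 0 <= k ->
  (forall s, t - D0 <= s <= t -> norm (B (u s)) <= b * (W * exp (- k * s))) -> forall a, 0 <= a ->
  (forall x, norm (A x) <= a * norm x) ->
  norm (predictor A B D0 u t) <= D0 * (exp (D0 * a) * exp (k * D0) * b * W) * exp (- k * t).
Proof.
move=> HD0 Hk HW a Ha0 Ha.
have HBu s : continuous (fun s => B (u s)) s by apply: continuous_linear_comp.
have Hex : ex_RInt (fun s => E (t - s - D0) (B (u s))) (t - D0) t.
  apply: ex_RInt_continuous => s _; apply: convolution_integrand_continuous => //.
  by apply: ex_derive_continuous; auto_derive.
have -> : D0 * (exp (D0 * a) * exp (k * D0) * b * W) * exp (- k * t) =
  (t - (t - D0)) * (exp (D0 * a) * (b * (W * (exp (k * D0) * exp (- k * t))))) by ring.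
apply: (norm_RInt_le_const _ _ _ _ _ _ _ (RInt_correct _ _ _ Hex)); first lra.
move=> s Hs.
apply: Rle_trans (norm_expop_le V A a Ha0 Ha _ _) _.
apply: Rmult_le_compat; [left; exact: exp_pos|exact: norm_ge_0| |].
- apply: exp_le; apply: Rmult_le_compat_r => //; split_Rabs; lra.
- have Hs' := HW s Hs; apply: (Rle_trans _ _ _ Hs').
  have HbW : 0 <= b * W.
    have := Rle_trans _ _ _ (norm_ge_0 _) Hs'.
    have He := exp_pos (- k * s); move=> H; apply: (Rmult_le_reg_r (exp (- k * s))) => //; lra.
  rewrite -exp_plus -!Rmult_assoc; apply: Rmult_le_compat_l => //.
  apply: exp_le; nra.
Qed.

End Predictor.

(** Written with [exp (t A)] in front, so that it is defined and differentiable on the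
    whole line. *)
Definition duhamel {V : CompleteNormedModule R_AbsRing} (A : V -> V) (y0 : V) (g : R ->
  V) (t : R) : V :=
  expop A t (plus y0 (RInt (fun s => expop A (- s) (g s)) 0 t)).

Section Duhamel.
Variables (V : CompleteNormedModule R_AbsRing) (A : V -> V) (y0 : V) (g : R -> V).
Hypothesis (HA : is_linear A) (Hg : forall t, continuous g t).

Lemma is_derive_duhamel t : is_derive (duhamel A y0 g) t (plus (A (duhamel A y0 g t)) (g t)).
Proof.
have [a [Ha1 Ha]] := linear_norm _ HA.
have Ha0 := Rlt_le _ _ Ha1.
have Hq s : continuous (fun s => expop A (- s) (g s)) s.
  apply: (convolution_integrand_continuous V A HA) => //.
  by apply: ex_derive_continuous; auto_derive.
have HdQ : is_derive (fun s => plus y0 (RInt (fun s => expop A (- s) (g s)) 0 s)) t (plus zero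
  (expop A (- t) (g t))).
  apply: is_derive_plus; first exact: is_derive_const.
  exact: (is_derive_RInt_0 V (fun s => expop A (- s) (g s)) t Hq).
have := is_derive_expop_apply V A a HA Ha0 Ha (fun s => s) t 1 _ _ (is_derive_id _) HdQ.
rewrite plus_zero_l -(expop_plus V A a HA Ha0 Ha) Rplus_opp_r (expop_0 V A a Ha0 Ha).
by rewrite (scal_one (A _)).
Qed.

Lemma duhamel_unique t y : is_RInt (fun s => expop A (t - s) (g s)) 0 t (minus y (expop A t y0)) ->
  y = duhamel A y0 g t.
Proof.
have [a [Ha1 Ha]] := linear_norm _ HA.
have Ha0 := Rlt_le _ _ Ha1.
move=> Hi; have {}Hi := is_RInt_unique _ _ _ _ Hi.
have HE := is_linear_expop V A a HA Ha0 Ha t.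
rewrite /duhamel (linear_plus _ HE).
have <- : RInt (fun s => expop A (t - s - 0) (g s)) 0 t =
  expop A t (RInt (fun s => expop A (- s) (g s)) 0 t).
  rewrite (convolution_factor V A HA) //; congr (expop _ _ _).
  by apply: RInt_ext => s _; rewrite Rminus_0_r.
have -> : RInt (fun s => expop A (t - s - 0) (g s)) 0 t = minus y (expop A t y0).
  by rewrite -Hi; apply: RInt_ext => s _; rewrite Rminus_0_r.
module_eq V.
Qed.
End Duhamel.

Section TruncatedLoop.
Variables (V U : CompleteNormedModule R_AbsRing) (A : V -> V) (B : U -> V) (K : V -> U).
Hypothesis (HA : is_linear A) (HB : is_linear B) (HK : is_linear K).
Variables (a M l g alpha t0 D0 delta : R) (phi : R -> R).
Let F x := expop A (- D0) (B x).
Let Acl x := plus (A x) (F (K x)).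
Hypothesis (Ha0 : 0 <= a) (Ha : forall x, norm (Acl x) <= a * norm x)
  (HM : 0 <= M) (Hl : 0 < l)
  (Hdec : forall t x, 0 <= t -> norm (expop Acl t x) <= M * exp (- l * t) * norm x)
  (Hg0 : 0 <= g) (Hg : forall x, norm (B (K x)) <= g * norm x)
  (Halpha : 0 < alpha) (Ht0 : 0 < t0) (Hdelta : 0 < delta < D0)
  (Hphi : forall t, 0 <= phi t <= 1) (Hphi1 : forall t, t0 <= t -> phi t = 1)
  (Hgain : M * g * (exp (a * delta) - exp (- l * delta)) < l).

(** The finite-dimensional part of the closed loop, with all signals extended to the real
    line; the constraints of the problem are imposed at the times where they are given. *)
Record truncated_loop (Y : R -> V) (u v d1 d2 : R -> U) (D : R -> R) : Prop := {
  tl_Y : forall t, is_derive Y t (plus (A (Y t)) (B (v t)));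
  tl_v : forall t, v t = plus (u (t - D t)) (d1 t);
  tl_u : forall t, 0 <= t -> u t = scal (phi t) (plus (K (plus (Y t) (predictor A B D0 u t)))
    (d2 t));
  tl_u0 : forall t, - D0 - delta <= t <= 0 -> u t = zero;
  tl_D : forall t, 0 <= t -> Rabs (D t - D0) <= delta;
  tl_cu : forall t, continuous u t;
  tl_cD : forall t, continuous D t;
  tl_cd : forall t, continuous d1 t
}.

Arguments tl_Y {Y u v d1 d2 D} _.
Arguments tl_v {Y u v d1 d2 D} _.
Arguments tl_u {Y u v d1 d2 D} _.
Arguments tl_u0 {Y u v d1 d2 D} _.
Arguments tl_D {Y u v d1 d2 D} _.
Arguments tl_cu {Y u v d1 d2 D} _.
Arguments tl_cD {Y u v d1 d2 D} _.
Arguments tl_cd {Y u v d1 d2 D} _.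

(** The first estimate is [small_gain] up to [T].  The second one, on the state, must not
    see [d2] after [t1]: [small_gain] is applied up to [t1] only, the prediction integral is
    subtracted at [t1], and the open loop is followed from [t1] to [T], where [v] involves
    [u] at times up to [t1] only.  The length [T - t1 <= D0] bounds the growth of a possibly
    unstable [A]. *)
Lemma truncated_stability : exists k C, 0 < k /\ k < alpha /\ 0 < C /\
  forall Y u v d1 d2 D, truncated_loop Y u v d1 d2 D ->
  (forall T E, (forall t, 0 <= t <= T -> norm (d1 t) <= E * exp (- k * t)) ->
     (forall t, 0 <= t <= T -> norm (d2 t) <= E * exp (- k * t)) ->
     0 <= T -> norm (u T) <= C * (norm (Y 0) + E) * exp (- k * T)) /\
  (forall T E, 0 <= T -> (forall t, 0 <= t <= T -> norm (d1 t) <= E * exp (- k * t)) ->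
     (forall t, 0 <= t <= Rmax (T - (D0 - delta)) 0 -> norm (d2 t) <= E * exp (- k * t)) ->
     norm (Y T) <= C * (norm (Y 0) + E) * exp (- k * T) /\
     forall t, 0 <= t <= T -> norm (v t) <= C * (norm (Y 0) + E) * exp (- k * t)).
Proof.
have [al [Hal1 Hal]] := linear_norm _ HA.
have Hal0 := Rlt_le _ _ Hal1.
have HF : is_linear F by apply: (is_linear_comp B (expop A (- D0))) => //;
  exact: (is_linear_expop V A al HA Hal0 Hal).
have [k [C [k0 [ka [HC Hsg]]]]] := small_gain V U A B F K HA HB HF HK a M l g alpha t0 D0 delta phi
  Ha0 Ha HM Hl Hdec Hg0 Hg Halpha Ht0 Hdelta Hphi Hphi1 Hgain.
have [b [b0 Hb]] := linear_norm B HB.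
have [kk [kk0 Hkk]] := linear_norm K HK.
pose Cu := kk * C + 1.
pose p := exp (k * (D0 + delta)).
pose Cv := Cu * p + 1.
pose e := exp (D0 * al) * exp (k * D0).
pose CY1 := C + D0 * (e * b * Cu).
pose CY := e * CY1 + D0 * (e * b * Cv).
have Hp : 1 <= p by apply: exp_ge1; nra.
have He : 0 < e by apply: Rmult_lt_0_compat; apply: exp_pos.
have HCu : 1 <= Cu by rewrite /Cu; have := Rmult_le_pos _ _ (Rlt_le _ _ kk0) HC; lra.
have HCv : 1 <= Cv by have := Rmult_le_pos Cu p ltac:(lra) ltac:(lra); rewrite /Cv; lra.
have Heb : 0 <= e * b by apply: Rmult_le_pos; lra.
have HeCu : 0 <= e * b * Cu by apply: Rmult_le_pos; lra.
have HeCv : 0 <= e * b * Cv by apply: Rmult_le_pos; lra.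
have HCY1 : 0 <= CY1 by rewrite /CY1; have := Rmult_le_pos D0 _ ltac:(lra) HeCu; lra.
have HCY : 0 <= CY.
  rewrite /CY; have := Rmult_le_pos _ _ (Rlt_le _ _ He) HCY1; have :=
    Rmult_le_pos D0 _ ltac:(lra) HeCv; lra.
exists k, (Cu + Cv + CY); split=> //; split=> //; split; first lra.
move=> Y u v d1 d2 D HD.
pose Z t := plus (Y t) (predictor A B D0 u t).
have Hpred0 : predictor A B D0 u 0 = zero.
  rewrite /predictor; apply: is_RInt_unique.
  have H0 := is_RInt_const (0 - D0) 0 (zero : V); rewrite scal_zero_r in H0.
  move: H0; apply: is_RInt_ext => s; rewrite Rmin_left ?Rmax_right; try lra.
  move=> Hs; rewrite (tl_u0 HD); last lra.
  by rewrite (linear_zero _ HB) (linear_zero _ (is_linear_expop V A al HA Hal0 Hal _)).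
have HZ0 : Z 0 = Y 0 by rewrite /Z Hpred0 plus_zero_r.
have Hdata T E : (forall t, 0 <= t <= T -> norm (d1 t) <= E * exp (- k * t)) ->
     (forall t, 0 <= t <= T -> norm (d2 t) <= E * exp (- k * t)) ->
     loop_data V U A B F K D0 delta phi Z u d1 d2 D T k E.
  move=> H1 H2; split=> //.
  - move=> t Ht.
    have := is_derive_plus _ _ _ _ _ (tl_Y HD t) (is_derive_predictor V U A B D0 HA HB u
      (tl_cu HD) t).
    rewrite (tl_v HD).
    have -> // : plus (plus (A (Y t)) (B (plus (u (t - D t)) (d1 t))))
        (plus (A (predictor A B D0 u t)) (minus (expop A (- D0) (B (u t))) (B (u (t - D0)))))
      = plus (A (Z t)) (plus (F (u t)) (plus (B (minus (u (t - D t)) (u (t - D0)))) (B (d1 t)))).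
    rewrite /Z /F (linear_plus _ HA) (linear_plus _ HB) (linear_minus _ _ _ HB); module_eq V.
  - move=> t Ht; apply: (tl_u HD); lra.
  - exact: (tl_u0 HD).
  - move=> t Ht; apply: (tl_D HD); lra.
  - exact: (tl_cu HD).
  - exact: (tl_cD HD).
  - exact: (tl_cd HD).
have Hnn T E : 0 <= T -> (forall t, 0 <= t <= T -> norm (d1 t) <= E * exp (- k * t)) -> 0 <= E.
  move=> HT H1; have := H1 0 ltac:(lra); rewrite Rmult_0_r exp_0 Rmult_1_r; have :=
    norm_ge_0 (d1 0); lra.
have Y0 := norm_ge_0 (Y 0).
have ubound T E : (forall t, 0 <= t <= T -> norm (d1 t) <= E * exp (- k * t)) ->
     (forall t, 0 <= t <= T -> norm (d2 t) <= E * exp (- k * t)) -> 0 <= T ->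
     forall s, - D0 - delta <= s <= T -> norm (u s) <= Cu * (norm (Y 0) + E) * exp (- k * s).
  move=> H1 H2 HT s Hs.
  have HE := Hnn T E HT H1.
  have Hes := exp_pos (- k * s).
  case: (Rle_lt_dec s 0) => Hs0.
    rewrite (tl_u0 HD); last lra.
    rewrite norm_zero; apply: Rmult_le_pos; last lra; apply: Rmult_le_pos; lra.
  have HZs := Hsg Z u d1 d2 D T E (Hdata T E H1 H2) s ltac:(lra); rewrite HZ0 in HZs.
  rewrite (tl_u HD); last lra.
  have [P1 P2] := Hphi s.
  apply: (Rle_trans _ _ _ (norm_scal_R _ _)); rewrite Rabs_pos_eq //.
  apply: (Rle_trans _ (1 * norm (plus (K (Z s)) (d2 s)))).
    by apply: Rmult_le_compat_r => //; apply: norm_ge_0.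
  rewrite Rmult_1_l; apply: (Rle_trans _ _ _ (norm_triangle _ _)).
  have N1 := Rle_trans _ _ _ (Hkk (Z s)) (Rmult_le_compat_l _ _ _ (Rlt_le _ _ kk0) HZs).
  have N2 := H2 s ltac:(lra).
  apply: (Rle_trans _ _ _ (Rplus_le_compat _ _ _ _ N1 N2)).
  rewrite /Cu; have := Rmult_le_pos _ _ Y0 (Rlt_le _ _ Hes); lra.
split.
  move=> T E H1 H2 HT.
  have HE := Hnn T E HT H1.
  apply: (Rle_trans _ _ _ (ubound T E H1 H2 HT T ltac:(lra))).
  apply: Rmult_le_compat_r; first by left; apply: exp_pos.
  by apply: Rmult_le_compat_r; lra.
move=> T E HT H1.
set t1 := Rmax (T - (D0 - delta)) 0 => H2.
have Ht1 : 0 <= t1 <= T by split; [exact: Rmax_r|apply: Rmax_lub; lra].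
have Ht1' : T - (D0 - delta) <= t1 by apply: Rmax_l.
have HE := Hnn T E HT H1.
set R0 := norm (Y 0) + E.
have HR0 : 0 <= R0 by rewrite /R0; lra.
have Hu s : - D0 - delta <= s <= t1 -> norm (u s) <= Cu * R0 * exp (- k * s).
  apply: ubound => //; last lra.
  move=> t Ht; apply: H1; lra.
have Hv s : 0 <= s <= T -> norm (v s) <= Cv * R0 * exp (- k * s).
  move=> Hs; rewrite (tl_v HD).
  have := tl_D HD s (proj1 Hs) => /Rabs_le_between HDs.
  apply: (Rle_trans _ _ _ (norm_triangle _ _)).
  have N1 := Hu (s - D s) ltac:(lra).
  have N2 := H1 s Hs.
  apply: (Rle_trans _ _ _ (Rplus_le_compat _ _ _ _ N1 N2)).
  have E1 : exp (- k * (s - D s)) <= p * exp (- k * s).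
    by rewrite /p -exp_plus; apply: exp_le; nra.
  have N3 := Rmult_le_compat_l _ _ _ (Rmult_le_pos Cu R0 ltac:(lra) HR0) E1.
  have N4 := Rmult_le_pos _ _ Y0 (Rlt_le _ _ (exp_pos (- k * s))).
  rewrite /Cv /R0 in N3 *; lra.
split; last first.
  move=> s Hs; apply: (Rle_trans _ _ _ (Hv s Hs)).
  apply: Rmult_le_compat_r; first by left; apply: exp_pos.
  by apply: Rmult_le_compat_r; lra.
have HZt1 : norm (Z t1) <= C * R0 * exp (- k * t1).
  have := Hsg Z u d1 d2 D t1 E (Hdata t1 E (fun t Ht => H1 t ltac:(lra)) H2) t1 ltac:(lra).
  by rewrite HZ0.
have HP : norm (predictor A B D0 u t1) <= D0 * (e * b * (Cu * R0)) * exp (- k * t1).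
  rewrite /e; apply: (predictor_norm V U A B D0 HA HB u (tl_cu HD)) => //; try lra.
  move=> s Hs; apply: (Rle_trans _ _ _ (Hb _)); apply: Rmult_le_compat_l; first lra.
  apply: Hu; lra.
have HY1 : norm (Y t1) <= CY1 * R0 * exp (- k * t1).
  have -> : Y t1 = minus (Z t1) (predictor A B D0 u t1) by rewrite /Z; module_eq V.
  apply: (Rle_trans _ _ _ (norm_minus_le _ _)).
  rewrite /CY1; lra.
have Hcv t : continuous v t.
  apply: (continuous_ext (fun t => plus (u (t - D t)) (d1 t))).
    by move=> s; rewrite (tl_v HD).
  apply: continuous_plus; last exact: (tl_cd HD).
  refine (continuous_comp (fun r => r - D r) u t _ _); last exact: (tl_cu HD).
  apply: (continuous_minus (V := R_NormedModule)); first exact: continuous_id.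
  exact: (tl_cD HD).
have HI := variation_of_constants V A al HA Hal0 Hal Y (fun s => B (v s)) t1 T
  (fun t _ => tl_Y HD t) (fun t _ => continuous_linear_comp B v t HB (Hcv t)).
have eT : exp (- k * t1) <= exp (k * D0) * exp (- k * T) by rewrite -exp_plus; apply: exp_le; nra.
have HIb : norm (minus (Y T) (expop A (T - t1) (Y t1))) <=
  (T - t1) * (e * b * Cv * R0 * exp (- k * T)).
  apply: (norm_RInt_le_const _ _ _ _ _ _ _ HI); first lra.
  move=> s Hs; apply: (Rle_trans _ _ _ (norm_expop_le V A al Hal0 Hal _ _)).
  have -> : e * b * Cv * R0 * exp (- k * T) = exp (D0 * al) * (b * (Cv * R0 * (exp
    (k * D0) * exp (- k * T)))) by rewrite /e; ring.
  apply: Rmult_le_compat; [left; exact: exp_pos|exact: norm_ge_0| |].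
  + apply: exp_le; apply: Rmult_le_compat_r => //; rewrite Rabs_pos_eq; lra.
  + apply: (Rle_trans _ _ _ (Hb _)); apply: Rmult_le_compat_l; first lra.
    apply: (Rle_trans _ _ _ (Hv s ltac:(lra))); apply: Rmult_le_compat_l.
      by apply: Rmult_le_pos; lra.
    rewrite -exp_plus; apply: exp_le; nra.
have HYe : norm (expop A (T - t1) (Y t1)) <= e * CY1 * R0 * exp (- k * T).
  apply: (Rle_trans _ _ _ (norm_expop_le V A al Hal0 Hal _ _)).
  have -> : e * CY1 * R0 * exp (- k * T) = exp (D0 * al) * (CY1 * R0 * (exp (k * D0) * exp
    (- k * T))) by rewrite /e; ring.
  apply: Rmult_le_compat; [left; exact: exp_pos|exact: norm_ge_0| |].
  + apply: exp_le; apply: Rmult_le_compat_r => //; rewrite Rabs_pos_eq; lra.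
  + apply: (Rle_trans _ _ _ HY1); apply: Rmult_le_compat_l => //.
    by apply: Rmult_le_pos.
have -> : Y T = plus (minus (Y T) (expop A (T - t1) (Y t1))) (expop A (T - t1) (Y t1)) by
  module_eq V.
apply: (Rle_trans _ _ _ (norm_triangle _ _)).
apply: (Rle_trans _ _ _ (Rplus_le_compat _ _ _ _ HIb HYe)).
have HexpT := exp_pos (- k * T).
have HRT : 0 <= R0 * exp (- k * T) by apply: Rmult_le_pos => //; left.
have N1 : (T - t1) * (e * b * Cv * R0 * exp (- k * T)) <= D0 * (e * b * Cv * R0 * exp (- k * T)).
  apply: Rmult_le_compat_r; last lra.
  rewrite Rmult_assoc; exact: Rmult_le_pos.
have N2 : CY * (R0 * exp (- k * T)) <= (Cu + Cv + CY) * (R0 * exp (- k * T)) by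
  apply: Rmult_le_compat_r => //; lra.
rewrite /CY in N2 *; lra.
Qed.
End TruncatedLoop.

(** * Coefficients of high index *)

Lemma l2_sum N p (a : nat -> nat -> R) : (forall l n, 0 <= a l n) ->
  l2 N (fun n => sum_n (fun l => a l n) p) <= sum_n (fun l => l2 N (a l)) p.
Proof.
move=> Ha; elim: p => [|p IH].
  rewrite sum_O; right; apply: l2_ext => n; by rewrite sum_O.
rewrite sum_Sn.
apply: (Rle_trans _ (l2 N (fun n => sum_n (fun l => a l n) p + a (S p) n))).
  by right; apply: l2_ext => n; rewrite sum_Sn.
apply: Rle_trans (l2_triangle _ _ _ _ _) _ => //.
- move=> n; elim: p {IH} => [|p IH]; first by rewrite sum_O.
  by rewrite sum_Sn; apply: Rplus_le_le_0_compat.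
- exact: Rplus_le_compat_r.
Qed.

Lemma l2_head N N0 y : 0 <= y -> l2 N (fun n => if Nat.ltb n N0 then y else 0) <= INR N0 * y.
Proof.
move=> Hy.
have H : forall N, l2 N (fun n => if Nat.ltb n N0 then y else 0) <= INR (min (S N) N0) * y.
  elim=> [|{}N IH].
    rewrite l2_0; last by case: Nat.ltb; lra.
    case: N0 => [|n0] /=; first by rewrite Rmult_0_l; right.
    by rewrite Rmult_1_l; right.
  rewrite l2_S.
  have H0 := l2_ge0 N (fun n => if Nat.ltb n N0 then y else 0).
  case: (Nat.ltb_spec (S N) N0) => Hlt.
    rewrite Nat.min_l; last lia.
    rewrite Nat.min_l in IH; last lia.
    rewrite [INR (S (S N))]S_INR.
    rewrite -[X in _ <= X]sqrt_pow2; last by have := pos_INR (S N); nra.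
    apply: sqrt_le_1_alt; nra.
  rewrite Nat.min_r; last lia.
  rewrite Nat.min_r in IH; last lia.
  rewrite pow_ne_zero; last lia.
  by rewrite Rplus_0_r sqrt_pow2.
apply: Rle_trans (H N) _; apply: Rmult_le_compat_r => //; apply: le_INR; exact: Nat.le_min_r.
Qed.

Lemma sup_on_ub a b f s c : (forall s, a <= s <= b -> f s <= c) -> a <= s <= b ->
  f s <= sup_on a b f.
Proof.
move=> Hc Hs; rewrite /sup_on.
set P := fun r => _.
have [Hub Hlub] := Lub_Rbar_correct P.
have Hfin : Rbar_le (Lub_Rbar P) c by apply: Hlub => r [x [Hx ->]] /=; apply: Hc.
have H1 : Rbar_le (f s) (Lub_Rbar P) by apply: Hub; exists s.
by move: H1 Hfin; case: (Lub_Rbar P).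
Qed.

Section Modes.
Variables (k : scalar_kind) (H : Hilbert k) (m : nat).
Variables (A : unbounded_operator H H) (B : Kvec k m -> H) (lam : nat ->
  scalars k) (psi : nat -> H).

(** A bound on the [n]-th coefficient of [F v], uniform for [v] in the unit ball: the sum
    over the canonical basis is again square summable in [n]. *)
Definition input_coeff (F : Kvec k m -> H) n := sum_n (fun l => abs (inner (F
  (basis_vec k m l)) (psi n))) (pred m).

Lemma norm_B_mode n (v : Kvec k m) :
  norm (Mmul (B_trunc A B (fun _ => lam n) (fun _ => psi n) 1) v : Kvec k 1)
  <= (abs (lam n) * input_coeff B n + input_coeff (fun v => A (B v)) n) * norm v.
Proof.
rewrite norm_Kvec1 coeff_Mmul; try lia.
rewrite /input_coeff.
have T l : abs (mult (coeff_mat zero (B_trunc A B (fun _ => lam n)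
  (fun _ => psi n) 1 : matrix 1 m) 0 l) (coeff_mat zero (v : matrix m 1) l 0))
  <= (abs (lam n) * abs (inner (B (basis_vec k m l)) (psi n)) +
    abs (inner (A (B (basis_vec k m l))) (psi n))) * norm v.
  rewrite abs_mult_eq; apply: Rmult_le_compat;
    [exact: abs_ge_0|exact: abs_ge_0| |exact: coeff_le_norm].
  have P1 := Rmult_le_pos _ _ (abs_ge_0 (lam n)) (abs_ge_0 (inner (B (basis_vec k m l)) (psi n))).
  have P2 := abs_ge_0 (inner (A (B (basis_vec k m l))) (psi n)).
  case: (Nat.lt_ge_cases l m) => Hl; last by rewrite coeff_mat_out; [rewrite abs_zero; lra|right].
  rewrite /B_trunc coeff_mat_bij //.
  apply: Rle_trans (abs_triangle _ _) _.
  by rewrite abs_opp abs_mult_eq; right.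
elim: (pred m) => [|p IH]; first by rewrite !sum_O; apply: T.
rewrite !sum_Sn.
apply: Rle_trans (abs_triangle _ _) _.
apply: (Rle_trans _ _ _ (Rplus_le_compat _ _ _ _ IH (T (S p)))).
by right; rewrite /plus /=; ring.
Qed.

(** [l = - Re lam_n >= alpha], and [l / (l - kap)] is decreasing in [l]; this is where the
    bound [xi] on [|lam_n| / l] is used. *)
Lemma mode_bound n (X0 X : H) (v : R -> Kvec k m) t W kap xi alpha :
  0 <= t -> 0 < kap < alpha -> sRe (lam n) <= - alpha -> abs (lam n) <= xi * - sRe (lam n) ->
    0 <= W ->
  (forall s, 0 <= s <= t -> norm (v s) <= W * exp (- kap * s)) ->
  is_RInt (V := real_space k (Kvec k 1))
    (fun s => expop (V := real_space k (Kvec k 1)) (fun y : Kvec k 1 => Mmul (A_trunc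
      (fun _ => lam n) 1) y : Kvec k 1) (t - s)
       (Mmul (B_trunc A B (fun _ => lam n) (fun _ => psi n) 1) (v s))) 0 t
    (minus (Y_trunc (fun _ => psi n) 1 X : real_space k (Kvec k 1))
       (expop (V := real_space k (Kvec k 1)) (fun y : Kvec k 1 => Mmul (A_trunc
         (fun _ => lam n) 1) y : Kvec k 1) t (Y_trunc (fun _ => psi n) 1 X0))) ->
  abs (inner X (psi n)) <= exp (- kap * t) *
    (abs (inner X0 (psi n)) + W * (xi * alpha / (alpha - kap) * input_coeff B n +
      / (alpha - kap) * input_coeff (fun v => A (B v)) n)).
Proof.
move=> Ht Hkap Hre Hxi HW Hv HI.
have Eab y : abs (inner y (psi n)) = norm (Y_trunc (fun _ => psi n) 1 y).
  by rewrite norm_Kvec1 coeff_Y //; lia.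
rewrite !Eab.
set s1 := input_coeff B n; set s2 := input_coeff _ n.
have Hs1 : 0 <= s1.
  rewrite /s1 /input_coeff; elim: (pred m) => [|p IH]; first by rewrite sum_O; apply: abs_ge_0.
  by rewrite sum_Sn; apply: Rplus_le_le_0_compat => //; apply: abs_ge_0.
have Hs2 : 0 <= s2.
  rewrite /s2 /input_coeff; elim: (pred m) => [|p IH]; first by rewrite sum_O; apply: abs_ge_0.
  by rewrite sum_Sn; apply: Rplus_le_le_0_compat => //; apply: abs_ge_0.
pose l := - sRe (lam n).
have Hl : alpha <= l by rewrite /l; lra.
have HIb := convolution_bound _ 0 t 1 ((abs (lam n) * s1 + s2) * W) l kap _ Ht ltac:(lra) _ HI.
have {}HIb := HIb ltac:(idtac).
set I := minus _ _ in HI HIb.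
have {}HIb : norm I <= 1 * ((abs (lam n) * s1 +
  s2) * W) * exp (- kap * t) * ((1 - exp (- (l - kap) * (t - 0))) / (l - kap)).
  apply: HIb => s Hs.
  apply: (Rle_trans _ _ _ (expop_mode_growth k lam n (t - s) _ ltac:(lra))).
  have -> : 1 * exp (- l * (t - s)) = exp (sRe (lam n) * (t - s)) by
    rewrite /l Ropp_involutive Rmult_1_l.
  apply: Rmult_le_compat_l; first by left; apply: exp_pos.
  apply: (Rle_trans _ _ _ (norm_B_mode n (v s))).
  rewrite (Rmult_assoc _ W); apply: Rmult_le_compat_l; last exact: Hv.
  have := Rmult_le_pos _ _ (abs_ge_0 (lam n)) Hs1; rewrite -/s1 -/s2; lra.
have -> : Y_trunc (fun _ => psi n) 1 X = plus I (expop (V :=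
  real_space k (Kvec k 1)) (fun y : Kvec k 1 => Mmul (A_trunc
    (fun _ => lam n) 1) y : Kvec k 1) t (Y_trunc (fun _ => psi n) 1 X0)).
  rewrite /I; module_eq (real_space k (Kvec k 1)).
apply: (Rle_trans _ _ _ (norm_triangle _ _)).
have N1 := expop_mode_growth k lam n t (Y_trunc (fun _ => psi n) 1 X0) Ht.
rewrite Rmult_plus_distr_l Rplus_comm; apply: Rplus_le_compat.
  apply: (Rle_trans _ _ _ N1); apply: Rmult_le_compat_r; first exact: norm_ge_0.
  apply: exp_le; nra.
apply: (Rle_trans _ _ _ HIb).
have Hlk : 0 < / (l - kap) by apply: Rinv_0_lt_compat; lra.
have H1 : (1 - exp (- (l - kap) * (t - 0))) / (l - kap) <= / (l - kap).
  rewrite -[X in _ <= X]Rmult_1_l; apply: Rmult_le_compat_r; first lra.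
  have := exp_pos (- (l - kap) * (t - 0)); lra.
have He := exp_pos (- kap * t).
have Hal := Rmult_le_pos _ _ (abs_ge_0 (lam n)) Hs1.
have P1 : 0 <= 1 * ((abs (lam n) * s1 + s2) * W) * exp (- kap * t).
  by rewrite Rmult_1_l; apply: Rmult_le_pos; [apply: Rmult_le_pos => //; lra|lra].
apply: (Rle_trans _ _ _ (Rmult_le_compat_l _ _ _ P1 H1)).
have -> : 1 * ((abs (lam n) * s1 + s2) * W) * exp (- kap * t) * / (l - kap) =
  exp (- kap * t) * (W * (abs (lam n) / (l - kap) * s1 + / (l - kap) * s2)).
  field; lra.
apply: Rmult_le_compat_l; first lra.
apply: Rmult_le_compat_l => //.
apply: Rplus_le_compat; apply: Rmult_le_compat_r => //.
- apply: (Rle_trans _ (xi * l / (l - kap))); first by apply: Rmult_le_compat_r => //; lra.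
  have Hxi0 : 0 <= xi.
    have := abs_ge_0 (lam n); move=> Ha0; apply: (Rmult_le_reg_r l); [lra|rewrite /l; lra].
  have -> : xi * l / (l - kap) = xi * (l / (l - kap)) by field; lra.
  have -> : xi * alpha / (alpha - kap) = xi * (alpha / (alpha - kap)) by field; lra.
  apply: Rmult_le_compat_l => //.
  apply/Rle_div_l; first lra.
  have -> : alpha / (alpha - kap) * (l - kap) = l + (l - alpha) * (kap / (alpha - kap)) by
    field; lra.
  have : 0 <= (l - alpha) * (kap / (alpha - kap)) by apply: Rmult_le_pos;
    [lra|apply: Rdiv_le_0_compat; lra].
  lra.
- apply: Rinv_le_contravar; lra.
Qed.
End Modes.

(** * The truncated loop of a mild solution *)

Section MildToTruncated.
Variables (k : scalar_kind) (H : Hilbert k) (m : nat)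
  (A : unbounded_operator H H) (Bb : unbounded_operator H (Kvec k m))
  (S : R -> H -> H) (B : Kvec k m -> H) (lam : nat -> scalars k) (phi psi : nat -> H)
  (N0 : nat) (K : Mat k m N0) (varphi : R -> R) (D0 delta omega : R).
Hypothesis (Hbcs : boundary_control_system A Bb S B)
  (Hrs : riesz_spectral (restrict_ker A Bb) lam phi) (Hbi : biorthogonal phi psi)
  (Hom0 : 0 <= omega) (Hom : forall n, sRe (lam n) <= omega) (Hdelta : 0 < delta < D0).

Let V := real_space k (Kvec k N0).
Let U := real_space k (Kvec k m).
(** Multiplication maps between the spaces of column vectors; as plain functions they can
    be read in the complex and in the underlying real spaces. *)
Definition truncated_op (lam : nat -> scalars k) N : Kvec k N -> Kvec k N :=
  fun y => Mmul (A_trunc lam N) y.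
Definition truncated_input (lam : nat -> scalars k) (psi : nat -> H) N : Kvec k m ->
  Kvec k N := fun y => Mmul (B_trunc A B lam psi N) y.

(** The boundary input [v] is extended to the line by extending [u], [D] and [d1].  The
    derivative given with the mild formula then coincides with the continuous derivative
    of the extension, by uniqueness of one-sided derivatives.  In the feedback law the
    lower limit [max (t - D0, 0)] may be replaced by [t - D0] as [u] vanishes before 0. *)
Lemma mild_truncated_loop D X0 d1 d2 X u :
  C1_on (fun t => 0 <= t) D -> (forall t, 0 <= t -> Rabs (D t - D0) <= delta) ->
  C1_on (V := U) (fun t => 0 <= t) d1 ->
  mild_solution A S B lam psi N0 K varphi D0 delta D X0 d1 d2 X u ->
  exists (Y : R -> V) (uF v d1F : R -> U) (DF : R -> R),
    truncated_loop V U (truncated_op lam N0) (truncated_input lam psi N0)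
      (fun x : Kvec k N0 => Mmul K x) D0 delta varphi Y uF v d1F d2 DF /\
    (forall t, 0 <= t -> Y t = Y_trunc psi N0 (X t)) /\ Y 0 = Y_trunc psi N0 X0 /\
    (forall t, 0 <= t -> uF t = u t) /\ (forall t, 0 <= t -> d1F t = d1 t) /\
    (forall n t, 0 <= t -> is_RInt (V := real_space k (Kvec k 1))
      (fun s => expop (V := real_space k (Kvec k 1)) (truncated_op (fun _ => lam n) 1) (t - s)
       (truncated_input (fun _ => lam n) (fun _ => psi n) 1 (v s))) 0 t
      (minus (Y_trunc (fun _ => psi n) 1 (X t) : real_space k (Kvec k 1))
       (expop (V := real_space k (Kvec k 1)) (truncated_op (fun _ => lam n) 1) t (Y_trunc
         (fun _ => psi n) 1 X0)))).
Proof.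
move=> HD HDd Hd1 [_ HuC1 [dv [Hdv HX]] Hu0 Hufb].
have [HB [HdomB [HAB HBbB]]] := bcs_lifting _ _ _ _ Hbcs.
have Hgen := bcs_generates _ _ _ _ Hbcs.
have [uF [duF [HuF [HduF EuF]]]] := C1_extension U _ u HuC1.
have [DF [dDF [HDF [HdDF EDF]]]] := C1_extension R_NormedModule _ D HD.
have [d1F [dd1F [Hd1F [Hdd1F Ed1F]]]] := C1_extension U _ d1 Hd1.
pose v t : U := plus (uF (t - DF t)) (d1F t).
pose dvF t : U := plus (scal (1 - dDF t) (duF (t - DF t))) (dd1F t).
have Hr t : is_derive (fun s => s - DF s) t (1 - dDF t).
  exact: (is_derive_minus (V := R_NormedModule) (fun s => s) DF t 1 (dDF t) (is_derive_id _)
    (HDF t)).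
have Hv t : is_derive v t (dvF t).
  apply: is_derive_plus => //.
  exact: (is_derive_comp uF (fun s => s - DF s) t _ _ (HuF _) (Hr t)).
have Hcr t : continuous (fun s => s - DF s) t by apply: ex_derive_continuous; eexists; apply: Hr.
have HdvF t : continuous dvF t.
  apply: continuous_plus => //.
  apply: continuous_scal.
  - apply: (continuous_minus (V := R_NormedModule)) => //; exact: continuous_const.
  - exact: (continuous_comp (fun s => s - DF s) duF t (Hcr t) (HduF _)).
have Ev t : 0 <= t -> v t = plus (u (t - D t)) (d1 t).
  move=> Ht; rewrite /v EDF // Ed1F //.
  have := HDd t Ht => /Rabs_le_between HDt.
  by rewrite EuF //; lra.
have Edv t : 0 <= t -> dv t = dvF t.
  move=> Ht; apply: (is_derive_on_unique U 0 _ t _ _ Ht (Hdv t Ht)).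
  by apply: (is_derive_derive_on U _ v) => // s Hs; apply: Ev.
have Hcv t : continuous v t by apply: ex_derive_continuous; eexists; apply: Hv.
have Hmild t : 0 <= t -> boundary_mild_formula A S B X0 X v dvF t.
  move=> Ht; move: (HX t Ht); rewrite /boundary_mild_formula -!Ev //; last lra.
  move=> ->; congr (plus _ _).
  apply: (RInt_ext (V := real_space k H)) => s;
    rewrite (Rmin_left 0 t) // (Rmax_right 0 t) // => Hs.
  by rewrite -Ev ?Edv //; lra.
have Hmode N (sigma : nat -> nat) t : 0 <= t -> is_RInt (V := real_space k (Kvec k N))
      (fun s => expop (V := real_space k (Kvec k N)) (truncated_op (fun i => lam (sigma i)) N)
        (t - s)
       (truncated_input (fun i => lam (sigma i)) (fun i => psi (sigma i)) N (v s))) 0 t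
      (minus (Y_trunc (fun i => psi (sigma i)) N (X t) : real_space k (Kvec k N))
       (expop (V := real_space k (Kvec k N)) (truncated_op (fun i => lam (sigma i)) N) t
         (Y_trunc (fun i => psi (sigma i)) N X0))).
  move=> Ht.
  have := mild_projection k H (restrict_ker A Bb) S lam phi psi Hgen Hrs Hbi omega Hom0 Hom m A
    B HB HAB (Kvec k N)
    (truncated_op (fun i => lam (sigma i)) N) (Y_trunc (fun i => psi (sigma i)) N)
      (Mmul_linear_r k _ _ _ _) (Y_linear k H _ N)
    (Y_eigen k H lam phi psi N sigma Hbi) X0 X v dvF t Hv HdvF Ht (Hmild t Ht).
  apply: is_RInt_ext => s _; congr (expop _ _ _).
  by rewrite /truncated_input B_trunc_apply.
have HAr : @is_linear R_AbsRing V V (truncated_op lam N0) by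
  apply: (real_linear k (Kvec k N0) (Kvec k N0)); apply: Mmul_linear_r.
have HBr : @is_linear R_AbsRing U V (truncated_input lam psi N0) by
  apply: (real_linear k (Kvec k m) (Kvec k N0)); apply: Mmul_linear_r.
have HKr : @is_linear R_AbsRing V U (fun x : Kvec k N0 => Mmul K x) by
  apply: (real_linear k (Kvec k N0) (Kvec k m)); apply: Mmul_linear_r.
pose g (s : R) : V := truncated_input lam psi N0 (v s).
have Hg s : continuous g s by apply: (continuous_linear_comp (X := U) (Y := V)).
pose Y : R -> V := duhamel (V := V) (truncated_op lam N0) (Y_trunc psi N0 X0) g.
have HY t : 0 <= t -> Y t = Y_trunc psi N0 (X t).
  move=> Ht; symmetry; apply: (duhamel_unique V _ _ _ HAr Hg).
  exact: (Hmode N0 (fun i => i) t Ht).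
have HY0 : Y 0 = Y_trunc psi N0 X0.
  rewrite /Y /duhamel RInt_point plus_zero_r.
  have [al [Hal1 Hal]] := linear_norm _ HAr.
  exact: (expop_0 V _ al (Rlt_le _ _ Hal1) Hal).
have HcuF t : continuous uF t by apply: ex_derive_continuous; eexists; apply: HuF.
have Huneg t : - D0 - delta <= t <= 0 -> uF t = zero.
  by move=> Ht; rewrite EuF; [apply: Hu0|lra].
exists Y, uF, v, d1F, DF; split; last first.
  split=> //; split=> //; split; first by move=> t Ht; apply: EuF; lra.
  split=> // n t Ht; exact: (Hmode 1%nat (fun _ => n) t Ht).
split=> //.
- move=> t; exact: (is_derive_duhamel V _ _ _ HAr Hg).
- move=> t Ht; rewrite EuF; last lra.
  rewrite Hufb // /feedback_law HY //.
  have HP : RInt (V := V) (fun s => Mmul (Mexp (scal (ofR k (t - s - D0)) (A_trunc lam N0)))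
    (Mmul (B_trunc A B lam psi N0) (u s))) (Rmax (t - D0) 0) t
    = predictor (V := V) (U := U) (truncated_op lam N0) (truncated_input lam psi N0) D0 uF t.
    have -> : RInt (V := V) (fun s => Mmul (Mexp (scal (ofR k (t - s - D0)) (A_trunc lam N0)))
      (Mmul (B_trunc A B lam psi N0) (u s))) (Rmax (t - D0) 0) t
      = RInt (V := V) (fun s => expop (V := V) (truncated_op lam N0) (t - s - D0)
        (truncated_input lam psi N0 (uF s))) (Rmax (t - D0) 0) t.
      apply: (RInt_ext (V := V)) => s.
      have M1 : Rmax (t - D0) 0 <= t by apply: Rmax_lub; lra.
      have M2 := Rmax_r (t - D0) 0.
      rewrite (Rmin_left _ _ M1) (Rmax_right _ _ M1) => Hs.
      rewrite Mexp_apply EuF //; lra.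
    have Hex a b : ex_RInt (V := V) (fun s => expop (V :=
      V) (truncated_op lam N0) (t - s - D0) (truncated_input lam psi N0 (uF s))) a b.
      apply: (ex_RInt_continuous (V := V)) => s _;
        apply: (convolution_integrand_continuous V _ HAr).
      + by apply: ex_derive_continuous; auto_derive.
      + exact: (continuous_linear_comp (X := U) (Y := V)).
    rewrite /predictor -(RInt_Chasles (V := V) _ (t - D0) (Rmax (t - D0) 0) t) //.
    rewrite (_ : RInt (V := V) _ (t - D0) (Rmax (t - D0) 0) = zero) ?plus_zero_l //.
    apply: is_RInt_unique.
    have Hz := is_RInt_const (V := V) (t - D0) (Rmax (t - D0) 0) zero; rewrite scal_zero_r in Hz.
    move: Hz; apply: is_RInt_ext => s; rewrite Rmin_left; last exact: Rmax_l.
    rewrite Rmax_right; last exact: Rmax_l.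
    move=> Hs.
    have Hs0 : s <= 0.
      move: Hs; rewrite /Rmax; case: Rle_dec => ? ?; lra.
    have [al [Hal1 Hal]] := linear_norm _ HAr.
    rewrite Huneg; last lra.
    by rewrite (linear_zero _ HBr) (linear_zero _ (is_linear_expop V _ al HAr
      (Rlt_le _ _ Hal1) Hal _)).
  rewrite HP.
  have HKp x y : Mmul K (plus x y : Kvec k N0) = plus (Mmul K x : Kvec k m) (Mmul K y) by
    exact: (linear_plus _ (Mmul_linear_r k m N0 1 K)).
  rewrite [X in _ = scal _ (plus X _)]HKp.
  change (scal (ofR k (varphi t)) (plus (plus (Mmul K (Y_trunc psi N0 (X t)) : Kvec k m)
    (d2 t)) (Mmul K (predictor (V := V) (U := U) (truncated_op lam N0)
      (truncated_input lam psi N0) D0 uF t)))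
   = scal (ofR k (varphi t)) (plus (plus (Mmul K (Y_trunc psi N0 (X t)) : Kvec k m) (Mmul K
     (predictor (V := V) (U := U) (truncated_op lam N0)
       (truncated_input lam psi N0) D0 uF t))) (d2 t))).
  congr (scal _ _).
  module_eq (real_space k (Kvec k m)).
- by move=> t Ht; rewrite EDF //; apply: HDd.
- by move=> t; apply: ex_derive_continuous; eexists; apply: HDF.
- by move=> t; apply: ex_derive_continuous; eexists; apply: Hd1F.
Qed.
End MildToTruncated.

(** * Stability of the closed loop *)

(** Minkowski's inequality for the l2 norm of the bounds on the coefficients: the head of
    [N0] equal terms, the initial value, and the two input terms. *)
Lemma state_from_modes k (H : Hilbert k) m (A : unbounded_operator H H) (B : Kvec k m -> H)
   (psi : nat -> H) N0 cb cu p q :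
  0 < cb -> 0 < cu -> 0 <= p -> 0 <= q ->
  (forall x N, l2 N (fun n => abs (inner x (psi n))) <= cb * norm x) ->
  (forall x Q, (forall N, l2 N (fun n => abs (inner x (psi n))) <= Q) -> norm x <= cu * Q) ->
  exists C, 0 < C /\ forall (X X0 : H) e Yb W, 0 < e -> 0 <= Yb -> 0 <= W ->
    (forall n, (n < N0)%nat -> abs (inner X (psi n)) <= e * Yb) ->
    (forall n, (N0 <= n)%nat -> abs (inner X (psi n)) <= e *
       (abs (inner X0 (psi n)) + W * (p * input_coeff k H m psi B n +
         q * input_coeff k H m psi (fun v => A (B v)) n))) ->
    norm X <= C * (norm X0 + Yb + W) * e.
Proof.
move=> Hcb Hcu Hp Hq Hb Hu.
pose S1 := sum_n (fun l => cb * norm (B (basis_vec k m l))) (pred m).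
pose S2 := sum_n (fun l => cb * norm (A (B (basis_vec k m l)))) (pred m).
have sum_ge0 (a : nat -> R) n : (forall l, 0 <= a l) -> 0 <= sum_n a n.
  move=> Ha; elim: n => [|n IH]; first by rewrite sum_O.
  by rewrite sum_Sn; apply: Rplus_le_le_0_compat.
have HS1 : 0 <= S1 by apply: sum_ge0 => l; apply: Rmult_le_pos; [lra|exact: norm_ge_0].
have HS2 : 0 <= S2 by apply: sum_ge0 => l; apply: Rmult_le_pos; [lra|exact: norm_ge_0].
have Hs F N : l2 N (input_coeff k H m psi F) <= sum_n (fun l => cb * norm (F
  (basis_vec k m l))) (pred m).
  rewrite /input_coeff.
  apply: Rle_trans (l2_sum _ _ (fun l n => abs (inner (F (basis_vec k m l)) (psi n))) _) _.
    by move=> l n; apply: abs_ge_0.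
  by apply: sum_n_m_le => l; apply: Hb.
have HN0 := pos_INR N0.
pose C := cu * (INR N0 + cb + p * S1 + q * S2) + 1.
have HpS := Rmult_le_pos _ _ Hp HS1.
have HqS := Rmult_le_pos _ _ Hq HS2.
exists C; split.
  rewrite /C; have := Rmult_le_pos cu (INR N0 + cb + p * S1 + q * S2) ltac:(lra) ltac:(lra); lra.
move=> X X0 e Yb W He HYb HW H1 H2.
have Hx0 := norm_ge_0 X0.
have ic_ge0 F n : 0 <= input_coeff k H m psi F n by apply: sum_ge0 => l; apply: abs_ge_0.
have HX : norm X <= cu * (e * (INR N0 * Yb + (cb * norm X0 + W * (p * S1 + q * S2)))).
  apply: Hu => N.
  pose hd n := if Nat.ltb n N0 then Yb else 0.
  pose i1 n := input_coeff k H m psi B n.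
  pose i2 n := input_coeff k H m psi (fun v => A (B v)) n.
  have Hhd n : 0 <= hd n by rewrite /hd; case: Nat.ltb; lra.
  have Hi1 n : 0 <= p * i1 n by apply: Rmult_le_pos => //; apply: ic_ge0.
  have Hi2 n : 0 <= q * i2 n by apply: Rmult_le_pos => //; apply: ic_ge0.
  have Hii n : 0 <= p * i1 n + q * i2 n by have := Hi1 n; have := Hi2 n; lra.
  have HWi n : 0 <= W * (p * i1 n + q * i2 n) by apply: Rmult_le_pos.
  have Hx n := abs_ge_0 (inner X0 (psi n)).
  have Hxi n : 0 <= abs (inner X0 (psi n)) + W * (p * i1 n + q * i2 n) by have := Hx n; have :=
    HWi n; lra.
  apply: (Rle_trans _ (l2 N (fun n => e * (hd n + (abs (inner X0 (psi n)) + W * (p * i1 n +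
    q * i2 n)))))).
    apply: l2_le => n; split; first exact: abs_ge_0.
    rewrite /hd; case: (Nat.ltb_spec n N0) => Hn.
      apply: Rle_trans (H1 n Hn) _; apply: Rmult_le_compat_l; first lra.
      have := Hxi n; lra.
    by rewrite Rplus_0_l; apply: H2.
  rewrite l2_scal; [|lra|by move=> n; have := Hhd n; have := Hxi n; lra].
  apply: Rmult_le_compat_l; first lra.
  apply: Rle_trans (l2_triangle _ _ _ Hhd Hxi) _.
  apply: Rplus_le_compat; first exact: l2_head.
  apply: Rle_trans (l2_triangle _ _ _ Hx HWi) _.
  apply: Rplus_le_compat; first exact: Hb.
  rewrite l2_scal //; apply: Rmult_le_compat_l => //.
  apply: Rle_trans (l2_triangle _ _ _ Hi1 Hi2) _.
  rewrite !l2_scal //; try by move=> n; apply: ic_ge0.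
  by apply: Rplus_le_compat; apply: Rmult_le_compat_l => //; apply: Hs.
apply: Rle_trans HX _.
have -> : cu * (e * (INR N0 * Yb + (cb * norm X0 + W * (p * S1 + q * S2)))) =
  cu * (INR N0 * Yb + (cb * norm X0 + W * (p * S1 + q * S2))) * e by ring.
apply: Rmult_le_compat_r; first lra.
set s := norm X0 + Yb + W.
have Q1 : INR N0 * Yb <= INR N0 * s by apply: Rmult_le_compat_l => //; rewrite /s; lra.
have Q2 : cb * norm X0 <= cb * s by apply: Rmult_le_compat_l; rewrite /s; lra.
have Q3 : W * (p * S1 + q * S2) <= s * (p * S1 + q * S2) by apply: Rmult_le_compat_r;
  rewrite /s; lra.
have Q4 := Rmult_le_compat_l cu _ _ (Rlt_le _ _ Hcu) (Rplus_le_compat _ _ _ _ Q1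
  (Rplus_le_compat _ _ _ _ Q2 Q3)).
apply: Rle_trans Q4 _; rewrite /C.
have : 0 <= s by rewrite /s; lra.
lra.
Qed.

(** Translates the suprema of the statement, normalised at the time [T], into bounds with
    decay rate [kap] on the whole interval. *)
Lemma weighted_sup_bound k m kap (d : R -> Kvec k m) t T : 0 <= t ->
  C1_on (V := real_space k (Kvec k m)) (fun t => 0 <= t) d ->
  0 <= sup_on 0 t (fun tau => exp (- kap * (T - tau)) * norm (d tau)) /\
  forall s, 0 <= s <= t -> norm (d s) <= exp (kap * T) * sup_on 0 t (fun tau => exp (- kap *
    (T - tau)) * norm (d tau)) * exp (- kap * s).
Proof.
move=> Ht Hd.
have [dF [ddF [HdF [_ EdF]]]] := C1_extension (real_space k (Kvec k m)) _ d Hd.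
have Hc s : 0 <= s <= t -> continuous dF s by move=> _; apply: ex_derive_continuous; eexists;
  apply: HdF.
have [s0 [Hs0 Hmax]] := continuous_max (fun s => exp (kap * s) * norm (dF s)) t Ht
  (fun s Hs => continuous_norm_weighted dF kap s (Hc s Hs)).
set c := exp (kap * s0) * _ in Hmax.
have key s : exp (- kap * (T - s)) = exp (- kap * T) * exp (kap * s) by rewrite -exp_plus;
  f_equal; ring.
have Hub s : 0 <= s <= t -> exp (- kap * (T - s)) * norm (d s) <=
  sup_on 0 t (fun tau => exp (- kap * (T - tau)) * norm (d tau)).
  apply: (sup_on_ub 0 t (fun tau => exp (- kap * (T - tau)) * norm (d tau)) s (exp
    (- kap * T) * c)) => r Hr.
  rewrite key Rmult_assoc; apply: Rmult_le_compat_l; first by left; apply: exp_pos.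
  have := Hmax r Hr; rewrite EdF //; lra.
split.
  apply: Rle_trans (Hub 0 ltac:(lra)); apply: Rmult_le_pos; [left; exact: exp_pos|exact: norm_ge_0].
move=> s Hs; apply/weight_le.
have := Hub s Hs; rewrite key => Hk.
have HT := exp_pos (kap * T).
have := Rmult_le_compat_l _ _ _ (Rlt_le _ _ HT) Hk.
have E1 : exp (kap * T) * exp (- kap * T) = 1 by
  rewrite -exp_plus (_ : kap * T + - kap * T = 0) ?exp_0 //; ring.
have -> : exp (kap * T) * (exp (- kap * T) * exp (kap * s) * norm (d s)) =
  exp (kap * T) * exp (- kap * T) * (exp (kap * s) * norm (d s)) by ring.
by rewrite E1 Rmult_1_l.
Qed.

Theorem theorem2
    (k : scalar_kind) (H : Hilbert k) (m : nat)
    (A : unbounded_operator H H) (Bb : unbounded_operator H (Kvec k m))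
    (S : R -> H -> H) (B : Kvec k m -> H)
    (lam : nat -> scalars k) (phi psi : nat -> H)
    (N0 : nat) (alpha xi : R)
    (varphi : R -> R) (t0 D0 : R) (K : Mat k m N0)
    (lambda Mlambda delta : R) :
  separable H ->
  boundary_control_system A Bb S B ->
  riesz_spectral (restrict_ker A Bb) lam phi ->
  biorthogonal phi psi ->
  (0 < N0)%nat ->
  0 < alpha ->
  (forall n, (N0 <= n)%nat -> sRe (lam n) <= - alpha) ->
  is_lub (fun r => exists n, (N0 <= n)%nat /\
            r = Cmod (toC k (lam n) / RtoC (sRe (lam n)))) xi ->
  let AN := A_trunc lam N0 in
  let BN := B_trunc A B lam psi N0 in
  stabilizable AN BN ->
  0 < t0 ->
  C1_on (fun _ => True) varphi ->
  transition_signal t0 varphi ->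
  0 < D0 ->
  let Acl := A_closed_loop AN BN K D0 in
  Hurwitz Acl ->
  0 < lambda ->
  1 <= Mlambda ->
  (forall t, 0 <= t ->
     op_norm (Mexp (scal (ofR k t) Acl)) <= Mlambda * exp (- lambda * t)) ->
  0 < delta < D0 ->
  Mlambda * op_norm (Mmul BN K)
    * (exp (op_norm Acl * delta) - exp (- lambda * delta)) < lambda ->
  exists kappa C1 C2 C3 C4 C5 C6 : R,
    0 < kappa < alpha /\
    0 < C1 /\ 0 < C2 /\ 0 < C3 /\ 0 < C4 /\ 0 < C5 /\ 0 < C6 /\
    forall (D : R -> R) (X0 : H) (d1 d2 : R -> Kvec k m),
      C1_on (fun t => 0 <= t) D ->
      (forall t, 0 <= t -> Rabs (D t - D0) <= delta) ->
      C1_on (V := real_space k (Kvec k m)) (fun t => 0 <= t) d1 ->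
      C1_on (V := real_space k (Kvec k m)) (fun t => 0 <= t) d2 ->
      forall (X : R -> H) (u : R -> Kvec k m),
        mild_solution A S B lam psi N0 K varphi D0 delta D X0 d1 d2 X u ->
        forall t, 0 <= t ->
          norm (X t)
            <= C1 * exp (- kappa * t) * norm X0
             + C2 * sup_on 0 t (fun tau => exp (- kappa * (t - tau)) * norm (d1 tau))
             + C3 * sup_on 0 (Rmax (t - (D0 - delta)) 0)
                      (fun tau => exp (- kappa * (t - tau)) * norm (d2 tau)) /\
          norm (u t)
            <= C4 * exp (- kappa * t) * norm X0
             + C5 * sup_on 0 t (fun tau => exp (- kappa * (t - tau)) * norm (d1 tau))
             + C6 * sup_on 0 t (fun tau => exp (- kappa * (t - tau)) * norm (d2 tau)).
Proof.
move=> _ Hbcs Hrs Hbi HN0 Halpha Hre Hxi AN BN _ Ht0 _ [_ [Hphi [_ Hphi1]]] HD0 Acl _ Hlambda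
  HM Hexp Hdelta Hgain.
pose V := real_space k (Kvec k N0).
pose U := real_space k (Kvec k m).
have [omega [Hom0 Hom]] : exists omega, 0 <= omega /\ forall n, sRe (lam n) <= omega.
  exists (l2 N0 (fun n => Rabs (sRe (lam n)))); split; first exact: l2_ge0.
  move=> n; have Hl := l2_ge0 N0 (fun n => Rabs (sRe (lam n))).
  case: (Nat.le_gt_cases N0 n) => Hn; first by have := Hre n Hn; lra.
  apply: Rle_trans (Rle_abs _) _.
  apply: (l2_coeff_le N0 (fun n => Rabs (sRe (lam n)))); [move=> ?; exact: Rabs_pos|lia].
have Hxin n : (N0 <= n)%nat -> abs (lam n) <= xi * - sRe (lam n).
  move=> Hn; have Hr := Hre n Hn.
  have := proj1 Hxi (Cmod (toC k (lam n) / RtoC (sRe (lam n)))) (ex_intro _ n (conj Hn eq_refl)).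
  have Hne : RtoC (sRe (lam n)) <> 0 by move=> /RtoC_inj; lra.
  rewrite Cmod_div // Cmod_R -abs_toC Rabs_left; last lra.
  by move/Rle_div_l; apply; lra.
have Hxi0 : 0 <= xi.
  have := Hxin N0 (le_n _); have := abs_ge_0 (lam N0); have := Hre N0 (le_n _) => Hr Ha1 Ha2.
  by apply: (Rmult_le_reg_r (- sRe (lam N0))); lra.
have HAr : @is_linear R_AbsRing V V (truncated_op k lam N0) by
  apply: (real_linear k (Kvec k N0) (Kvec k N0)); apply: Mmul_linear_r.
have HBr : @is_linear R_AbsRing U V (truncated_input k H m A B lam psi N0) by
  apply: (real_linear k (Kvec k m) (Kvec k N0)); apply: Mmul_linear_r.
have HKr : @is_linear R_AbsRing V U (fun x : Kvec k N0 => Mmul K x) by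
  apply: (real_linear k (Kvec k N0) (Kvec k m)); apply: Mmul_linear_r.
have HAclr : @is_linear R_AbsRing V V (fun x : Kvec k N0 => Mmul Acl x) by
  apply: (real_linear k (Kvec k N0) (Kvec k N0)); apply: Mmul_linear_r.
have EAcl (x : Kvec k N0) : Mmul Acl x = plus (truncated_op k lam N0 x)
    (expop (V := V) (truncated_op k lam N0) (- D0) (truncated_input k H m A B lam psi N0
      (Mmul K x)) : Kvec k N0).
  rewrite /Acl /A_closed_loop (linear_plus _ (Mmul_linear_l k _ _ _ x)); congr (plus _ _).
  rewrite /truncated_op /truncated_input -(Mexp_apply k N0 (A_trunc lam N0) (- D0)).
  rewrite /Mmul -!Mmult_assoc //.
have [kap [C [Hk0 [Hka [HC Hstab]]]]] := truncated_stability V U (truncated_op k lam N0)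
  (truncated_input k H m A B lam psi N0)
  (fun x : Kvec k N0 => Mmul K x) HAr HBr HKr (op_norm Acl) Mlambda lambda (op_norm
    (Mmul BN K)) alpha t0 D0 delta varphi
  (op_norm_ge0 _ _ _ Acl)
  (fun x => eq_ind _ (fun y : Kvec k N0 => norm y <=
    op_norm Acl * norm x) (norm_Mmul_op k _ _ Acl x) _ (EAcl x))
  ltac:(lra) Hlambda
  (fun t x Ht => eq_ind_r (fun y : Kvec k N0 => norm y <= Mlambda * exp (- lambda * t) * norm x)
     (eq_ind _ (fun y : Kvec k N0 => norm y <= Mlambda * exp (- lambda * t) * norm x)
        (Rle_trans _ _ _ (norm_Mmul_op k _ _ (Mexp (scal (ofR k t) Acl)) x)
          (Rmult_le_compat_r _ _ _ (norm_ge_0 x) (Hexp t Ht)))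
        _ (Mexp_apply k N0 Acl t x))
     (expop_ext V _ _ t x HAclr EAcl))
  (op_norm_ge0 _ _ _ _)
  (fun x => eq_ind_r (fun y : Kvec k N0 => norm y <=
    op_norm (Mmul BN K) * norm x) (norm_Mmul_op k _ _ (Mmul BN K) x) (Mmult_assoc _ _ _))
  Halpha Ht0 Hdelta Hphi Hphi1 Hgain.
have [cb [cu [Hcb [Hcu [Hb Hu]]]]] := riesz_frame k H phi psi (rs_basis _ _ _ Hrs) Hbi.
have Hp : 0 <= xi * alpha / (alpha - kap) by apply: Rdiv_le_0_compat; nra.
have Hq : 0 <= / (alpha - kap) by left; apply: Rinv_0_lt_compat; lra.
have [CX [HCX HstateX]] := state_from_modes k H m A B psi N0 cb cu _ _ Hcb Hcu Hp Hq Hb Hu.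
have [cy [Hcy HY]] := linear_norm _ (Y_linear k H psi N0).
pose Cu := C * (cy + 1).
have HCu : 0 < Cu by apply: Rmult_lt_0_compat; lra.
pose Cx := CX * (2 * Cu + 1).
have HCx : 0 < Cx by apply: Rmult_lt_0_compat; lra.
exists kap, Cx, Cx, Cx, Cu, Cu, Cu; do 7 (split; first by []).
move=> D X0 d1 d2 HD HDd Hd1 Hd2 X u Hmild t Ht.
have [Y [uF [v [d1F [DF [Hloop [HYX [HY0 [HuF [Hd1F Hmode]]]]]]]]]] :=
  mild_truncated_loop k H m A Bb S B lam phi psi N0 K varphi D0 delta omega Hbcs Hrs Hbi Hom0
    Hom Hdelta D X0 d1 d2 X u HD HDd Hd1 Hmild.
have [Hub Hxb] := Hstab Y uF v d1F d2 DF Hloop.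
have HYn : norm (Y 0) <= cy * norm X0 by rewrite HY0; apply: HY.
have Het := exp_pos (- kap * t).
have E1 : exp (kap * t) * exp (- kap * t) = 1 by
  rewrite -exp_plus (_ : kap * t + - kap * t = 0) ?exp_0 //; ring.
have Hx0 := norm_ge_0 X0.
have Hekt := exp_pos (kap * t).
have Cb a E : 0 <= E -> a <= C * (norm (Y 0) + E) * exp (- kap * t) ->
  a <= Cu * (norm X0 + E) * exp (- kap * t).
  move=> HE Ha; apply: Rle_trans Ha _; apply: Rmult_le_compat_r; first lra.
  rewrite /Cu Rmult_assoc; apply: Rmult_le_compat_l; first lra.
  have := Rmult_le_pos cy E ltac:(lra) HE; lra.
set s1 := sup_on 0 t (fun tau => exp (- kap * (t - tau)) * norm (d1 tau)).
have [P1 W1] : 0 <= s1 /\ forall s, 0 <= s <= t ->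
  norm (d1 s) <= exp (kap * t) * s1 * exp (- kap * s).
  exact: weighted_sup_bound.
(* Both disturbances are bounded by one constant E; T is max (t - (D0 - delta), 0) for the
   state and t for the input. *)
have Hdist T : 0 <= T -> let s2 := sup_on 0 T (fun tau => exp (- kap * (t - tau)) * norm
  (d2 tau)) in
    exists E, 0 <= s2 /\ 0 <= E /\ E * exp (- kap * t) = s1 + s2 /\
      (forall s, 0 <= s <= t -> norm (d1F s) <= E * exp (- kap * s)) /\
      (forall s, 0 <= s <= T -> norm (d2 s) <= E * exp (- kap * s)).
  move=> HT s2.
  have [P2 W2] : 0 <= s2 /\ forall s, 0 <= s <= T ->
    norm (d2 s) <= exp (kap * t) * s2 * exp (- kap * s).
    exact: weighted_sup_bound.
  exists (exp (kap * t) * (s1 + s2)); split=> //; split; first by apply: Rmult_le_pos; lra.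
  split; first by rewrite (Rmult_comm _ (s1 + s2)) Rmult_assoc E1 Rmult_1_r.
  split=> s Hs.
    rewrite Hd1F; last lra.
    apply: Rle_trans (W1 s Hs) _; apply: Rmult_le_compat_r; first by left; apply: exp_pos.
    apply: Rmult_le_compat_l; lra.
  apply: Rle_trans (W2 s Hs) _; apply: Rmult_le_compat_r; first by left; apply: exp_pos.
  apply: Rmult_le_compat_l; lra.
split.
- have [E [P2 [HE [HEe [HEb1 HEb2]]]]] := Hdist (Rmax (t - (D0 - delta)) 0) (Rmax_r _ _).
  set s2 := sup_on 0 (Rmax _ _) _ in P2 HEe *.
  have [HYt Hvt] := Hxb t E Ht HEb1 HEb2.
  pose W := Cu * (norm X0 + E).
  have HW : 0 <= W by apply: Rmult_le_pos; lra.
  have HCW : C * (norm (Y 0) + E) <= W.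
    rewrite /W /Cu Rmult_assoc; apply: Rmult_le_compat_l; first lra.
    have := Rmult_le_pos cy E ltac:(lra) HE; lra.
  have HX : norm (X t) <= CX * (norm X0 + W + W) * exp (- kap * t).
    apply: HstateX => // n Hn.
    + rewrite Rmult_comm; apply: (Rle_trans _ (norm (Y t))); last first.
        by apply: (Rle_trans _ _ _ HYt); apply: Rmult_le_compat_r; [left|exact: HCW].
      rewrite HYX // -(coeff_Y k H psi N0 (X t) n 0 Hn) //; exact: coeff_le_norm.
    + apply: (mode_bound k H m A B lam psi n X0 (X t) v t W kap xi alpha) => //; first exact: Hre.
      * exact: Hxin.
      * move=> s Hs; apply: Rle_trans (Hvt s Hs) _; apply: Rmult_le_compat_r => //; left;
        exact: exp_pos.
      * exact: Hmode.
  apply: Rle_trans HX _.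
  have -> : CX * (norm X0 + W + W) * exp (- kap * t) = CX * (1 +
    2 * Cu) * (exp (- kap * t) * norm X0) + CX * (2 * Cu) * (E * exp (- kap * t)) by
      rewrite /W; ring.
  rewrite HEe /Cx.
  have Q := Rmult_le_pos CX (s1 + s2) ltac:(lra) ltac:(lra).
  lra.
- have [E [P2 [HE [HEe [HEb1 HEb2]]]]] := Hdist t Ht.
  set s2 := sup_on 0 t (fun tau => _ * norm (d2 tau)) in P2 HEe *.
  have Hut := Hub t E HEb1 HEb2 Ht.
  rewrite HuF // in Hut.
  apply: Rle_trans (Cb _ E HE Hut) _.
  have -> : Cu * (norm X0 + E) * exp (- kap * t) = Cu * exp (- kap * t) * norm X0 +
    Cu * (E * exp (- kap * t)) by ring.
  rewrite HEe; lra.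
Qed.
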